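(* Let $\mathfrak g=\mathfrak{sl}(n,\mathbb C)$, let $\mathfrak p$ be the standard parabolic subalgebra with consecutive diagonal blocks of sizes $n_1,\dots,n_r$ (positive integers with sum $n$), let $\mathfrak p'$ be its derived algebra and $\mathfrak m$ its nilradical, and let $P'$ be the connected algebraic subgroup of $SL(n,\mathbb C)$ with Lie algebra $\mathfrak p'$, acting on $\mathfrak m$ by the adjoint action. Let $e+V$ be the linear subvariety of $\mathfrak m$ defined by the labelled lines in the tableau $\mathscr T$ of $(n_1,\dots,n_r)$ produced by the three-step construction described in the context, satisfying $(P_1)$ and $(P_2)$. Then $e+V$ is a Weierstrass section for the action of $P'$ on $\mathfrak m$.
   Context: The base field is $\mathbb C$; $\mathfrak p$ consists of block upper triangular trace-zero matrices; $x_{i,j}$ is the standard matrix unit. WEIERSTRASS SECTION. For a connected algebraic group $H$ acting on a vector space $M$, a Weierstrass section is a linear subvariety $e+V$ of $M$ ($e\in M$, $V\subset M$ a subspace) such that the restriction map $\mathbb C[M]^H\to\mathbb C[e+V]$ is an isomorphism. TABLEAU. The diagram of $(n_1,\dots,n_r)$ has top-aligned columns of boxes, from left to right of heights $n_1,\dots,n_r$; rows $R_1,R_2,\dots$ are counted from the top. $\mathscr T$ is obtained by inserting $1,\dots,n$ down the columns, going from left to right. Then $x_{i,j}\in\mathfrak m$ iff $i$ lies in a column strictly to the left of that of $j$. For boxes $b,b'$ write $b<b'$ (resp. $b\le b'$) if the column of $b$ is strictly to the left of (resp. to the left of or equal to) that of $b'$. Two columns are neighbouring of height $s$ if both have height $s$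 and no column between them has height $s$. Two boxes of a row are adjacent if no box of that row lies between them. $R^i$ is the union of $R_1,\dots,R_i$. LINES. A line joins a box $b$ (entry $i$) to a box $b'$ (entry $j$) with $b<b'$, represents $x_{i,j}$, and carries a label $0$ or $1$. A composite line is a concatenation of lines going strictly from left to right; composite lines are disjoint if they pass through no common box. From the final set of labelled lines, $e$ is the sum of the $x_{i,j}$ given by the lines labelled $1$, and $V$ is the direct sum of the $\mathbb Cx_{i,j}$ given by the lines labelled $0$. $(P_1)$: for all $s\ge1$ and between any two neighbouring columns $C,C'$ of height $s$, there is a permutation $\sigma$ of $1,\dots,s$ and a unique disjoint union of $s$ composite lines joining $C\cap R_i$ to $C'\cap R_{\sigma(i)}$. $(P_2)$: of the lines which make up the composite lines in the disjoint union joining the boxes of $C,C'$ given by $(P_1)$, all are labelled by $1$ except for exactly one, which is labelled by $0$. CONSTRUCTION. Step 1: draw all horizontal lines between adjacent boxes of the same row. Step 2: label every line $1$, except that for each pair of neighbouring columns $C,C'$ of height $s$ (with $C$ to the left), the rightmost line of the horizontal composite line in $R_s$ joining $C\cap R_s$ to $C'\cap R_s$ is labelled $0$. Step 3: proceed by stages $i=1,2,\dots$ down the rows. Some lines labelled $0$ get ''gated''; gated lines are not removed (they remain in the final set with label $0$). At stage $i$, for each pair of neighbouring columns $C,C'$ of height $i$, consider the ungated lines labelled $0$ in $R^{i-1}$ lying between $C$ and $C'$. If there are none, nothing is changed for this pair. Otherwise they join pairs $(b_j,b'_j)$, $j=1,\dots,u$, with $b_1<b'_1\le b_2<b'_2\le\dots\le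 b_u<b'_u$. Gate all of them. Let $b''_1<\dots<b''_v$ be the successive boxes of $R_i$ from $C\cap R_i$ to $C'\cap R_i$ (the line joining $b''_{v-1},b''_v$ is labelled $0$). Let $v_1$ be maximal with $b''_{v_1}<b'_1$. Delete the lines joining $b''_{v_1},b''_{v_1+1}$ and $b''_{v-1},b''_v$ (a single line if $v_1=v-1$). Join $b''_{v_1}$ to $b'_1$ by a line labelled $1$, and $b_u$ to $b''_v$ by a line labelled $0$ (the unique new ungated line between $C,C'$). (a) If $v_1=v-1$, also join $b_j$ to $b'_{j+1}$, for $1\le j\le u-1$, by lines labelled $1$. (b) If $v_1<v-1$, select columns $C_0=C,C_1,C_2,\dots,C_{2n}=C'$ ($n$ here being some positive integer) among $C$, $C'$ and the columns of height $>i$ between them, as follows: for $j$ even, $C_{j+1}$ is the rightmost such column with no ungated line (of those considered above) between $C_j$ and $C_{j+1}$ (possibly $C_{j+1}=C_j$); for $j$ odd, $C_{j+1}$ is the next such column to the right of $C_j$, so there is at least one ungated line between $C_j$ and $C_{j+1}$ and no column of height $>i$ strictly between them. Let $b''_{v_j}$ be the box $C_j\cap R_i$, $1\le j\le 2n$ (this agrees with the previous $v_1$, and $v_{2n}=v$). Delete the lines joining $b''_{v_j},b''_{v_{j+1}}$ for all odd $j$, $1\le j\le 2n-1$. For even $j$ with $2\le j\le 2n-1$, let $u_j$ be maximal with $b_{u_j}<b''_{v_j}$ and join $b_{u_j}$ to $b''_{v_j}$ by a line labelled $1$. For odd $j$ with $2\le j\le 2n-1$, let $u'_j$ be minimal with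 $b''_{v_j}<b'_{u'_j}$ and join $b''_{v_j}$ to $b'_{u'_j}$ by a line labelled $1$; here $u'_{j+1}=u_j+1$ for $j$ even. Finally join $b_k$ to $b'_{k+1}$ ($1\le k\le u-1$) by lines labelled $1$ as in (a), except for the pairs $(b_{u_j},b'_{u'_{j+1}})$ with $j$ even, $2\le j\le 2n-2$, which are not joined.
   Formalization: In Step 3(b), if no ungated line lies between the last column of height >i before C' and C' (e.g. (2,1,1,3,2)), no choice with C_{2n}=C' exists; there the line joining b''_{v-1}, b''_v is kept with label 0 and b_u is not joined to b''_v. *)

(* Defs.v *)
From HB Require Import structures.
From mathcomp Require Import all_boot all_order all_algebra.
From mathcomp Require Import perm classical_sets functions reals complex.
From mathcomp Require mpoly.

Set Implicit Arguments.
Unset Strict Implicit.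
Unset Printing Implicit Defensive.

Import Order.TTheory GRing.Theory Num.Theory.

Section Weierstrass.
Local Open Scope ring_scope.
Local Open Scope classical_set_scope.
Variables (K : fieldType) (M : vectType K).

(* K[M] for an infinite field K: polynomials in linear forms, so that no basis
   of M has to be chosen. *)
Definition polynomial_function (f : M -> K) : Prop :=
  exists (k : nat) (l : 'I_k -> {linear M -> K^o}) (p : mpoly.mpoly k K),
    forall x, f x = mpoly.meval (fun i => l i x) p.

Definition linear_subvariety (e : M) (V : {vspace M}) : set M :=
  [set x | x - e \in V].

(* K[A] for a closed subvariety A of M. *)
Definition regular_functions (A : set M) : set (A -> K) :=
  [set h | exists2 f, polynomial_function f & h = sigL A f].
Arguments regular_functions : clear implicits.

(* K[M]^H *)
Definition invariant_functions (gT : Type) (H : set gT) (act : gT -> M -> M) :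
    set (M -> K) :=
  [set f | polynomial_function f /\
           forall g, H g -> forall x, f (act g x) = f x].

(* Restriction is a morphism of algebras, so it is an isomorphism of algebras
   as soon as it is bijective. *)
Definition weierstrass_section (gT : Type) (H : set gT) (act : gT -> M -> M)
    (e : M) (V : {vspace M}) : Prop :=
  set_bij (invariant_functions H act)
          (regular_functions (linear_subvariety e V))
          (sigL (linear_subvariety e V)).

Definition zariski_closed (A : set M) : Prop :=
  exists2 F : set (M -> K), F `<=` polynomial_function &
    A = [set x | forall f, F f -> f x = 0].

Definition zariski_connected (A : set M) : Prop :=
  forall B C : set M, zariski_closed B -> zariski_closed C ->
    A `<=` B `|` C -> A `&` B `&` C = set0 -> A `<=` B \/ A `<=` C.

End Weierstrass.

Section AlgebraicGroups.
Local Open Scope ring_scope.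
Local Open Scope classical_set_scope.
Variables (K : fieldType) (n : nat).

(* SL_n is closed in 'M_n, so closed in SL_n and closed in 'M_n agree. *)
Record connected_algebraic_subgroup_SL (G : set 'M[K]_n) : Prop := {
  cas_SL : forall g, G g -> \det g = 1;
  cas_1 : G 1%:M;
  cas_M : forall g h, G g -> G h -> G (g *m h);
  cas_V : forall g, G g -> G (invmx g);
  cas_closed : zariski_closed G;
  cas_connected : zariski_connected G }.

(* The tangent space at the identity: the X killed by the differential at 1 of
   every polynomial function vanishing on G. For K infinite there is exactly
   one q with q.[t] = f (1 + t X) for all t. *)
Definition lie_algebra (G : set 'M[K]_n) : set 'M[K]_n :=
  [set X | forall f, polynomial_function f -> (forall g, G g -> f g = 0) ->
     forall q : {poly K}, (forall t, q.[t] = f (1%:M + t *: X)) ->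
       q^`().[0] = 0].

(* [L, L]: finite sums of commutators of elements of L. *)
Definition derived_algebra (L : set 'M[K]_n) : set 'M[K]_n :=
  [set X | exists (k : nat) (a b : 'I_k -> 'M[K]_n),
     (forall i, L (a i) /\ L (b i)) /\
     X = \sum_i (a i *m b i - b i *m a i)].

End AlgebraicGroups.

(* A composition ns = [:: n_1; ...; n_r] has columns numbered from 0 and rows
   numbered from 1. A box is given by its entry in the tableau, except that
   entries are numbered from 0, as are the rows and columns of matrices. *)
Section Tableau.
Local Open Scope nat_scope.
Variable ns : seq nat.

Definition height (k : nat) : nat := nth 0 ns k.
Definition col (b : nat) : nat := reshape_index ns b.
Definition row (b : nat) : nat := (reshape_offset ns b).+1.
Definition box (k i : nat) : nat := flatten_index ns k i.-1.

Definition boxes : seq nat := iota 0 (sumn ns).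

Definition ltb (b c : nat) : bool := col b < col c.

(* The boxes of R_i from column C to column C', from left to right. *)
Definition row_between (i C C' : nat) : seq nat :=
  [seq b <- boxes | (row b == i) && (C <= col b <= C')].

Definition neighbouring (s C C' : nat) : bool :=
  [&& C < C', C' < size ns, height C == s, height C' == s &
      all (fun k => height k != s) (iota C.+1 (C' - C.+1))].

Definition neighbours (s : nat) : seq (nat * nat) :=
  [seq CC <- [seq (C, C') | C <- iota 0 (size ns), C' <- iota 0 (size ns)]
   | neighbouring s CC.1 CC.2].

Definition line := (nat * nat)%type.

(* A set of labelled lines; gated0 is the part of lines0 that is gated. *)
Record diagram := Diagram {
  lines1 : seq line;
  lines0 : seq line;
  gated0 : seq line }.

Definition lines (D : diagram) : seq line := lines1 D ++ lines0 D.

Definition adjacent (b c : nat) : bool :=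
  [&& row b == row c, ltb b c &
      all (fun a => ~~ [&& row a == row b, ltb b a & ltb a c]) boxes].

Definition horizontal_lines : seq line :=
  [seq l <- [seq (b, c) | b <- boxes, c <- boxes] | adjacent l.1 l.2].

(* l is the last line of the horizontal composite line in R_s joining two
   neighbouring columns of height s. *)
Definition rightmost_line (l : line) : bool :=
  has (fun CC => (CC.1 <= col l.1) && (col l.2 == CC.2))
      (neighbours (row l.1)).

Definition initial_diagram : diagram :=
  Diagram [seq l <- horizontal_lines | ~~ rightmost_line l]
          [seq l <- horizontal_lines | rightmost_line l]
          [::].

(* The ungated lines labelled 0 in R^{i-1} between the columns C and C', from
   left to right. *)
Definition ungated (D : diagram) (i C C' : nat) : seq line :=
  sort (fun l l' => col l.1 <= col l'.1)
    [seq l <- lines0 D | [&& l \notin gated0 D, row l.1 < i, row l.2 < i,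
                             C <= col l.1 & col l.2 <= C']].

Definition update (del gate add1 add0 : seq line) (D : diagram) : diagram :=
  Diagram ([seq l <- lines1 D | l \notin del] ++ add1)
          ([seq l <- lines0 D | l \notin del] ++ add0)
          (gate ++ gated0 D).

Definition max_such (u : nat) (P : pred nat) : nat :=
  last 0 [seq p <- iota 1 u | P p].
Definition min_such (u : nat) (P : pred nat) : nat :=
  head 0 [seq p <- iota 1 u | P p].

(* The columns C_{j+1}, C_{j+2}, ... following C_j = Cj for j even, where U is
   the sequence of ungated lines and cs that of the columns to choose from.

   Pitfall: if U has no line to the right of the last column of height > i
   before C', the sequence reaches C' at an odd index, and no choice of
   columns ends with C_{2n} = C' as it should; we then stop there. *)
Fixpoint select_from (fuel : nat) (U : seq line) (cs : seq nat) (C' Cj : nat) :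
    seq nat :=
  let Cj1 := last Cj [seq c <- cs | (Cj <= c) &&
               all (fun l => ~~ ((Cj <= col l.1) && (col l.2 <= c))) U] in
  if Cj1 == C' then [:: C'] else
  let Cj2 := head C' [seq c <- cs | Cj1 < c] in
  if Cj2 == C' then [:: Cj1; C'] else
  if fuel is fuel'.+1 then
    [:: Cj1, Cj2 & select_from fuel' U cs C' Cj2]
  else [:: Cj1; Cj2].

(* [:: C_0; C_1; ...; C'] *)
Definition select (U : seq line) (i C C' : nat) : seq nat :=
  C :: select_from (size ns) U
         [seq c <- iota C (C' - C).+1 | [|| c == C, c == C' | i < height c]]
         C' C.

(* Stage i for a pair (C, C') of neighbouring columns of height i. The names
   b, b', b'', u, v, v1, vj, uj and u'j and the numbering from 1 are those of
   the usual description of the construction: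

     U = ((b 1, b' 1), ..., (b u, b' u))   and   b'' 1, ..., b'' v in R_i.

   The boolean closed says that U has a line to the right of the last column
   of height > i between C and C' (always so in case (a)). Otherwise (see
   select_from) the line joining b'' (v - 1) to b'' v is left in place with its
   label 0 and remains the unique ungated line, and b u, which gets joined to
   the box in R_i of that last column, is not joined to b'' v. For instance
   for ns = (2,1,1,3,2), deleting that line and joining b u to b'' v instead
   would leave no line starting from the box in R_2 of the column of height 3,
   and the invariant attached to the two columns of height 2 would vanish
   identically on e + V. *)
Definition reroute (i : nat) (D : diagram) (CC : nat * nat) : diagram :=
  let: (C, C') := CC in
  let U := ungated D i C C' in
  if U isn't l0 :: _ then D else
  let u := size U in
  let b j := (nth l0 U j.-1).1 in
  let b' j := (nth l0 U j.-1).2 in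
  let R := row_between i C C' in
  let v := size R in
  let b'' t := nth 0 R t.-1 in
  let v1 := max_such v (fun t => ltb (b'' t) (b' 1)) in
  if v1 == v.-1 then
    update [:: (b'' v1, b'' v)]
           U
           ((b'' v1, b' 1) :: [seq (b j, b' j.+1) | j <- iota 1 u.-1])
           [:: (b u, b'' v)] D
  else
    let Cs := select U i C C' in
    let m := (size Cs).-1 in
    let closed := ~~ odd m in
    let vj j := (index (nth 0 Cs j) [seq col a | a <- R]).+1 in
    let uj j := max_such u (fun k => ltb (b k) (b'' (vj j))) in
    let u'j j := min_such u (fun k => ltb (b'' (vj j)) (b' k)) in
    let odds := [seq j <- iota 1 m.-1 | odd j] in
    let inner_odds := [seq j <- odds | 2 <= j] in
    let inner_evens := [seq j <- iota 2 m.-2 | ~~ odd j] in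
    let omitted := [seq uj j | j <- inner_evens] in
    update ([:: (b'' v1, b'' v1.+1)]
              ++ (if closed then [:: (b'' v.-1, b'' v)] else [::])
              ++ [seq (b'' (vj j), b'' (vj j.+1)) | j <- odds])
           U
           ([:: (b'' v1, b' 1)]
              ++ [seq (b (uj j), b'' (vj j)) | j <- inner_evens]
              ++ [seq (b'' (vj j), b' (u'j j)) | j <- inner_odds]
              ++ [seq (b k, b' k.+1) | k <- iota 1 u.-1 & k \notin omitted])
           (if closed then [:: (b u, b'' v)] else [::]) D.

(* Distinct pairs of neighbouring columns of the same height do not interact,
   so the order in which they are treated does not matter. *)
Definition stage (D : diagram) (i : nat) : diagram :=
  foldl (reroute i) D (neighbours i).

Definition final_diagram : diagram :=
  foldl stage initial_diagram (iota 1 (foldr maxn 0 ns)).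

(* A composite line is given by the sequence of boxes it passes through. *)
Definition composite_line (D : diagram) (b c : nat) (p : seq nat) : Prop :=
  exists2 q, p = b :: q &
    path (fun a a' => (a, a') \in lines D) b q /\ last b q = c.

Definition lines_of (p : seq nat) : seq line := zip p (behead p).

Definition disjoint_union (D : diagram) (s C C' : nat)
    (c : s.-tuple (seq nat)) : Prop :=
  (exists sigma : 'S_s, forall i : 'I_s,
     composite_line D (box C i.+1) (box C' (sigma i).+1) (tnth c i)) /\
  (forall (i j : 'I_s) a, a \in tnth c i -> a \in tnth c j -> i = j).

Definition P1 (D : diagram) : Prop :=
  forall s C C', 1 <= s -> neighbouring s C C' ->
    exists! c : s.-tuple (seq nat), disjoint_union D C C' c.

Definition P2 (D : diagram) : Prop :=
  forall s C C' (c : s.-tuple (seq nat)), 1 <= s -> neighbouring s C C' ->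
    disjoint_union D C C' c ->
    let L := flatten [seq lines_of p | p <- c] in
    exists2 l0, l0 \in L /\ l0 \in lines0 D &
      forall l, l \in L -> l != l0 -> l \in lines1 D /\ l \notin lines0 D.

End Tableau.

Section Parabolic.
Local Open Scope ring_scope.
Local Open Scope classical_set_scope.
Variables (K : fieldType) (ns : seq nat).
Local Notation n := (sumn ns).

Definition parabolic : set 'M[K]_n :=
  [set X | \tr X = 0 /\
           forall i j : 'I_n, (col ns j < col ns i)%N -> X i j = 0].

Definition span_units (P : rel 'I_n) : {vspace 'M[K]_n} :=
  <<[seq delta_mx ij.1 ij.2 | ij <- enum [pred ij | P ij.1 ij.2]]>>%VS.

Definition nilradical : {vspace 'M[K]_n} :=
  span_units (fun i j => (col ns i < col ns j)%N).

(* The P'-module m as a vector space in its own right. *)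
Definition mspace : vectType K := subvs_of nilradical.

(* Conjugation by P' preserves m, on which vsproj is the identity. *)
Definition adjoint (g : 'M[K]_n) (x : mspace) : mspace :=
  vsproj nilradical (g *m vsval x *m invmx g).

(* The lines join boxes of a column to boxes of a column to its right, so all
   the matrix units below are in m. *)
Definition e_of (D : diagram) : mspace :=
  vsproj nilradical
    (\sum_(i < n) \sum_(j < n | ((i : nat), (j : nat)) \in lines1 D)
       delta_mx i j).

Definition V_of (D : diagram) : {vspace mspace} :=
  (linfun (vsproj nilradical) @:
     span_units (fun i j => ((i : nat), (j : nat)) \in lines0 D))%VS.

End Parabolic.

Arguments parabolic : clear implicits.
Arguments e_of : clear implicits.
Arguments V_of : clear implicits.
Arguments adjoint : clear implicits.

(* Main.v *)
From HB Require Import structures.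
From mathcomp Require Import all_boot all_order all_algebra.
From mathcomp Require Import boolp classical_sets functions reals complex.
From mathcomp Require Import perm zify ring.
From mathcomp Require Import -(notations) mpoly.
Require Import Defs.

Set Implicit Arguments.
Unset Strict Implicit.
Unset Printing Implicit Defensive.

Import GRing.Theory Num.Theory.

(* Order the boxes by columns, from bottom to top in each column. Between
   neighbouring columns [C], [C'] of height [s], each box [y] of [R^s] to the
   right of [C] is entered by a line whose start [g y] is smaller than that of
   every other line ending at [y], [g] is injective, and [(g y, y)] is labelled 0
   exactly when [y] is the box of [C'] in [R_s]. A greedy argument then shows
   that the lines [(g y, y)] form the only disjoint union of composite lines.

   The invariant attached to [C], [C'] (Benlolo-Sanderson) is the lowest
   coefficient in [t] of the minor of [t + x] whose rows are the boxes from [C]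
   on, before [C'], and whose columns are those after [C], up to [C']. By the
   same greedy argument only one permutation contributes to it on [e + V], where
   it equals, up to sign, the coordinate given by the line labelled 0 into [C'].
   These lines exhaust those labelled 0, so the invariants are coordinates on
   [e + V], and every function on [e + V] extends to an invariant.

   For the injectivity of the restriction, let [x_R] be the sum of all horizontal
   lines. Its orbit under [P] is dense, and [P x_R] is the union of the [P']-orbits
   of the [t x_R t^-1] with [t] in a torus on which the coordinates are, up to
   sign, products of inverses of the above invariants. So every invariant is a
   Laurent polynomial in these, and vanishes as soon as it does on [e + V].

   Finally [P'] consists of the block triangular matrices whose diagonal blocks
   have determinant 1: it contains the exponentials of the nilpotent matrix units
   of [p'], the characters of what remains have finite order since blocks of [p']
   have trace 0, and they are trivial since [P'] is connected. *)

(** * Boxes, neighbours and keys *)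

(** The obstacle in the combinatorics is that a later stage reroutes lines across regions already
    treated, while the conclusion concerns all heights at once. Stage [i] permutes starts cyclically
    inside each gap between consecutive columns of height at least [i]. The end of an ungated line
    gets a start preceding the old one, thanks to the order from bottom to top, and the old line
    stays as a worse choice. Between neighbouring columns of smaller height [s] at most one ungated
    line starting in R^s remains after stage [s], the one into the last box, so no later stage draws
    a line starting in R^s there. Hence the [g] of stage [s] is frozen, although the global [f]
    keeps changing. On the algebraic side, diagonal matrices depending on the row only commute with
    [x_R]; they normalise one block determinant for each height, so that the torus keeps one
    coordinate for each pair of neighbouring columns. Division is avoided: on the dense orbit, hence
    everywhere, an invariant times a product of basic ones is a polynomial in these, and this
    product, nonzero at [x_R], is cancelled by restriction to lines. *)

Section FilterIota.
Variables (P : pred nat).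

Lemma last_filter_iota x0 a n c0 : a <= c0 < a + n -> P c0 ->
  let m := last x0 [seq c <- iota a n | P c] in
  [/\ a <= m < a + n, P m & forall c, a <= c < a + n -> P c -> c <= m].
Proof.
elim: n => [|n IHn] hc Pc0 m; first by lia.
rewrite /m -addn1 iotaD filter_cat /=.
have [Pn|nPn] := boolP (P (a + n)).
  by rewrite last_cat /=; split=> // [|c ? _]; lia.
rewrite cats0.
have hc' : a <= c0 < a + n.
  by case: (eqVneq c0 (a + n)) => [E|]; [rewrite E (negPf nPn) in Pc0|lia].
have [h1 h2 h3] := IHn hc' Pc0; split=> // [|c hcn Pc]; first by lia.
case: (eqVneq c (a + n)) => [E|ne]; first by rewrite E (negPf nPn) in Pc.
by apply: h3 => //; lia.
Qed.

Lemma head_filter_iota x0 a n c0 : a <= c0 < a + n -> P c0 ->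
  let m := head x0 [seq c <- iota a n | P c] in
  [/\ a <= m < a + n, P m & forall c, a <= c < a + n -> P c -> m <= c].
Proof.
elim: n a => [|n IHn] a hc Pc0 m; first by lia.
rewrite /m /=; have [Pn|nPn] := boolP (P a).
  by split=> // [|c ? _] /=; lia.
have hc' : a.+1 <= c0 < a.+1 + n.
  by case: (eqVneq c0 a) => [E|]; [rewrite E (negPf nPn) in Pc0|lia].
have [h1 h2 h3] := IHn _ hc' Pc0; split=> // [|c hcn Pc]; first by lia.
case: (eqVneq c a) => [E|ne]; first by rewrite E (negPf nPn) in Pc.
by apply: h3 => //; lia.
Qed.

End FilterIota.

Section Boxes.
Variable ns : seq nat.
Local Notation N := (sumn ns).
Local Notation h := (height ns).
Local Notation col := (col ns).
Local Notation row := (row ns).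
Local Notation box := (box ns).

Definition inbox k i := 0 < i <= h k.

Lemma col_box k i : inbox k i -> col (box k i) = k.
Proof. by move=> hi; apply: flatten_indexKl; rewrite /inbox /height in hi; lia. Qed.

Lemma row_box k i : inbox k i -> row (box k i) = i.
Proof.
move=> hi; rewrite /row flatten_indexKr; rewrite /inbox /height in hi; lia.
Qed.

Lemma box_lt k i : inbox k i -> box k i < N.
Proof. by move=> hi; apply: flatten_indexP; rewrite /inbox /height in hi; lia. Qed.

Lemma boxK b : box (col b) (row b) = b.
Proof. exact: reshape_indexK. Qed.

Lemma row_gt0 b : 0 < row b. Proof. by []. Qed.

Lemma row_le b : b < N -> row b <= h (col b).
Proof. exact: reshape_offsetP. Qed.

Lemma col_lt b : b < N -> col b < size ns.
Proof. exact: reshape_indexP. Qed.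

Lemma inbox_box b : b < N -> inbox (col b) (row b).
Proof. by move=> hb; rewrite /inbox row_gt0 row_le. Qed.

Lemma eq_box b c : col b = col c -> row b = row c -> b = c.
Proof. by move=> e1 e2; rewrite -(boxK b) e1 e2 boxK. Qed.

Lemma height_lt k : 0 < h k -> k < size ns.
Proof. by rewrite /height; case: (ltnP k (size ns)) => // hk; rewrite nth_default. Qed.

Lemma height_le_sum k : h k <= N.
Proof.
rewrite /height; elim: ns k => [|a s IH] [|k] //=; first by lia.
by have := IH k; lia.
Qed.

(* Orders the boxes by columns, from the bottom to the top of each column. *)
Definition key b := col b * N.+1 + (N - row b).

Lemma key_col x y : col x < col y -> key x < key y.
Proof. rewrite /key => hxy; nia. Qed.

Lemma key_row x y : x < N -> col x = col y -> row y < row x -> key x < key y.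
Proof.
rewrite /key => hx -> hxy; have := row_le hx; have := height_le_sum (col x); lia.
Qed.

Lemma key_inj x y : x < N -> y < N -> key x = key y -> x = y.
Proof.
move=> hx hy e; case: (ltngtP (col x) (col y)) => hc.
- by have := key_col hc; lia.
- by have := key_col hc; lia.
case: (ltngtP (row x) (row y)) => hr; last exact: eq_box.
- by have := key_row hy (esym hc) hr; lia.
- by have := key_row hx hc hr; lia.
Qed.

(** [lcol] searches strictly left of [k], [rcol] from [k] on. The range of [rcol] overshoots the
    last column, where heights default to 0. *)
Definition lcol i k := last 0 [seq c <- iota 0 k | i <= h c].
Definition rcol i k := head 0 [seq c <- iota k (size ns) | i <= h c].

Lemma lcolP i k c0 : c0 < k -> i <= h c0 ->
  [/\ lcol i k < k, i <= h (lcol i k), c0 <= lcol i k &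
      forall c, lcol i k < c < k -> h c < i].
Proof.
move=> hc0 hi.
have [h1 h2 h3] := @last_filter_iota (fun c => i <= h c) 0 0 k c0 hc0 hi.
split=> //; first exact: h3.
move=> c hc; rewrite ltnNge; apply/negP => hic.
by have := h3 c; rewrite /lcol in hc *; lia.
Qed.

Lemma rcolP i k c0 : 0 < i -> k <= c0 -> i <= h c0 ->
  [/\ k <= rcol i k <= c0, i <= h (rcol i k) &
      forall c, k <= c < rcol i k -> h c < i].
Proof.
move=> i0 hc0 hi.
have hs : c0 < size ns by apply: height_lt; lia.
have hc1 : k <= c0 < k + size ns by lia.
have [h1 h2 h3] := @head_filter_iota (fun c => i <= h c) 0 k _ c0 hc1 hi.
split=> //.
  by have := h3 c0 hc1 hi; rewrite /rcol; lia.
move=> c hc; rewrite ltnNge; apply/negP => hic.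
have := h3 c0 hc1 hi => hle; rewrite /rcol in hc *.
by have := h3 c; rewrite hic; lia.
Qed.

Lemma lcol_uniq i k p : p < k -> i <= h p -> (forall c, p < c < k -> h c < i) ->
  lcol i k = p.
Proof.
move=> hp hi hn; have [h1 h2 h3 h4] := lcolP hp hi.
case: (ltngtP p (lcol i k)) h3 => // hlt _.
by have := hn (lcol i k); lia.
Qed.

Definition hasl y := [exists c : 'I_(col y), row y <= h c].

Lemma haslP y : reflect (exists2 c, c < col y & row y <= h c) (hasl y).
Proof.
apply: (iffP existsP) => [[c hc]|[c hc hr]]; first by exists c.
by exists (Ordinal hc).
Qed.

(** The left neighbour in the row; meaningful only under [hasl], otherwise the default column 0
    enters. *)
Definition lnbr y := box (lcol (row y) (col y)) (row y).

Lemma lnbrP y : hasl y ->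
  [/\ lnbr y < N, col (lnbr y) < col y, row (lnbr y) = row y,
      col (lnbr y) = lcol (row y) (col y) &
      forall c, col (lnbr y) < c < col y -> h c < row y].
Proof.
case/haslP=> c hc hr; have [h1 h2 h3 h4] := lcolP hc hr.
have hi : inbox (lcol (row y) (col y)) (row y) by rewrite /inbox row_gt0.
by rewrite /lnbr col_box // row_box // box_lt.
Qed.

Lemma adjacentE x y : x < N -> y < N -> adjacent ns x y = hasl y && (x == lnbr y).
Proof.
move=> hx hy; apply/idP/idP.
  case/and3P=> /eqP hr hl /allP ha.
  have hh : hasl y by apply/haslP; exists (col x); rewrite // -hr row_le.
  rewrite hh /=; apply/eqP; rewrite -(boxK x) hr /lnbr; congr box.
  apply/esym/lcol_uniq => //; first by rewrite -hr row_le.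
  move=> c hc; rewrite ltnNge; apply/negP=> hcr.
  have hi : inbox c (row y) by rewrite /inbox row_gt0.
  have := ha (box c (row y)); rewrite mem_iota /= add0n box_lt // => /(_ isT).
  by rewrite /ltb col_box // row_box // hr eqxx hc.
case/andP=> hh /eqP->; have [h1 h2 h3 h4 h5] := lnbrP hh.
rewrite /adjacent h3 eqxx /ltb h2 /=; apply/allP => a.
rewrite mem_iota /= add0n => ha; apply/negP => /andP[/eqP e /h5].
by have := row_le ha; lia.
Qed.

Definition nonfirst q := [exists c : 'I_q, h c == h q].

Definition prevcol q := last 0 [seq c <- iota 0 q | h c == h q].

Lemma prevcolP q : nonfirst q ->
  [/\ prevcol q < q, h (prevcol q) = h q &
      forall c, prevcol q < c < q -> h c != h q].
Proof.
case/existsP=> c hc.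
have [h1 /eqP h2 h3] :=
  @last_filter_iota (fun c => h c == h q) 0 0 q c (ltn_ord c) hc.
split=> // d hd; apply/negP => e.
by have := h3 d; rewrite /prevcol in hd *; lia.
Qed.

Lemma neighbouringP s C C' : 0 < s ->
  reflect [/\ C < C', C' < size ns, h C = s, h C' = s &
           forall c, C < c < C' -> h c <> s] (neighbouring ns s C C').
Proof.
move=> s0; apply: (iffP idP).
  case/and5P=> h1 h2 /eqP h3 /eqP h4 /allP h5; split=> // c hc.
  by apply/eqP/h5; rewrite mem_iota; lia.
case=> h1 h2 h3 h4 h5; apply/and5P; split; rewrite ?h3 ?h4 //.
apply/allP => c; rewrite mem_iota => hc; apply/eqP/h5; lia.
Qed.

Lemma neighbouring_nonfirst s C C' : 0 < s -> neighbouring ns s C C' ->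
  nonfirst C' /\ C = prevcol C'.
Proof.
move=> s0 /(neighbouringP _ _ s0)[h1 h2 h3 h4 h5].
have hn : nonfirst C' by apply/existsP; exists (Ordinal h1); rewrite /= h3 h4.
split=> //; have [p1 p2 p3] := prevcolP hn.
case: (ltngtP C (prevcol C')) => // hc.
  by have := h5 (prevcol C'); lia.
by have := p3 C; rewrite h3 h4 eqxx hc h1 => /(_ isT).
Qed.

Lemma nonfirst_neighbouring q : nonfirst q -> 0 < h q ->
  neighbouring ns (h q) (prevcol q) q.
Proof.
move=> hn h0; have [p1 p2 p3] := prevcolP hn.
apply/neighbouringP => //; split=> //; first exact: height_lt.
by move=> c /p3/eqP.
Qed.

Lemma mem_neighbours s CC : (CC \in neighbours ns s) =
   neighbouring ns s CC.1 CC.2.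
Proof.
rewrite mem_filter andbC; case: CC => C C' /=.
have [hn|] := boolP (neighbouring ns s C C'); rewrite ?andbF ?andbT //.
apply/allpairsP; exists (C, C'); case/and5P: hn => h1 h2 _ _ _.
by rewrite !mem_iota /=; split=> //; lia.
Qed.

End Boxes.

(** * One step of the construction *)

Section Reroute.
Variable ns : seq nat.
Local Notation N := (sumn ns).
Local Notation h := (height ns).
Local Notation col := (col ns).
Local Notation row := (row ns).
Local Notation box := (box ns).

Variables (i C C' : nat) (U : seq (nat * nat)) (d0 : nat * nat).
Hypothesis i_gt0 : 0 < i.
Hypothesis nbCC' : neighbouring ns i C C'.
Local Notation b k := (nth d0 U k).1.
Local Notation b' k := (nth d0 U k).2.
Local Notation u := (size U).

Hypothesis U_line : forall k, k < u ->
  [/\ C <= col (b k), col (b k) < col (b' k), col (b' k) <= C',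
      h (col (b' k)) < i &
      forall c, i <= h c -> ~~ (col (b k) < c < col (b' k))].
Hypothesis U_chain : forall k, k.+1 < u -> col (b' k) <= col (b k.+1).

(** An ungated line jumps over no column of height at least [i], so it sits in one gap between two
    consecutive such columns, [gapl k] and [gapr k]. The column of [b k] may itself be the left end,
    whence the successor; the column of [b' k] is too short to be the right end. Apart from a
    possible last [C'], the columns [C_j] of the construction are the left ends of the gaps for [j]
    odd and their right ends for [j] even and positive. *)
Definition gapl k := lcol ns i (col (b k)).+1.
Definition gapr k := rcol ns i (col (b' k)).

Let C_lt : C < C'. Proof. by case: (neighbouringP _ _ _ i_gt0 nbCC'). Qed.
Let hC : h C = i. Proof. by case: (neighbouringP _ _ _ i_gt0 nbCC'). Qed.
Let hC' : h C' = i. Proof. by case: (neighbouringP _ _ _ i_gt0 nbCC'). Qed.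

Lemma gapP k : k < u ->
  [/\ C <= gapl k, gapl k <= col (b k), col (b' k) < gapr k, gapr k <= C' &
  [/\ i <= h (gapl k), i <= h (gapr k) & forall c, gapl k < c < gapr k -> h c < i]].
Proof.
move=> hk; have [h1 h2 h3 h4 h5] := U_line hk.
have hC0 : i <= h C by rewrite hC.
have hC0' : i <= h C' by rewrite hC'.
have h1' : C < (col (b k)).+1 by lia.
have [l1 l2 l3 l4] := lcolP h1' hC0.
have [r1 r2 r3] := rcolP i_gt0 h3 hC0'.
rewrite /gapl /gapr; split=> //; try lia.
  case: (ltngtP (col (b' k)) (rcol ns i (col (b' k)))) => // [hh|hh]; first by lia.
  by rewrite -hh in r2; lia.
split=> // c hc; case: (leqP c (col (b k))) => hcb; first by apply: l4; lia.
case: (leqP (col (b' k)) c) => hcb'; first by apply: r3; lia.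
by rewrite ltnNge; apply/negP => hic; move/negP: (h5 _ hic); lia.
Qed.

Lemma b_ltb' k : k < u -> col (b k) < col (b' k).
Proof. by move=> hk; have [] := U_line hk. Qed.

Lemma b_le j k : j <= k -> k < u -> col (b j) <= col (b k).
Proof.
move=> /subnKC <-; elim: (k - j) => [|d IH]; first by rewrite addn0.
rewrite addnS => hd; apply: leq_trans (IH _) _; first by lia.
have hd' : j + d < u by lia.
by have := U_chain hd; have := b_ltb' hd'; lia.
Qed.

Lemma b'_le_b j k : j < k -> k < u -> col (b' j) <= col (b k).
Proof.
by move=> hjk hk; apply: leq_trans (U_chain _) (b_le hjk hk); lia.
Qed.

Lemma b_lt j k : j < k -> k < u -> col (b j) < col (b k).
Proof.
move=> hjk hk; apply: leq_trans (b'_le_b hjk hk).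
by have [] := @U_line j (ltn_trans hjk hk).
Qed.

Lemma gap_eq j k : j < u -> k < u -> gapl j < gapr k -> gapl k < gapr j ->
  gapl j = gapl k /\ gapr j = gapr k.
Proof.
move=> hj hk h1 h2.
have [j1 j2 j3 j4 [j5 j6 j7]] := gapP hj.
have [k1 k2 k3 k4 [k5 k6 k7]] := gapP hk.
split; [case: (ltngtP (gapl j) (gapl k)) => // hlt
       |case: (ltngtP (gapr j) (gapr k)) => // hlt].
- by have := j7 (gapl k); lia.
- by have := k7 (gapl j); lia.
- by have := k7 (gapr j); have := b_ltb' hj; lia.
- by have := j7 (gapr k); have := b_ltb' hk; lia.
Qed.

Lemma gapl_lt k : k < u -> gapl k < gapr k.
Proof. by move=> hk; have [? ? ? ? _] := gapP hk; have := b_ltb' hk; lia. Qed.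

Lemma gapl_eqr j k : j < u -> k < u -> gapl j = gapl k -> gapr j = gapr k.
Proof.
move=> hj hk e; have := gapl_lt hj; have := gapl_lt hk => h1 h2.
by case: (@gap_eq j k) => //; lia.
Qed.

Lemma gapl_le j k : j <= k -> k < u -> gapl j <= gapl k.
Proof.
move=> hjk hk; have hj : j < u by lia.
have [j1 j2 j3 j4 [j5 j6 j7]] := gapP hj.
have [k1 k2 k3 k4 [k5 k6 k7]] := gapP hk.
have := b_le hjk hk => hb.
rewrite leqNgt; apply/negP => hlt.
by have := k7 (gapl j); have := b_ltb' hk; lia.
Qed.

(** These single out the last and the first ungated line of a gap; [lo k] is the new start of the
    composite line through [b' k]. Lines are numbered from 0 here, but from 1 in [reroute]. *)
Definition lastk k := (k.+1 == u) || (gapl k.+1 != gapl k).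
Definition firstk k := (k == 0) || (gapl k.-1 != gapl k).
Definition lo k := if firstk k then box (gapl k) i else b k.-1.

Lemma lastk_uniq j k : j < u -> k < u -> lastk j -> lastk k ->
  gapl j = gapl k -> j = k.
Proof.
move=> hj hk lj lk e; case: (ltngtP j k) => // hlt.
  case/orP: lj => [|/eqP]; first by lia.
  by have := @gapl_le j j.+1; have := @gapl_le j.+1 k; lia.
case/orP: lk => [|/eqP]; first by lia.
by have := @gapl_le k k.+1; have := @gapl_le k.+1 j; lia.
Qed.

Lemma firstk_uniq j k : j < u -> k < u -> firstk j -> firstk k ->
  gapl j = gapl k -> j = k.
Proof.
move=> hj hk lj lk e; case: (ltngtP j k) => // hlt.
  case/orP: lk => [|/eqP]; first by lia.
  by have := @gapl_le j k.-1; have := @gapl_le k.-1 k; lia.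
case/orP: lj => [|/eqP]; first by lia.
by have := @gapl_le k j.-1; have := @gapl_le j.-1 j; lia.
Qed.

Definition rcols := [seq c <- iota C (C' - C).+1 | i <= h c].

Lemma mem_rcols c : (c \in rcols) = (C <= c <= C') && (i <= h c).
Proof. by rewrite mem_filter mem_iota andbC; congr (_ && _); lia. Qed.

Lemma rcols_sorted : sorted ltn rcols.
Proof. by apply: sorted_filter (iota_ltn_sorted _ _); apply: ltn_trans. Qed.

Lemma rcols_ltn c d : c \in rcols -> d \in rcols ->
  (index c rcols < index d rcols) = (c < d).
Proof.
have H x y : x \in rcols -> y \in rcols -> index x rcols < index y rcols -> x < y.
  move=> hx hy; exact: (@sorted_ltn_index _ ltn ltn_trans _ rcols_sorted).
move=> hc hd; apply/idP/idP; first exact: H.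
move=> hcd; rewrite ltnNge leq_eqVlt; apply/negP => /orP[/eqP e|/H]; last first.
  by move=> /(_ hd hc); lia.
by have := congr1 (nth 0 rcols) e; rewrite !nth_index //; lia.
Qed.

Lemma rcols_succ c d : c \in rcols -> d \in rcols -> c < d ->
  (forall e, c < e < d -> h e < i) -> index d rcols = (index c rcols).+1.
Proof.
move=> hc hd hcd hn; have := rcols_ltn hc hd; rewrite hcd => hlt.
apply/eqP; rewrite eq_sym eqn_leq hlt /= leqNgt; apply/negP => hlt2.
have hs : (index c rcols).+1 < size rcols.
  by apply: ltn_trans hlt2 _; rewrite index_mem.
set e := nth 0 rcols (index c rcols).+1.
have he : e \in rcols by rewrite mem_nth.
have ie : index e rcols = (index c rcols).+1.
  by rewrite index_uniq // (sorted_uniq ltn_trans ltnn rcols_sorted).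
have h1 : c < e by rewrite -rcols_ltn // ie.
have h2 : e < d by rewrite -rcols_ltn // ie.
have := hn e; rewrite h1 h2 => /(_ isT).
by move: he; rewrite mem_rcols; lia.
Qed.

Lemma C'_rcols : C' \in rcols. Proof. rewrite mem_rcols hC'; lia. Qed.
Lemma C_rcols : C \in rcols. Proof. rewrite mem_rcols hC; lia. Qed.

Lemma index_C' : (index C' rcols).+1 = size rcols.
Proof.
have hm := C'_rcols; apply/eqP; rewrite eqn_leq index_mem hm /= leqNgt.
apply/negP => hlt; have he := mem_nth 0 hlt.
have hi : index (nth 0 rcols (index C' rcols).+1) rcols = (index C' rcols).+1.
  by rewrite index_uniq // (sorted_uniq ltn_trans ltnn rcols_sorted).
have := rcols_ltn hm he; rewrite hi ltnSn => /esym.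
by move: he; rewrite mem_rcols; lia.
Qed.

Lemma inbox_rcols c : c \in rcols -> inbox ns c i.
Proof. by rewrite mem_rcols /inbox => /andP[_ ->]; rewrite i_gt0. Qed.

Lemma ltn_col x y : col x < col y -> x < y.
Proof.
by rewrite ltnNge [in X in _ -> X]ltnNge; apply: contra; rewrite (reshape_leq ns);
  rewrite -/(Defs.col ns x) -/(Defs.col ns y); lia.
Qed.

Lemma row_betweenE : row_between ns i C C' = [seq box c i | c <- rcols].
Proof.
apply: (@irr_sorted_eq _ ltn ltn_trans ltnn).
- by apply: sorted_filter (iota_ltn_sorted _ _); apply: ltn_trans.
- have := rcols_sorted; have : {subset rcols <= rcols} by [].
  move: {-2}rcols; elim=> // a s IH; rewrite /= => hs.
  have : {subset s <= rcols} by move=> x hx; apply: hs; rewrite inE hx orbT.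
  case: s IH hs => //= c s IH hs hs' /andP[hac hp]; rewrite IH // andbT.
  by apply: ltn_col; rewrite !col_box //; apply/inbox_rcols/hs; rewrite !inE eqxx ?orbT.
move=> x; rewrite mem_filter mem_iota /= add0n; apply/idP/mapP.
  case/andP=> /andP[/eqP hr hc] hx; exists (col x); last by rewrite -hr boxK.
  by rewrite mem_rcols hc -hr row_le.
case=> c hc ->; have hi := inbox_rcols hc.
rewrite row_box // col_box // box_lt // eqxx /=.
by move: hc; rewrite mem_rcols; lia.
Qed.

Lemma gapl_rcols k : k < u -> gapl k \in rcols.
Proof.
by move=> hk; have := gapl_lt hk; have [? ? ? ? [? ? ?]] := gapP hk; rewrite mem_rcols; lia.
Qed.

Lemma gapr_rcols k : k < u -> gapr k \in rcols.
Proof.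
by move=> hk; have := gapl_lt hk; have [? ? ? ? [? ? ?]] := gapP hk; rewrite mem_rcols; lia.
Qed.

Lemma index_gapr k : k < u -> index (gapr k) rcols = (index (gapl k) rcols).+1.
Proof.
move=> hk; have [? ? ? ? [? ? hn]] := gapP hk.
apply: rcols_succ; by [apply: gapl_rcols|apply: gapr_rcols|apply: gapl_lt|].
Qed.

(** Strictly between neighbouring columns of height [i] no column has height exactly [i], so the
    strict inequality in [select] may be relaxed. *)
Lemma select_colsE :
  [seq c <- iota C (C' - C).+1 | [|| c == C, c == C' | i < h c]] = rcols.
Proof.
apply: eq_in_filter => c; rewrite mem_iota => hc.
case: eqVneq => [->|n1]; first by rewrite hC leqnn.
case: eqVneq => [->|n2]; first by rewrite hC' leqnn.
have [_ _ _ _ hne] := neighbouringP _ _ _ i_gt0 nbCC'.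
by have := hne c; lia.
Qed.

(** [G] lists the gaps of the ungated lines from index [k0] on, which are those not to the left of
    [Cj]. Each round of the recursion stops at the two ends of the next such gap. A further [C'] is
    appended only when the last gap ends before it: this is the case of [reroute] where [closed]
    fails. *)
Lemma select_fromP fuel Cj k0 : C' - Cj <= fuel -> Cj \in rcols -> Cj != C' ->
  (forall k, k < u -> (k0 <= k) = (Cj <= col (b k))) ->
  exists G : seq (nat * nat),
  [/\ select_from ns fuel U rcols C' Cj =
      flatten [seq [:: g.1; g.2] | g <- G]
        ++ (if last Cj [seq g.2 | g <- G] == C' then [::] else [:: C']),
      forall k, k0 <= k < u -> (gapl k, gapr k) \in G,
      forall g, g \in G -> exists2 k, k0 <= k < u & g = (gapl k, gapr k) &
      pairwise (fun g g' => g.2 <= g'.1) G].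
Proof.
elim: fuel Cj k0 => [|fuel IH] Cj k0 hf hCj neC' hk0.
  by move: hCj neC'; rewrite mem_rcols; lia.
have [hk|hk] := leqP u k0.
  exists [::]; split=> //=; [|by move=> k; lia].
  rewrite (negPf neC').
  set Cj1 := last _ _; suff -> : Cj1 = C' by rewrite eqxx.
  rewrite /Cj1 /rcols -filter_predI.
  have hr : C <= C' < C + (C' - C).+1 by lia.
  set P := predI _ _.
  have PC' : P C'.
    rewrite /P /= hC' leqnn andbT; apply/andP; split.
      by move: hCj; rewrite mem_rcols; lia.
    apply/(all_nthP d0) => k hku.
    change (is_true (~~ ((Cj <= col (b k)) && (col (b' k) <= C')))).
    by have := hk0 k hku; lia.
  have [h1 _ h3] := @last_filter_iota P Cj C _ C' hr PC'.
  have := h3 C' hr PC'; move: h1; set m := last _ _ => h1 h2.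
  by apply/eqP; rewrite eqn_leq h2; lia.
have [g1 g2 g3 g4 [g5 g6 g7]] := gapP hk.
have hb : Cj <= col (b k0) by rewrite -hk0.
have hCj' : Cj <= gapl k0.
  have : i <= h Cj by move: hCj; rewrite mem_rcols; lia.
  have hb' : Cj < (col (b k0)).+1 by lia.
  by move=> hi; have [] := lcolP hb' hi.
have glr := gapl_lt hk.
rewrite /=; set Cj1 := last _ _.
have -> : Cj1 = gapl k0.
  rewrite /Cj1 /rcols -filter_predI.
  have hr : C <= gapl k0 < C + (C' - C).+1 by lia.
  set P := predI _ _.
  have Pg : P (gapl k0).
    rewrite /P /= g5 andbT hCj' /=.
    apply/(all_nthP d0) => k hku.
    change (is_true (~~ ((Cj <= col (b k)) && (col (b' k) <= gapl k0)))).
    apply/negP => /andP[]; rewrite -hk0 // => hkk hle.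
    by have := b_le hkk hku; have := b_ltb' hku; lia.
  have [h1 h2 h3] := @last_filter_iota P Cj C _ _ hr Pg.
  have := h3 _ hr Pg; move: h1 h2; set m := last _ _ => h1 h2 hm.
  apply/eqP; rewrite eqn_leq hm andbT leqNgt; apply/negP => hlt.
  case/andP: h2 => /andP[_ /(all_nthP d0) /(_ _ hk) hn] him.
  change (is_true (~~ ((Cj <= col (b k0)) && (col (b' k0) <= m)))) in hn.
  by have := g7 m; lia.
have -> : (gapl k0 == C') = false by lia.
set Cj2 := head _ _.
have -> : Cj2 = gapr k0.
  rewrite /Cj2 /rcols -filter_predI.
  have hr : C <= gapr k0 < C + (C' - C).+1 by lia.
  set P := predI _ _.
  have Pg : P (gapr k0) by rewrite /P /= g6 glr.
  have [h1 h2 h3] := @head_filter_iota P C' C _ _ hr Pg.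
  have := h3 _ hr Pg; move: h1 h2; set m := head _ _ => h1 /andP[/= h2 h2'] hm.
  apply/eqP; rewrite eqn_leq hm /= leqNgt; apply/negP => hlt.
  by have := g7 m; lia.
have [eC'|neC'2] := eqVneq (gapr k0) C'.
  exists [:: (gapl k0, gapr k0)]; rewrite /= eC' eqxx; split=> //.
    move=> k hku; have hku' : k < u by lia.
    have hkk : k0 <= k by lia.
    have e : gapl k = gapl k0 /\ gapr k = gapr k0.
      apply: gap_eq => //; have := gapl_lt hku'; have [? ? ? ? _] := gapP hku'.
        by lia.
      by have := gapl_le hkk hku'; lia.
    by case: e => -> ->; rewrite eC' inE.
  by move=> g; rewrite inE => /eqP->; exists k0; rewrite ?eC' //; lia.
pose k1 := find (fun l : nat * nat => gapr k0 <= col l.1) U.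
have hk1 k : k < u -> (k1 <= k) = (gapr k0 <= col (b k)).
  move=> hku; apply/idP/idP => hle.
    have hh : has (fun l : nat * nat => gapr k0 <= col l.1) U by rewrite has_find; lia.
    by apply: leq_trans (nth_find d0 hh) (b_le hle hku).
  rewrite leqNgt; apply/negP => hlt.
  by have := before_find d0 hlt; rewrite /= hle.
have k01 k : k1 <= k < u -> k0 <= k.
  move=> hkk; have hku : k < u by lia.
  have hb1 : gapr k0 <= col (b k) by rewrite -hk1 //; lia.
  by rewrite hk0 //; lia.
have [|G [E G1 G2 G3]] := IH (gapr k0) k1 _ (gapr_rcols hk) neC'2 hk1; first by lia.
exists ((gapl k0, gapr k0) :: G); split=> //=.
- by rewrite E.
- move=> k hkk; rewrite inE; have [hlt|hlt] := leqP k1 k.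
    by rewrite G1 ?orbT //; lia.
  have hku : k < u by lia.
  have := hk1 k hku; rewrite leqNgt hlt /= => /esym/negbT; rewrite -ltnNge => hb1.
  have [e1 e2] : gapl k = gapl k0 /\ gapr k = gapr k0.
    apply: gap_eq => //; have := gapl_lt hku; have [? ? ? ? _] := gapP hku.
      by lia.
    have : gapl k0 <= gapl k by apply: gapl_le; lia.
    by lia.
  by rewrite e1 e2 eqxx.
- move=> g; rewrite inE => /orP[/eqP->|/G2[k hkk ->]].
    by exists k0; rewrite ?hk ?leqnn.
  by exists k => //; have := k01 k hkk; lia.
- rewrite G3 andbT; apply/allP => g /G2[k hkk ->] /=.
  have hku : k < u by lia.
  have : gapr k0 <= col (b k) by rewrite -hk1 //; lia.
  move=> hb1; have hb2 : gapr k0 < (col (b k)).+1 by lia.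
  by have [] := lcolP hb2 g6.
Qed.

Lemma nth_rowb c : c \in rcols ->
  nth 0 (row_between ns i C C') (index c rcols) = box c i.
Proof. by move=> hc; rewrite row_betweenE (nth_map 0) ?index_mem ?nth_index. Qed.

Lemma size_rowb : size (row_between ns i C C') = size rcols.
Proof. by rewrite row_betweenE size_map. Qed.

Lemma map_col_rowb : [seq col a | a <- row_between ns i C C'] = rcols.
Proof.
rewrite row_betweenE -map_comp; apply: map_id_in => c /inbox_rcols hc.
exact: col_box.
Qed.

Lemma max_such_v1 : 0 < u ->
  max_such (size rcols) (fun t =>
    ltb ns (nth 0 (row_between ns i C C') t.-1) (b' 0)) =
  (index (gapl 0) rcols).+1.
Proof.
move=> u0; have hg := gapl_rcols u0.
have hgi : index (gapl 0) rcols < size rcols by rewrite index_mem.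
have [g1 g2 g3 g4 [g5 g6 g7]] := gapP u0.
set P := fun t => _.
have PE t : 0 < t <= size rcols -> P t = (t <= (index (gapl 0) rcols).+1).
  move=> ht; have ht' : t.-1 < size rcols by lia.
  have hm := mem_nth 0 ht'.
  have hi : index (nth 0 rcols t.-1) rcols = t.-1.
    by rewrite index_uniq // (sorted_uniq ltn_trans ltnn rcols_sorted).
  rewrite /P -{1}hi nth_rowb // /ltb col_box; last exact: inbox_rcols.
  have -> : (t <= (index (gapl 0) rcols).+1) =
            ~~ (index (gapl 0) rcols < index (nth 0 rcols t.-1) rcols).
    by rewrite hi; lia.
  rewrite rcols_ltn // -leqNgt.
  move: hm; rewrite mem_rcols => /andP[_ hm].
  apply/idP/idP => hlt; last by have := b_ltb' u0; lia.
  rewrite leqNgt; apply/negP => hlt2.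
  move: hm hlt hlt2 (g7 (nth 0 rcols t.-1)); move: (nth 0 rcols t.-1) (b' 0) g3 => c d hd; lia.
have hr : 1 <= (index (gapl 0) rcols).+1 < 1 + size rcols by lia.
have Pr : P (index (gapl 0) rcols).+1 by rewrite PE ?leqnn //; lia.
have [h1 h2 h3] := @last_filter_iota P 0 1 _ _ hr Pr.
have := h3 _ hr Pr; move: h1 h2; rewrite /max_such; set m := last _ _ => h1 h2 hm.
by rewrite PE in h2; lia.
Qed.

(** This identifies the number [u_j] of the construction with the last ungated line of the gap
    ending at [C_j]; the next lemma does the same for [u'_j] and the first line of a gap. *)
Lemma max_such_last k : k < u -> exists k',
  [/\ max_such u (fun j => ltb ns (b j.-1) (box (gapr k) i)) = k'.+1,
      k' < u, lastk k' & gapl k' = gapl k].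
Proof.
move=> hk; have hg := inbox_rcols (gapr_rcols hk).
have [g1 g2 g3 g4 [g5 g6 g7]] := gapP hk.
set P := fun j => ltb ns (b j.-1) (box (gapr k) i).
have PE j : P j = (col (b j.-1) < gapr k) by rewrite /P /ltb col_box.
have hr : 1 <= k.+1 < 1 + u by lia.
have Pk : P k.+1 by rewrite PE; have := b_ltb' hk; rewrite /=; lia.
have [h1 h2 h3] := @last_filter_iota P 0 1 _ _ hr Pk.
have := h3 _ hr Pk; move: h1 h2 h3; rewrite /max_such; move: (last 0 _) => m.
case: m => [|k'] h1 h2 h3 hkk'; first by lia.
have hk' : k' < u by lia.
rewrite PE /= in h2.
have [g'1 g'2 g'3 g'4 [g'5 g'6 g'7]] := gapP hk'.
have e : gapl k' = gapl k /\ gapr k' = gapr k.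
  have hle : gapl k <= gapl k' by apply: gapl_le.
  by apply: gap_eq => //; have := gapl_lt hk'; lia.
exists k'; split=> //; last by case: e.
rewrite /lastk; case: eqVneq => //= ne; apply/negP => /eqP e2.
have hk2 : k'.+1 < u by lia.
have e3 : gapr k'.+1 = gapr k by case: e => _ <-; apply: gapl_eqr.
have [_ _ h5 _ _] := gapP hk2.
have := h3 k'.+2; rewrite PE /=; have := b_ltb' hk2; lia.
Qed.

Lemma min_such_first k : k < u -> exists k',
  [/\ min_such u (fun j => ltb ns (box (gapl k) i) (b' j.-1)) = k'.+1,
      k' < u, firstk k' & gapl k' = gapl k].
Proof.
move=> hk; have hg := inbox_rcols (gapl_rcols hk).
have [g1 g2 g3 g4 [g5 g6 g7]] := gapP hk.
set P := fun j => ltb ns (box (gapl k) i) (b' j.-1).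
have PE j : P j = (gapl k < col (b' j.-1)) by rewrite /P /ltb col_box.
have hr : 1 <= k.+1 < 1 + u by lia.
have Pk : P k.+1 by rewrite PE; have := b_ltb' hk; rewrite /=; lia.
have [h1 h2 h3] := @head_filter_iota P 0 1 _ _ hr Pk.
have := h3 _ hr Pk; move: h1 h2 h3; rewrite /min_such; move: (head 0 _) => m.
case: m => [|k'] h1 h2 h3 hkk'; first by lia.
have hk' : k' < u by lia.
rewrite PE /= in h2.
have [g'1 g'2 g'3 g'4 [g'5 g'6 g'7]] := gapP hk'.
have e : gapl k' = gapl k /\ gapr k' = gapr k.
  have hle : gapl k' <= gapl k by apply: gapl_le.
  by apply: gap_eq => //; have := gapl_lt hk; lia.
exists k'; split=> //; last by case: e.
rewrite /firstk; case: eqVneq => //= ne; apply/negP => /eqP e2.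
have hk2 : k'.-1 < u by lia.
have [_ h4 _ _ _] := gapP hk2.
have := h3 k'; rewrite PE /=; have := b_ltb' hk2; case: e; lia.
Qed.

Lemma nth_flatten_pairs (G : seq (nat * nat)) t a : a < size G ->
  nth 0 (flatten [seq [:: g.1; g.2] | g <- G] ++ t) a.*2 = (nth (0, 0) G a).1 /\
  nth 0 (flatten [seq [:: g.1; g.2] | g <- G] ++ t) a.*2.+1 = (nth (0, 0) G a).2.
Proof. by elim: G a => [|g G IH] [|a] //= ha; apply: IH. Qed.

Lemma size_flatten_pairs (G : seq (nat * nat)) :
  size (flatten [seq [:: g.1; g.2] | g <- G]) = (size G).*2.
Proof. by elim: G => //= g G ->. Qed.

(** Gap by gap, the rerouting reads the same in all cases: the line of R_i across the gap is
    deleted, its left end takes over the first [b'], each [b] takes over the next [b'], and the last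
    [b] takes over the right end. The label is 0 only when this right end lies in [C']. *)
Definition del_line (l : nat * nat) :=
  exists2 k, k < u & l = (box (gapl k) i, box (gapr k) i).

Definition new_line1 (l : nat * nat) :=
  (exists2 k, k < u & l = (lo k, b' k)) \/
  (exists k, [/\ k < u, lastk k, gapr k <> C' & l = (b k, box (gapr k) i)]).

Definition new_line0 (l : nat * nat) :=
  exists k, [/\ k < u, lastk k, gapr k = C' & l = (b k, box C' i)].

Lemma update_spec del add1 add0 (D : diagram) :
  (forall l, l \in del <-> del_line l) ->
  (forall l, l \in add1 <-> new_line1 l) ->
  (forall l, l \in add0 <-> new_line0 l) -> size add0 <= 1 ->
  [/\ forall l, l \in lines1 (update del U add1 add0 D) <->
                (l \in lines1 D /\ ~ del_line l) \/ new_line1 l,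
      forall l, l \in lines0 (update del U add1 add0 D) <->
                (l \in lines0 D /\ ~ del_line l) \/ new_line0 l,
      gated0 (update del U add1 add0 D) = U ++ gated0 D &
      uniq (lines0 D) -> (forall l, new_line0 l -> l \notin lines0 D) ->
      uniq (lines0 (update del U add1 add0 D))].
Proof.
move=> hd h1 h0 hs; split=> // [l|l|u0 hn]; last first.
  rewrite cat_uniq filter_uniq //=; case: add0 h0 hs => [|z [|]] //= h0 _.
  by rewrite orbF !andbT mem_filter negb_and hn ?orbT // -h0 mem_head.
all: rewrite /update /= mem_cat mem_filter;
  rewrite -?h1 -?h0 -hd; split.
- by case/orP=> [/andP[/negP ? ->]|->]; [left|right].
- by case=> [[-> /negP ->]|->]; rewrite ?orbT.
- by case/orP=> [/andP[/negP ? ->]|->]; [left|right].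
- by case=> [[-> /negP ->]|->]; rewrite ?orbT.
Qed.

(** When the first gap already ends at [C'], it contains all the ungated lines. *)
Lemma reroute_case_a : 0 < u -> gapr 0 = C' ->
  [/\ forall l, l \in [:: (box (gapl 0) i, box C' i)] <-> del_line l,
      forall l, l \in (box (gapl 0) i, b' 0) ::
                  [seq (b j.-1, b' j) | j <- iota 1 u.-1] <-> new_line1 l &
      forall l, l \in [:: (b u.-1, box C' i)] <-> new_line0 l].
Proof.
move=> u0 hg0.
have all_gap k : k < u -> gapl k = gapl 0 /\ gapr k = C'.
  move=> hk; rewrite -hg0; apply: gap_eq => //.
    by have [? ? ? ? _] := gapP hk; have := b_ltb' hk; rewrite hg0; lia.
  have hle : gapl 0 <= gapl k by apply: gapl_le.
  by have := gapl_lt hk; lia.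
split=> l.
- rewrite inE; split=> [/eqP->|[k hk ->]].
    by exists 0; rewrite // hg0.
  by have [-> ->] := all_gap _ hk.
- rewrite inE; split=> [/orP[/eqP->|/mapP[j]]|].
  + by left; exists 0.
  + rewrite mem_iota => hj ->; left; have hju : j < u by lia.
    exists j => //; rewrite /lo ifN // /firstk negb_or negbK.
    have hj1 : j.-1 < u by lia.
    by have [-> _] := all_gap _ hju; have [-> _] := all_gap _ hj1; lia.
  + case=> [[k hk ->]|[k [hk _ + _]]]; last by have [_ ->] := all_gap _ hk.
    case: (posnP k) => [->|k0]; first by rewrite eqxx.
    apply/orP; right; apply/mapP; exists k; first by rewrite mem_iota; lia.
    rewrite /lo ifN // /firstk negb_or negbK.
    have hj1 : k.-1 < u by lia.
    by have [-> _] := all_gap _ hk; have [-> _] := all_gap _ hj1; lia.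
- rewrite inE; split=> [/eqP->|[k [hk lk _ ->]]].
    have hu1 : u.-1 < u by lia.
    exists u.-1; split=> //; last by case: (all_gap _ hu1).
    by rewrite /lastk prednK // eqxx.
  have [->//|ne] := eqVneq k u.-1; have hk1 : k.+1 < u by lia.
  move: lk; rewrite /lastk; have [-> _] := all_gap _ hk.
  by have [-> _] := all_gap _ hk1; rewrite eqxx; lia.
Qed.

(** * Case (b) of a stage, read gap by gap *)

Section CaseB.
Variable G : seq (nat * nat).
Hypothesis u_gt0 : 0 < u.
Hypothesis gapG : forall k, k < u -> (gapl k, gapr k) \in G.
Hypothesis Ggap : forall g, g \in G -> exists2 k, k < u & g = (gapl k, gapr k).
Hypothesis G_sorted : pairwise (fun g g' => g.2 <= g'.1) G.

Let tl := if last C [seq g.2 | g <- G] == C' then [::] else [:: C'].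
Let Cs := C :: (flatten [seq [:: g.1; g.2] | g <- G] ++ tl).
Let m := (size Cs).-1.
Let R := row_between ns i C C'.
Let b'' t := nth 0 R t.-1.
Let vj j := (index (nth 0 Cs j) [seq col a | a <- R]).+1.
Let B j := (nth d0 U j.-1).1.
Let B' j := (nth d0 U j.-1).2.
Let uj j := max_such u (fun k => ltb ns (B k) (b'' (vj j))).
Let u'j j := min_such u (fun k => ltb ns (b'' (vj j)) (B' k)).
Let odds := [seq j <- iota 1 m.-1 | odd j].
Let inner_odds := [seq j <- odds | 2 <= j].
Let inner_evens := [seq j <- iota 2 m.-2 | ~~ odd j].
Let omitted := [seq uj j | j <- inner_evens].
Local Notation gam a := (nth (0, 0) G a).

Let G_size : 0 < size G.
Proof. by have := gapG u_gt0; case: G. Qed.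

Let G_lt a c : a < c -> c < size G -> (gam a).2 <= (gam c).1.
Proof.
move=> hac hc; have ha : a < size G by lia.
exact: (pairwiseP (0, 0) G_sorted a c ha hc hac).
Qed.

Let G_gap a : a < size G -> exists2 k, k < u & gam a = (gapl k, gapr k).
Proof. by move=> ha; apply/Ggap/mem_nth. Qed.

Let G_index k : k < u -> exists2 a, a < size G & gam a = (gapl k, gapr k).
Proof.
move=> hk; have := gapG hk => hg.
exists (index (gapl k, gapr k) G); by rewrite ?index_mem ?nth_index.
Qed.

Let closedE : (last C [seq g.2 | g <- G] == C') = ((gam (size G).-1).2 == C').
Proof.
by case: (G) G_size => // g s _; rewrite nth_last /= last_map.
Qed.

Let mE : m = (size G).*2 + ((gam (size G).-1).2 != C').
Proof.
rewrite /m /Cs /= size_cat size_flatten_pairs /tl closedE.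
by case: (_ == C').
Qed.

Let Cs_odd a : a < size G -> nth 0 Cs a.*2.+1 = (gam a).1.
Proof. by move=> ha; have [] := nth_flatten_pairs tl ha. Qed.

Let Cs_even a : a < size G -> nth 0 Cs a.*2.+2 = (gam a).2.
Proof. by move=> ha; have [] := nth_flatten_pairs tl ha. Qed.

Let bvj c : c \in rcols -> nth 0 R (index c [seq col a | a <- R]).+1.-1 = box c i.
Proof. by rewrite map_col_rowb; apply: nth_rowb. Qed.

Let b_odd a k : a < size G -> gam a = (gapl k, gapr k) -> k < u ->
  b'' (vj a.*2.+1) = box (gapl k) i.
Proof. by move=> ha e hk; rewrite /b'' /vj Cs_odd // e bvj // gapl_rcols. Qed.

Let b_even a k : a < size G -> gam a = (gapl k, gapr k) -> k < u ->
  b'' (vj a.*2.+2) = box (gapr k) i.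
Proof. by move=> ha e hk; rewrite /b'' /vj Cs_even // e bvj // gapr_rcols. Qed.

Let mem_odds j : reflect (exists2 a, a < size G & j = a.*2.+1) (j \in odds).
Proof.
rewrite mem_filter mem_iota; apply: (iffP idP) => [/andP[oj hj]|[a ha ->]].
  exists j./2; have := odd_double_half j; rewrite oj mE in hj *; lia.
by rewrite /= odd_double /= mE; lia.
Qed.

Let gam_lt a : a < (size G).-1 -> (gam a).2 < C'.
Proof.
move=> ha; have h1 : a < (size G).-1 by [].
have h2 : (size G).-1 < size G by lia.
have := G_lt h1 h2; have [k hk ->] := G_gap h2; rewrite /=.
by have := gapl_lt hk; have [? ? ? ? _] := gapP hk; lia.
Qed.

Let mem_evens j : reflect (exists2 a, a < size G & j = a.*2.+2 /\ (gam a).2 <> C')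
  (j \in inner_evens).
Proof.
rewrite mem_filter mem_iota; apply: (iffP idP) => [/andP[oj hj]|[a ha [-> hne]]].
  exists j./2.-1; have := odd_double_half j; rewrite (negPf oj) mE in hj *.
    by lia.
  move=> ej; split; first by lia.
  have [hl|hl] := ltnP j./2.-1 (size G).-1; first by have := gam_lt hl; lia.
  have -> : j./2.-1 = (size G).-1 by lia.
  by case: eqVneq hj => //; lia.
rewrite /= odd_double /= mE.
have [hl|hl] := ltnP a (size G).-1; first by lia.
have e : a = (size G).-1 by lia.
by rewrite -e; case: eqP => //; lia.
Qed.

Let gam0 : gam 0 = (gapl 0, gapr 0).
Proof.
have [a ha e] := G_index u_gt0; case: (posnP a) => [a0|a0]; first by rewrite a0 in e.
have := G_lt a0 ha; have [k hk e'] := G_gap G_size; rewrite e e' /=.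
have : gapl 0 <= gapl k by apply: gapl_le.
have := gapl_lt hk; lia.
Qed.

Let firstk_gam0 k : k < u -> firstk k -> gapl k = gapl 0 -> k = 0.
Proof. by move=> hk hf e; apply: firstk_uniq. Qed.

Let ujE a k : a < size G -> gam a = (gapl k, gapr k) -> k < u ->
  exists k', [/\ uj a.*2.+2 = k'.+1, k' < u, lastk k' & gapl k' = gapl k].
Proof.
move=> ha e hk; have [k' [h1 h2 h3 h4]] := max_such_last hk.
by exists k'; split=> //; rewrite -h1 /uj (b_even ha e hk).
Qed.

Let u'jE a k : a < size G -> gam a = (gapl k, gapr k) -> k < u ->
  exists k', [/\ u'j a.*2.+1 = k'.+1, k' < u, firstk k' & gapl k' = gapl k].
Proof.
move=> ha e hk; have [k' [h1 h2 h3 h4]] := min_such_first hk.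
by exists k'; split=> //; rewrite -h1 /u'j (b_odd ha e hk).
Qed.

Let v1E : max_such (size R) (fun t => ltb ns (b'' t) (B' 1)) =
  (index (gapl 0) rcols).+1.
Proof. by rewrite size_rowb; apply: max_such_v1. Qed.

Let closed := ~~ odd m.

Let closed_eq : closed = ((gam (size G).-1).2 == C').
Proof. by rewrite /closed mE oddD odd_double; case: (_ == C'). Qed.

Let last_gap : closed -> exists2 k, k < u & gapr k = C'.
Proof.
rewrite closed_eq => /eqP e; have hl : (size G).-1 < size G by lia.
by have [k hk e'] := G_gap hl; exists k; rewrite // -e e'.
Qed.

Let v := size R.
Let v1 := max_such v (fun t => ltb ns (b'' t) (B' 1)).

Let b_v1 : b'' v1 = box (gapl 0) i.
Proof. by rewrite /v1 v1E /b'' nth_rowb // gapl_rcols. Qed.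

Let b_v : b'' v = box C' i.
Proof. by rewrite /b'' /v size_rowb -index_C' nth_rowb // C'_rcols. Qed.

Lemma reroute_del l :
  l \in [:: (b'' v1, b'' v1.+1)]
    ++ (if closed then [:: (b'' v.-1, b'' v)] else [::])
    ++ [seq (b'' (vj j), b'' (vj j.+1)) | j <- odds] <-> del_line l.
Proof.
rewrite !mem_cat; split.
- case/or3P.
  + rewrite inE => /eqP->; exists 0; rewrite // b_v1; congr (_, _).
    by rewrite /v1 v1E /b'' /= -index_gapr // nth_rowb // gapr_rcols.
  + case: ifP => // /last_gap [k hk e]; rewrite inE => /eqP->.
    exists k; rewrite // b_v e; congr (_, _).
    have e1 : (index (gapl k) rcols).+1 = v.-1.
      by rewrite -index_gapr // e /v size_rowb -index_C'.
    by rewrite /b'' -e1 nth_rowb // gapl_rcols.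
  + case/mapP=> j /mem_odds[a ha ->] ->; have [k hk e] := G_gap ha.
    by exists k; rewrite // (b_odd ha e hk) (b_even ha e hk).
case=> k hk ->; have [a ha e] := G_index hk.
apply/or3P/Or33/mapP; exists a.*2.+1; first by apply/mem_odds; exists a.
by rewrite (b_odd ha e hk) (b_even ha e hk).
Qed.

Let uj_omitted k : k < u -> lastk k -> gapr k <> C' -> k.+1 \in omitted.
Proof.
move=> hk lk hC1; have [a ha e] := G_index hk.
have [k' [h1 h2 h3 h4]] := ujE ha e hk.
apply/mapP; exists a.*2.+2; first by apply/mem_evens; exists a; rewrite // e.
by rewrite h1; congr _.+1; apply: lastk_uniq.
Qed.

Let omitted_uj j : j \in omitted -> exists k, [/\ k < u, lastk k & j = k.+1].
Proof.
case/mapP=> j' /mem_evens[a ha [-> hne]] ->; have [k hk e] := G_gap ha.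
by have [k' [h1 h2 h3 h4]] := ujE ha e hk; exists k'.
Qed.

(** The omitted numbers are those of the last lines of the gaps ending before [C'], where the next
    [b'], if any, lies in another gap. The pairs that remain are the chains inside the gaps. *)
Lemma reroute_add1 l :
  l \in [:: (b'' v1, B' 1)]
      ++ [seq (B (uj j), b'' (vj j)) | j <- inner_evens]
      ++ [seq (b'' (vj j), B' (u'j j)) | j <- inner_odds]
      ++ [seq (B k, B' k.+1) | k <- iota 1 u.-1 & k \notin omitted]
    <-> new_line1 l.
Proof.
rewrite !mem_cat orbA; split.
- case/or3P.
  + case/orP; first by rewrite inE => /eqP->; left; exists 0; rewrite // b_v1.
    case/mapP=> j /mem_evens[a ha [-> hne]] ->; have [k hk e] := G_gap ha.
    have [k' [h1 h2 h3 h4]] := ujE ha e hk.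
    right; exists k'; have e2 := gapl_eqr h2 hk h4; split=> //.
      by rewrite e2; rewrite e in hne.
    by rewrite (b_even ha e hk) e2 h1.
  + case/mapP=> j; rewrite mem_filter => /andP[h2j /mem_odds[a ha ej]] ->.
    have [k hk e] := G_gap ha; rewrite ej.
    have [k' [h1 h2 h3 h4]] := u'jE ha e hk.
    left; exists k' => //; rewrite (b_odd ha e hk) h1 /lo h3 h4 //.
  + case/mapP=> j; rewrite mem_filter mem_iota => /andP[hom hj] ->.
    left; have hj1 : j < u by lia.
    exists j => //; rewrite /lo ifN // /firstk negb_or negbK.
    have hj0 : j.-1 < u by lia.
    apply/andP; split; first by lia.
    apply/negPn/negP => ne; move/negP: hom; apply.
    have e : j.-1.+1 = j by lia.
    have l1 : lastk j.-1 by rewrite /lastk e [gapl j == _]eq_sym ne orbT.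
    have := uj_omitted hj0 l1; rewrite e; apply.
    have := @gapl_le j.-1 j (leq_pred _) hj1.
    have [_ _ _ h4 _] := gapP hj1; have hlt := gapl_lt hj1.
    have hlt0 := gapl_lt hj0 => hle e2.
    have [_ _ _ _ [q1 q2 q3]] := gapP hj0.
    have [_ _ _ _ [p1 p2 p3]] := gapP hj1.
    by have := q3 (gapl j); lia.
- case=> [[k hk ->]|[k [hk lk hC1 ->]]]; have [a ha e] := G_index hk.
  + have [fk|nfk] := boolP (firstk k).
      rewrite /lo fk; have [ea|a0] := posnP a.
        have k0 : k = 0.
          by apply: firstk_gam0 => //; move: e; rewrite ea gam0; case.
        by rewrite k0 b_v1 inE eqxx.
      have [k' [h1 h2 h3 h4]] := u'jE ha e hk.
      have ek : k' = k by apply: firstk_uniq.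
      apply/or3P/Or32/mapP; exists a.*2.+1.
        rewrite mem_filter; apply/andP; split; first by lia.
        by apply/mem_odds; exists a.
      by rewrite (b_odd ha e hk) h1 ek.
    rewrite /lo (negPf nfk); move: nfk; rewrite /firstk negb_or negbK.
    case/andP=> k0 /eqP eg; apply/or3P/Or33/mapP; exists k => //.
    rewrite mem_filter mem_iota; apply/andP; split; last by lia.
    apply/negP => /omitted_uj[k' [h1 h2 ek]]; subst k.
    by case/orP: h2 => [/eqP|/eqP ne]; [lia|apply: ne].
  + have [k' [h1 h2 h3 h4]] := ujE ha e hk.
    have ek : k' = k by apply: lastk_uniq.
    apply/or3P/Or31/orP; right; apply/mapP; exists a.*2.+2.
      by apply/mem_evens; exists a; rewrite // e.
    by rewrite (b_even ha e hk) h1 ek.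
Qed.

Lemma reroute_add0 l :
  l \in (if closed then [:: (B u, b'' v)] else [::]) <-> new_line0 l.
Proof.
split.
  case: ifP => // hc; rewrite inE => /eqP->.
  have [k hk e] := last_gap hc; have hu : u.-1 < u by lia.
  exists u.-1; rewrite b_v; split=> //; first by rewrite /lastk prednK // eqxx.
  have : gapl k <= gapl u.-1 by apply: gapl_le; lia.
  have := gapl_lt hu; have [_ _ _ h4 _] := gapP hu => hlt hle.
  case: (@gap_eq u.-1 k) => //; [by rewrite e; lia|by lia|by move=> _ ->].
case=> k [hk lk e ->]; have [a ha ea] := G_index hk.
have ea' : a = (size G).-1.
  have [hl|] := ltnP a (size G).-1; last by lia.
  by have := gam_lt hl; rewrite ea /=; lia.
have -> : closed by rewrite closed_eq -ea' ea e.
rewrite inE b_v; apply/eqP; congr ((nth d0 U _).1, _).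
case: (ltngtP k.+1 u) => hku; [|by lia|by lia].
have [h1 h2 h3 h4 _] := gapP hku; move: lk; rewrite /lastk => /orP[/eqP|/eqP ne].
  by lia.
have := b_lt (ltnSn k) hku => hb; have := b_ltb' hku => hb'.
have hle := @gapl_le k k.+1 (leqnSn k) hku.
have [_ _ _ _ [_ _ q3]] := gapP hk; have [_ _ _ _ [p1 p2 _]] := gapP hku.
by have := q3 (gapl k.+1); have := gapl_lt hku; lia.
Qed.
End CaseB.

End Reroute.

(** Once there is an ungated line, this is all that is used about [reroute] from here on. *)
Lemma reroute_spec ns i C C' D (U := ungated ns D i C C') (d0 := head (0, 0) U) :
  0 < i -> neighbouring ns i C C' ->
  (forall k, k < size U ->
     let b := col ns (nth d0 U k).1 in let b' := col ns (nth d0 U k).2 in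
    [/\ C <= b, b < b', b' <= C', height ns b' < i &
      forall c, i <= height ns c -> ~~ (b < c < b')]) ->
  (forall k, k.+1 < size U -> col ns (nth d0 U k).2 <= col ns (nth d0 U k.+1).1) ->
  U <> [::] -> let D' := reroute ns i D (C, C') in
  [/\ forall l, l \in lines1 D' <->
        (l \in lines1 D /\ ~ del_line ns i U d0 l) \/ new_line1 ns i C' U d0 l,
      forall l, l \in lines0 D' <->
        (l \in lines0 D /\ ~ del_line ns i U d0 l) \/ new_line0 ns i C' U d0 l,
      gated0 D' = U ++ gated0 D &
      uniq (lines0 D) ->
      (forall l, new_line0 ns i C' U d0 l -> l \notin lines0 D) ->
      uniq (lines0 D')].
Proof.
move=> i0 hn; rewrite /reroute -/U /d0; case: (U) => // l0 U0 hU hc _.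
rewrite -[head _ _]/l0 in hU hc *.
set V := l0 :: U0 in hU hc *; have u0 : 0 < size V by [].
have hcase := @reroute_case_a ns i C C' V l0 i0 hn hU hc u0.
have hgi := index_gapr i0 hn hU u0.
have hv := @max_such_v1 ns i C C' V l0 i0 hn hU u0.
have hC := index_C' i0 hn.
have hbv1 := nth_rowb i0 hn (gapl_rcols i0 hn hU u0).
have hbv := nth_rowb i0 hn (C'_rcols i0 hn).
cbv zeta.
have hsz := size_rowb i0 hn.
have hv1 : max_such (size (row_between ns i C C'))
   (fun t => ltb ns (nth 0 (row_between ns i C C') t.-1) (nth l0 V 1.-1).2) =
   (index (gapl ns i V l0 0) (rcols ns i C C')).+1 by rewrite hsz -hv.
rewrite hv1.
(* [v1] numbers the left end of the first gap in R_i, so the test says that this gap ends at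
   [C']. *)
case: eqVneq => [e|ne].
  have eC' : gapr ns i V l0 0 = C'.
    have : index (gapr ns i V l0 0) (rcols ns i C C') = index C' (rcols ns i C C').
      by rewrite hgi e hsz -hC.
    move/(congr1 (nth 0 (rcols ns i C C'))); rewrite !nth_index //.
      exact: C'_rcols.
    exact: (gapr_rcols i0 hn hU u0).
  have [h1 h2 h3] := hcase eC'.
  apply: update_spec => [l|l|l|//].
  - by rewrite -h1 hsz -hC -pred_Sn hbv1 hbv.
  - by rewrite -h2 -pred_Sn hbv1.
  - by rewrite -h3 hsz -hC hbv.
rewrite -hv1; have Cm : C \in rcols ns i C C' := C_rcols i0 hn.
have neC : C != C' by case: (neighbouringP _ _ _ i0 hn) => h1 _ _ _ _; lia.
have hk0 k : k < size V -> (0 <= k) = (C <= col ns (nth l0 V k).1).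
  by move=> hk; have [-> _ _ _ _] := hU k hk.
have hf : C' - C <= size ns.
  by case: (neighbouringP _ _ _ i0 hn) => _ h2 _ _ _; lia.
have [G [E G1 G2 G3]] := select_fromP i0 hn hU hc hf Cm neC hk0.
have hG2 g : g \in G -> exists2 k, k < size V & g = (gapl ns i V l0 k, gapr ns i V l0 k).
  by move=> /G2[k /andP[_ hk] ->]; exists k.
have {}G1 k : k < size V -> (gapl ns i V l0 k, gapr ns i V l0 k) \in G.
  by move=> hk; apply: G1; rewrite leq0n hk.
have ES : select ns V i C C' = C :: (flatten [seq [:: g.1; g.2] | g <- G]
        ++ (if last C [seq g.2 | g <- G] == C' then [::] else [:: C'])).
  by rewrite /select (select_colsE i0 hn) E.
rewrite ES.
apply: update_spec => [l|l|l|]; last by case: ifP.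
- by apply: (@reroute_del ns i C C' V l0) => //; eassumption.
- by apply: (@reroute_add1 ns i C C' V l0) => //; eassumption.
- by apply: (@reroute_add0 ns i C C' V l0) => //; eassumption.
Qed.

(** * The invariant of the construction *)

Section Invariant.
Variable ns : seq nat.
Hypothesis ns_pos : forall k, k < size ns -> 0 < height ns k.
Local Notation N := (sumn ns).
Local Notation h := (height ns).
Local Notation col := (col ns).
Local Notation row := (row ns).
Local Notation box := (box ns).
Local Notation lnbr := (lnbr ns).
Local Notation hasl := (hasl ns).
Local Notation key := (key ns).
Local Notation nonfirst := (nonfirst ns).

(* [f y] is the box from which the composite lines of the unique disjoint
   unions enter [y]; among the lines ending at [y] it is the one whose start
   has the least [key]. *)
Record inv (i : nat) (D : diagram) (f : nat -> nat) : Prop := {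
  inv_box : forall x y, (x, y) \in lines D ->
    [/\ x < N, y < N, col x < col y & hasl y];
  inv_str : forall x y, (x, y) \in lines D -> forall c, i <= h c ->
    row x <= h c -> row y <= h c -> ~~ (col x < c < col y);
  inv_hi : forall x y, (x, y) \in lines D -> i < row x \/ i < row y ->
    x = lnbr y;
  inv_f : forall y, y < N -> hasl y -> (f y, y) \in lines D;
  inv_min : forall x y, (x, y) \in lines D -> key (f y) <= key x;
  inv_f_inj : forall y y', y < N -> y' < N -> hasl y -> hasl y' -> f y = f y' ->
    y = y';
  inv_row : forall y, y < N -> hasl y -> row (f y) <= maxn i (row y);
  inv_fhi : forall y, y < N -> hasl y -> i < row y -> f y = lnbr y;
  inv_lab : forall l, l \in lines0 D -> l \notin lines1 D;
  inv_0 : forall x y, (x, y) \in lines0 D ->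
    [/\ row y = h (col y), nonfirst (col y) & row x <= row y];
  inv_0s : forall x y, (x, y) \in lines0 D -> forall c, row y <= h c ->
    ~~ (col x < c < col y);
  inv_0u : forall x x' y, (x, y) \in lines0 D -> (x', y) \in lines0 D -> x = x';
  inv_0e : forall q, q < size ns -> nonfirst q ->
    exists x, (x, box q (h q)) \in lines0 D;
  inv_g : forall x y, (x, y) \in lines0 D -> (f y == x) = ((x, y) \notin gated0 D);
  inv_gr : forall x y, (x, y) \in gated0 D -> row y < i;
  inv_uniq : uniq (lines0 D) }.

(** What stage [s] achieves between neighbouring columns of height [s]: the only ungated line that
    may be left ends at the bottom box of [A']. Later stages preserve this, and it is the reason why
    the ungated lines they meet do not overlap. *)
Definition settled (D : diagram) s A A' := forall x y, (x, y) \in lines0 D ->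
  (x, y) \notin gated0 D -> row x <= s -> A <= col x -> col y <= A' ->
  y = box A' s.

(** The pairs of height [i] are rerouted one at a time. Until its turn comes, a pair sees only
    horizontal lines at the boxes of R_i, and [f] follows them. *)
Definition intact i C C' (D : diagram) (f : nat -> nat) :=
  (forall x y, (x, y) \in lines D -> C <= col x -> col y <= C' ->
     row x = i \/ row y = i -> x = lnbr y) /\
  (forall y, y < N -> row y = i -> C < col y <= C' -> f y = lnbr y).

(** Only the start is required to lie in R^s; under [pairing] the end of a line of the diagram then
    does too. *)
Definition reg s A A' (l : nat * nat) :=
  [&& row l.1 <= s, A <= col l.1 & col l.2 <= A'].

(** The form in which the greedy argument sees the diagram between [A] and [A']. It does not mention
    gating and involves only the lines in [reg], so it outlives stage [s] with the [g] of that
    stage, while the [f] of [inv] goes on changing. *)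
Record pairing (D : diagram) s A A' (g : nat -> nat) : Prop := {
  pair_box : forall x y, (x, y) \in lines D -> reg s A A' (x, y) ->
    [/\ x < N, y < N, col x < col y & row y <= s];
  pair_line : forall y, y < N -> row y <= s -> A < col y <= A' ->
    [/\ row (g y) <= s, A <= col (g y), (g y, y) \in lines D &
        ((g y, y) \in lines0 D) = (y == box A' s)];
  pair_inj : forall y y', y < N -> y' < N -> row y <= s -> row y' <= s ->
    A < col y <= A' -> A < col y' <= A' -> g y = g y' -> y = y';
  pair_min : forall x y, (x, y) \in lines D -> reg s A A' (x, y) ->
    key (g y) <= key x;
  pair_lab : forall l, l \in lines0 D -> reg s A A' l -> l \notin lines1 D }.

Lemma lines0_lines l (D : diagram) : l \in lines0 D -> l \in lines D.
Proof. by rewrite mem_cat orbC => ->. Qed.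
Lemma lines1_lines l (D : diagram) : l \in lines1 D -> l \in lines D.
Proof. by rewrite mem_cat => ->. Qed.

Lemma inv_succ i D f : inv i D f -> inv i.+1 D f.
Proof.
case=> b1 b2 b3 b4 b5 b6 b7 b8 b9 b10 b11 b12 b13 b14 b15 b16; split=> //.
- by move=> x y hl c hc; apply: (b2 _ _ hl); lia.
- by move=> x y hl hr; apply: (b3 _ _ hl); lia.
- by move=> y hy hh; have := b7 y hy hh; lia.
- by move=> y hy hh hr; apply: b8 => //; lia.
- by move=> x y /b15; lia.
Qed.

Lemma lnbr_row x y : x < N -> y < N -> hasl y -> x = lnbr y -> row x = row y.
Proof. by move=> hx hy hh ->; have [_ _ ->] := lnbrP hh. Qed.

Lemma nb_facts i C C' : 0 < i -> neighbouring ns i C C' ->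
  [/\ C < C', C' < size ns, h C = i, h C' = i & nonfirst C'].
Proof.
move=> i0 hn; have [h1 h2 h3 h4 _] := neighbouringP _ _ _ i0 hn.
by split=> //; have [] := neighbouring_nonfirst i0 hn.
Qed.

Lemma hasl_col y c : c < col y -> row y <= h c -> hasl y.
Proof. by move=> hc hr; apply/haslP; exists c. Qed.

Lemma inv_intact i C C' D f : neighbouring ns i.+1 C C' -> inv i D f ->
  intact i.+1 C C' D f.
Proof.
move=> hn I; have [h1 h2 h3 h4 h5] := nb_facts (ltn0Sn i) hn.
split=> [x y hl _ _ hr|y hy hr /andP[hc _]].
  by apply: (inv_hi I hl); lia.
by apply: (inv_fhi I hy); [apply: hasl_col hc _; rewrite hr h3|lia].
Qed.

(** [f] serves as [g]. A line [(f y, y)] labelled 0 is ungated, so [settled] locates its end.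
    Conversely, gated lines end above R_i, so the line labelled 0 into the bottom box of [C'] is
    ungated and is therefore the one chosen by [f]. *)
Lemma settled_pairing i D f C C' : 0 < i -> neighbouring ns i C C' ->
  inv i D f -> settled D i C C' -> pairing D i C C' f.
Proof.
move=> i0 hn I hs; have [h1 h2 h3 h4 h5] := nb_facts i0 hn.
have hasY y : row y <= i -> C < col y <= C' -> hasl y.
  by move=> hr /andP[hc _]; apply: hasl_col hc _; rewrite h3.
split.
- move=> x y hl /and3P[/= r1 r2 r3]; have [x1 x2 x3 x4] := inv_box I hl.
  split=> //; rewrite leqNgt; apply/negP => hr.
  have e := inv_hi I hl (or_intror hr).
  by have := lnbr_row x1 x2 x4 e; lia.
- move=> y hy hr hc; have hh := hasY y hr hc.
  have hl := inv_f I hy hh; have hfr := inv_row I hy hh.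
  have hfr' : row (f y) <= i by lia.
  (* No line with both ends in R^i jumps over [C], which has height [i]. *)
  have hfc : C <= col (f y).
    have hstr : ~~ (col (f y) < C < col y) by apply: (inv_str I hl); lia.
    by lia.
  split=> //; apply/idP/eqP => [hl0|ey].
    have hng : (f y, y) \notin gated0 D by rewrite -(inv_g I hl0).
    by apply: (hs _ _ hl0 hng); lia.
  have [x hx] := inv_0e I h2 h5; rewrite h4 -ey in hx.
  have hng : (x, y) \notin gated0 D.
    apply/negP => /(inv_gr I); rewrite ey row_box ?ltnn //.
    by rewrite /inbox i0 h4 /=.
  by have := inv_g I hx; rewrite hng => /eqP->.
- by move=> y y' hy hy' hr hr' hc hc'; apply: (inv_f_inj I) => //; apply: hasY.
- by move=> x y hl _; apply: (inv_min I).
- by move=> l hl _; apply: (inv_lab I).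
Qed.

Lemma pairing_ext D D' s A A' g :
  (forall l, reg s A A' l -> (l \in lines1 D') = (l \in lines1 D)) ->
  (forall l, reg s A A' l -> (l \in lines0 D') = (l \in lines0 D)) ->
  pairing D s A A' g -> pairing D' s A A' g.
Proof.
move=> e1 e0 [p1 p2 p3 p4 p5].
have e l : reg s A A' l -> (l \in lines D') = (l \in lines D).
  by move=> hl; rewrite !mem_cat e1 // e0.
split=> //.
- by move=> x y hl hr; apply: p1; rewrite -?e.
- move=> y hy hr hc; have [q1 q2 q3 q4] := p2 y hy hr hc.
  have hreg : reg s A A' (g y, y) by rewrite /reg /= q1 q2; lia.
  by rewrite e // e0.
- by move=> x y hl hr; apply: p4; rewrite -?e.
- by move=> l hl hr; rewrite e1 // p5 // -e0.
Qed.

(** This is the chain of inequalities between the [b_j] and [b'_j] that the construction takes for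
    granted. If [(x', y')], the line ending further right, starts before the end of [(x, y)], then
    the column of [y] is shorter than that of [y'], and neither line jumps over the column preceding
    that of [y'] among those of its height. So [(x, y)] lies between two neighbouring columns that
    are already settled and would have to end at [y']. *)
Lemma ungated_disjoint i D f :
  inv i D f -> (forall s A A', 0 < s < i -> neighbouring ns s A A' -> settled D s A A') ->
  forall x y x' y', (x, y) \in lines0 D -> (x', y') \in lines0 D ->
  (x, y) \notin gated0 D -> (x', y') \notin gated0 D ->
  row y < i -> row y' < i -> (x, y) <> (x', y') ->
  col y <= col x' \/ col y' <= col x.
Proof.
move=> I hs.
have H x y x' y' : (x, y) \in lines0 D -> (x', y') \in lines0 D ->
  (x, y) \notin gated0 D -> row y' < i -> col y < col y' -> col y <= col x'.
  move=> l0 l0' ng hr' hc; rewrite leqNgt; apply/negP => hlt.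
  have [a1 a2 a3] := inv_0 I l0; have [b1 b2 b3] := inv_0 I l0'.
  have [x1 x2 x3 x4] := inv_box I (lines0_lines l0).
  have [y1 y2 y3 y4] := inv_box I (lines0_lines l0').
  have hlt2 : h (col y) < row y'.
    by rewrite ltnNge; apply/negP => hle; move/negP: (inv_0s I l0' hle); lia.
  have hq0 : 0 < h (col y') by rewrite -b1.
  have hnb := nonfirst_neighbouring b2 hq0.
  have [q1 q2 q3] := prevcolP b2.
  have hF : prevcol ns (col y') <= col x'.
    have : row y' <= h (prevcol ns (col y')) by rewrite q2 b1.
    by move/(inv_0s I l0'); lia.
  have [hF2|hF2] := leqP (prevcol ns (col y')) (col x); last first.
    have : row y <= h (prevcol ns (col y')) by rewrite q2 -b1; lia.
    by move/(inv_0s I l0); lia.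
  have hsi : 0 < h (col y') < i by rewrite -b1; lia.
  have e : y = box (col y') (h (col y')).
    by apply: (hs _ _ _ hsi hnb _ _ l0 ng); lia.
  by move: hc; rewrite e col_box ?ltnn // /inbox hq0 /=.
move=> x y x' y' l0 l0' ng ng' hr hr' ne.
case: (ltngtP (col y) (col y')) => hc.
- by left; apply: H l0' ng _ hc.
- by right; apply: H l0 ng' _ hc.
have [a1 a2 a3] := inv_0 I l0; have [b1 b2 b3] := inv_0 I l0'.
have e : y = y' by apply: (@eq_box ns) => //; rewrite a1 b1 hc.
by case: ne; rewrite -e in l0' *; rewrite (inv_0u I l0 l0').
Qed.

Lemma settled_intro i D f C C' : 0 < i -> neighbouring ns i C C' -> inv i D f ->
  (forall x y, (x, y) \in lines0 D -> (x, y) \notin gated0 D -> row x < i ->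
     row y < i -> C <= col x -> col y <= C' -> False) ->
  settled D i C C'.
Proof.
move=> i0 hn I hU x y hl ng hr hx hy; have [n1 n2 n3 n4 n5] := nb_facts i0 hn.
have [a1 a2 a3] := inv_0 I hl; have [x1 x2 x3 x4] := inv_box I (lines0_lines hl).
have [hlt|hle] := ltnP (row y) i.
  by case: (hU _ _ hl ng _ hlt hx hy); lia.
have [hlt|hle2] := ltnP i (row y).
  have e := inv_hi I (lines0_lines hl) (or_intror hlt).
  by have := lnbr_row x1 x2 x4 e; lia.
have ery : row y = i by lia.
have ecy : col y = C'.
  apply/eqP; rewrite eqn_leq hy leqNgt; apply/negP => hlt.
  have [_ _ _ _ hne] := neighbouringP _ _ _ i0 hn.
  by apply: (hne (col y)); lia.
by rewrite -(boxK ns y) ery ecy.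
Qed.

(** * Rerouting for one pair of neighbouring columns preserves the invariant *)

Section Step.
Variables (i C C' : nat) (D : diagram) (f : nat -> nat).
Hypothesis i_gt0 : 0 < i.
Hypothesis nbCC' : neighbouring ns i C C'.
Hypothesis I : inv i D f.
Hypothesis hset : forall s A A', 0 < s < i -> neighbouring ns s A A' ->
  settled D s A A'.
Hypothesis hint : intact i C C' D f.

Let U : seq (nat * nat) := ungated ns D i C C'.
Let d0 := head (0, 0) U.
Local Notation u := (size U).
Local Notation b k := (nth d0 U k).1.
Local Notation b' k := (nth d0 U k).2.

Lemma mem_ungated x y : (x, y) \in U =
  [&& (x, y) \in lines0 D, (x, y) \notin gated0 D, row x < i, row y < i,
      C <= col x & col y <= C'].
Proof.
rewrite mem_sort mem_filter /=; case: (_ \in lines0 D); rewrite ?andbT ?andbF //.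
Qed.

Let bb k : k < u ->
  [/\ (b k, b' k) \in lines0 D, (b k, b' k) \notin gated0 D, row (b k) < i,
      row (b' k) < i & C <= col (b k) /\ col (b' k) <= C'].
Proof.
move=> hk; have := mem_nth d0 hk; rewrite [nth _ _ _]surjective_pairing.
by rewrite mem_ungated => /and5P[-> -> -> -> /andP[]].
Qed.

Let nbf : [/\ C < C', C' < size ns, h C = i, h C' = i & nonfirst C'].
Proof. exact: nb_facts. Qed.

Let Uline k : k < u ->
  [/\ C <= col (b k), col (b k) < col (b' k), col (b' k) <= C',
      h (col (b' k)) < i &
      forall c, i <= h c -> ~~ (col (b k) < c < col (b' k))].
Proof.
move=> hk; have [l0 ng r1 r2 [c1 c2]] := bb hk.
have [x1 x2 x3 x4] := inv_box I (lines0_lines l0).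
have [a1 a2 a3] := inv_0 I l0.
by split=> //; [rewrite -a1|move=> c hc; apply: (inv_0s I l0); lia].
Qed.

Let Uuniq : uniq U.
Proof. by rewrite sort_uniq filter_uniq // (inv_uniq I). Qed.

Let Uchain k : k.+1 < u -> col (b' k) <= col (b k.+1).
Proof.
move=> hk1; have hk : k < u by lia.
have [l0 ng r1 r2 [c1 c2]] := bb hk.
have [l0' ng' r1' r2' [c1' c2']] := bb hk1.
have hso : sorted (fun l l' : nat * nat => col l.1 <= col l'.1) U.
  by apply: sort_sorted => l l'; apply: leq_total.
have hle : col (b k) <= col (b k.+1).
  have htr : transitive (fun l l' : nat * nat => col l.1 <= col l'.1).
    by move=> l1 l2 l3; apply: leq_trans.
  by have := sorted_ltn_nth htr d0 hso; move=> /(_ k k.+1 hk hk1 (ltnSn k)).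
have ne : (b k, b' k) <> (b k.+1, b' k.+1).
  rewrite -!surjective_pairing => /eqP; rewrite nth_uniq //; lia.
have [//|hlt] := ungated_disjoint I hset l0 l0' ng ng' r2 r2' ne.
by have [_ + _ _ _] := Uline hk1; lia.
Qed.

Local Notation gapl := (gapl ns i U d0).
Local Notation gapr := (gapr ns i U d0).
Local Notation lo := (lo ns i U d0).
Local Notation lastk := (lastk ns i U d0).
Local Notation firstk := (firstk ns i U d0).
Local Notation del_line := (del_line ns i U d0).
Local Notation new1 := (new_line1 ns i C' U d0).
Local Notation new0 := (new_line0 ns i C' U d0).

Let gapP k : k < u -> _ := @gapP ns i C C' U d0 i_gt0 nbCC' Uline k.
Let b_ltb' k : k < u -> col (b k) < col (b' k) := @b_ltb' ns i C C' U d0 Uline k.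
Let b'_le_b j k : j < k -> k < u -> col (b' j) <= col (b k).
Proof. by move=> hjk hk; apply: (@b'_le_b ns i C C' U d0). Qed.
Let b_lt j k : j < k -> k < u -> col (b j) < col (b k).
Proof. by move=> hjk hk; apply: (@b_lt ns i C C' U d0). Qed.
Let gap_eq j k : j < u -> k < u -> gapl j < gapr k -> gapl k < gapr j ->
  gapl j = gapl k /\ gapr j = gapr k.
Proof. by move=> *; apply: (@gap_eq ns i C C' U d0). Qed.
Let gapl_lt k : k < u -> gapl k < gapr k.
Proof. by move=> *; apply: (@gapl_lt ns i C C' U d0). Qed.
Let gapl_eqr j k : j < u -> k < u -> gapl j = gapl k -> gapr j = gapr k.
Proof. by move=> *; apply: (@gapl_eqr ns i C C' U d0). Qed.
Let firstk_uniq j k : j < u -> k < u -> firstk j -> firstk k ->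
  gapl j = gapl k -> j = k.
Proof. by move=> *; apply: (@firstk_uniq ns i C C' U d0). Qed.
Let lastk_uniq j k : j < u -> k < u -> lastk j -> lastk k ->
  gapl j = gapl k -> j = k.
Proof. by move=> *; apply: (@lastk_uniq ns i C C' U d0). Qed.

Let qbox k : k < u ->
  [/\ inbox ns (gapl k) i, inbox ns (gapr k) i, hasl (box (gapr k) i) &
      lnbr (box (gapr k) i) = box (gapl k) i].
Proof.
move=> hk; have [g1 g2 g3 g4 [g5 g6 g7]] := gapP hk.
have ip : inbox ns (gapl k) i by rewrite /inbox i_gt0.
have iq : inbox ns (gapr k) i by rewrite /inbox i_gt0.
have hlt : gapl k < gapr k by have := b_ltb' hk; lia.
split=> //.
  by apply: (@hasl_col _ (gapl k)); rewrite ?col_box ?row_box.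
rewrite /lnbr row_box // col_box //; congr box; apply: lcol_uniq => //.
Qed.

Let f_b' k : k < u -> f (b' k) = b k.
Proof.
move=> hk; have [l0 ng _ _ _] := bb hk.
by apply/eqP; rewrite (inv_g I l0).
Qed.

Let f_q k : k < u -> f (box (gapr k) i) = box (gapl k) i.
Proof.
move=> hk; have [q1 q2 q3 q4] := qbox hk; rewrite -q4; apply: hint.2.
- exact: box_lt.
- exact: row_box.
- rewrite col_box //; have [g1 g2 g3 g4 _] := gapP hk.
  by have := b_ltb' hk; lia.
Qed.

(** Until the pair is rerouted, only horizontal lines enter R_i between [C] and [C'], so the line to
    be deleted is the only one into the right end of a gap. *)
Let into_q x k : k < u -> (x, box (gapr k) i) \in lines D -> x = box (gapl k) i.
Proof.
move=> hk hl; have [q1 q2 q3 q4] := qbox hk; rewrite -q4.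
have [g1 g2 g3 g4 [g5 g6 g7]] := gapP hk; have hbk := b_ltb' hk.
have [n1 n2 n3 n4 n5] := nbf.
have hr := row_box q2; have hc := col_box q2.
have [hri|hri] := ltnP i (row x).
  by apply: (inv_hi I hl); left.
apply: (hint.1 _ _ hl); rewrite ?hr ?hc //; last by right.
have : ~~ (col x < C < gapr k).
  by rewrite -hc; apply: (inv_str I hl); rewrite ?hr n3.
by lia.
Qed.

Let b'_inj j k : j < u -> k < u -> b' j = b' k -> j = k.
Proof.
move=> hj hk e; case: (ltngtP j k) => // hlt.
  have := @b'_le_b _ _ hlt hk.
  by have := b_ltb' hk; rewrite e; lia.
have := @b'_le_b _ _ hlt hj.
by have := b_ltb' hj; rewrite e; lia.
Qed.

Let b_inj j k : j < u -> k < u -> b j = b k -> j = k.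
Proof.
move=> hj hk e; case: (ltngtP j k) => // hlt.
  by have := @b_lt _ _ hlt hk; rewrite e ltnn.
by have := @b_lt _ _ hlt hj; rewrite e ltnn.
Qed.

Let b'_ne_q j k : j < u -> k < u -> b' j <> box (gapr k) i.
Proof.
move=> hj hk e; have [_ _ _ hr _] := bb hj; have [_ q2 _ _] := qbox hk.
by move: hr; rewrite e row_box // ltnn.
Qed.

Let gapr_inj j k : j < u -> k < u -> gapr j = gapr k -> gapl j = gapl k.
Proof.
move=> hj hk e; have [] := @gap_eq j k hj hk => //.
  have := @gapl_lt _ hj; lia.
have := @gapl_lt _ hk; lia.
Qed.

Let box_inj c d : inbox ns c i -> inbox ns d i -> box c i = box d i -> c = d.
Proof. by move=> hc hd e; rewrite -(col_box hc) e col_box. Qed.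

Let ex_last k : k < u -> exists k', [/\ k' < u, lastk k', gapl k' = gapl k & gapr k' = gapr k].
Proof.
move=> hk; have [k' [_ h2 h3 h4]] := @max_such_last ns i C C' U d0 i_gt0 nbCC' Uline Uchain k hk.
by exists k'; split=> //; apply: gapl_eqr.
Qed.

Let bN k : k < u -> b k < N /\ b' k < N.
Proof. by move=> hk; have [l0 _ _ _ _] := bb hk; have [] := inv_box I (lines0_lines l0). Qed.

(** The comparison of keys is what dictates the order within a column: if [b k] lies in the left end
    of its gap, the new start is the box of R_i below it, and this box has to come first. *)
Let loP k : k < u ->
  [/\ lo k < N, gapl k <= col (lo k), col (lo k) < col (b' k), row (lo k) <= i
    & key (lo k) < key (b k)].
Proof.
move=> hk; have [g1 g2 g3 g4 [g5 g6 g7]] := gapP hk.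
have [q1 q2 q3 q4] := qbox hk; have hbk := b_ltb' hk.
have [l0 ng r1 r2 _] := bb hk.
rewrite /lo; case: ifPn => [fk|].
  rewrite box_lt // col_box // row_box //; split=> //; first by lia.
  case: (ltngtP (gapl k) (col (b k))) => hc; last 1 first.
  - by apply: key_row; rewrite ?col_box ?row_box ?box_lt.
  - by apply: key_col; rewrite col_box.
  - by lia.
rewrite negb_or negbK => /andP[k0 /eqP e].
have hk1 : k.-1 < u by lia.
have hlt := @b_lt k.-1 k; have hlt' := hlt _ hk.
have [p1 p2 p3 p4 _] := gapP hk1; have [_ _ r1' _ _] := bb hk1.
have [hN _] := bN hk1.
by split=> //; [rewrite -e|lia|lia|apply: key_col; lia].
Qed.

Let lo_inj j k : j < u -> k < u -> lo j = lo k -> j = k.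
Proof.
move=> hj hk; have [p1 _ _ _] := qbox hj; have [q1 _ _ _] := qbox hk.
rewrite /lo; case: ifPn => fj; case: ifPn => fk.
- move=> /(box_inj p1 q1) e.
  exact: firstk_uniq.
- move=> e; have hk1 : k.-1 < u by lia.
  by have [_ _ + _ _] := bb hk1; rewrite -e row_box // ltnn.
- move=> e; have hj1 : j.-1 < u by lia.
  by have [_ _ + _ _] := bb hj1; rewrite e row_box // ltnn.
- have hj1 : j.-1 < u by lia.
  have hk1 : k.-1 < u by lia.
  move: fj fk; rewrite !negb_or => /andP[j0 _] /andP[k0 _] /(b_inj hj1 hk1); lia.
Qed.

Let lo_ne_last j k : j < u -> k < u -> lastk k -> lo j <> b k.
Proof.
move=> hj hk lk; rewrite /lo; have [p1 _ _ _] := qbox hj.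
case: ifPn => fj e.
  by have [_ _ + _ _] := bb hk; rewrite -e row_box // ltnn.
have hj1 : j.-1 < u by lia.
have ek := b_inj hj1 hk e; move: fj lk; rewrite /firstk /lastk -ek.
rewrite negb_or negbK => /andP[j0 /eqP ->].
have -> : j.-1.+1 = j by lia.
by rewrite eqxx orbF => /eqP; lia.
Qed.

(** In a gap, [f] joins [b k] to [b' k] and the boxes of R_i at the two ends to each other. The new
    map has the same starts and the same ends, with the starts permuted cyclically; this is why it
    remains injective. *)
Definition rerouted y :=
  if [pick k : 'I_u | b' k == y] is Some k then lo k
  else if [pick k : 'I_u | lastk k && (box (gapr k) i == y)] is Some k then b k
  else f y.

Let f' := rerouted.

Let f'_b' k : k < u -> f' (b' k) = lo k.
Proof.
move=> hk; rewrite /f' /rerouted; case: pickP => [j /eqP e|/(_ (Ordinal hk))].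
  by rewrite (b'_inj (ltn_ord j) hk e).
by rewrite /= eqxx.
Qed.

Let f'_q k : k < u -> lastk k -> f' (box (gapr k) i) = b k.
Proof.
move=> hk lk; rewrite /f' /rerouted; case: pickP => [j /eqP e|_].
  by case: (b'_ne_q (ltn_ord j) hk).
case: pickP => [j /andP[lj /eqP e]|/(_ (Ordinal hk))]; last by rewrite /= lk eqxx.
have [_ p2 _ _] := qbox (ltn_ord j); have [_ q2 _ _] := qbox hk.
have e1 := gapr_inj (ltn_ord j) hk (box_inj p2 q2 e).
by rewrite (@lastk_uniq _ _ _ hk lj lk e1).
Qed.

Let f'P y : [\/ exists2 k, k < u & y = b' k /\ f' y = lo k,
   exists2 k, k < u & [/\ lastk k, y = box (gapr k) i & f' y = b k] |
   [/\ forall k, k < u -> y <> b' k, forall k, k < u -> y <> box (gapr k) i &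
       f' y = f y]].
Proof.
rewrite /f' /rerouted; case: pickP => [k /eqP e|n1].
  by constructor 1; exists k; rewrite // -e.
case: pickP => [k /andP[lk /eqP e]|n2].
  by constructor 2; exists k; rewrite // -e.
constructor 3; split=> // k hk e.
  by have := n1 (Ordinal hk); rewrite /= e eqxx.
have [k' [h1 h2 h3 h4]] := ex_last hk.
by have := n2 (Ordinal h1); rewrite /= h2 h4 e eqxx.
Qed.

Hypothesis U_neq0 : U <> [::].
Let D' := reroute ns i D (C, C').
Let spec := @reroute_spec ns i C C' D i_gt0 nbCC' Uline Uchain U_neq0.

Let mem1 l : l \in lines1 D' <-> (l \in lines1 D /\ ~ del_line l) \/ new1 l.
Proof. by have [+ _ _ _] := spec; apply. Qed.
Let mem0 l : l \in lines0 D' <-> (l \in lines0 D /\ ~ del_line l) \/ new0 l.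
Proof. by have [_ + _ _] := spec; apply. Qed.
Let memg l : (l \in gated0 D') = (l \in U) || (l \in gated0 D).
Proof. by have [_ _ -> _] := spec; rewrite mem_cat. Qed.

Let new_line x y := (exists2 k, k < u & x = lo k /\ y = b' k) \/
  (exists2 k, k < u & [/\ lastk k, x = b k & y = box (gapr k) i]).

Let mem_new x y : new_line x y <-> new1 (x, y) \/ new0 (x, y).
Proof.
split.
  case=> [[k hk [-> ->]]|[k hk [lk -> ->]]]; first by left; left; exists k.
  by have [e|ne] := eqVneq (gapr k) C'; [right|left; right]; exists k;
    split=> //; rewrite ?e //; apply/eqP.
case=> [[[k hk [-> ->]]|[k [hk lk _ [-> ->]]]]|[k [hk lk e [-> ->]]]].
- by left; exists k.
- by right; exists k.
- by right; exists k; rewrite // e.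
Qed.

Let memL x y : (x, y) \in lines D' <->
  ((x, y) \in lines D /\ ~ del_line (x, y)) \/ new_line x y.
Proof.
rewrite !mem_cat; split.
  case/orP=> [/mem1|/mem0] [[h1 h2]|h1].
  - by left; rewrite h1.
  - by right; apply/mem_new; left.
  - by left; rewrite h1 orbT.
  - by right; apply/mem_new; right.
case=> [[/orP[h1|h1] h2]|/mem_new[h1|h1]]; apply/orP.
- by left; apply/mem1; left.
- by right; apply/mem0; left.
- by left; apply/mem1; right.
- by right; apply/mem0; right.
Qed.

Let new_gap x y : new_line x y -> exists2 k, k < u &
  [/\ gapl k <= col x, col x < col y, col y <= gapr k, row x <= i & row y <= i] /\
  [/\ x < N, y < N & hasl y].
Proof.
case=> [[k hk [-> ->]]|[k hk [lk -> ->]]]; exists k => //;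
  have [g1 g2 g3 g4 [g5 g6 g7]] := gapP hk; have [bn b'n] := bN hk;
  have [l0 ng r1 r2 _] := bb hk; have [x1 x2 x3 x4] := inv_box I (lines0_lines l0).
  have [o1 o2 o3 o4 o5] := loP hk.
  by split; split=> //; lia.
have [q1 q2 q3 q4] := qbox hk; rewrite col_box // row_box //.
by split; split=> //; [lia|lia|exact: box_lt].
Qed.

Let new0P x y : new0 (x, y) -> exists2 k, k < u &
  [/\ lastk k, gapr k = C', x = b k, y = box C' i & new_line x y].
Proof.
move=> h0; have hn : new_line x y by apply/mem_new; right.
by case: h0 => k [hk lk e [ex ey]]; exists k.
Qed.

Let C'box : inbox ns C' i.
Proof. by have [_ _ _ e _] := nbf; rewrite /inbox i_gt0 e /=. Qed.

Let new0_old0 x y : new0 (x, y) -> (x, y) \in lines0 D -> False.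
Proof.
case/new0P=> k hk [lk e -> -> _] hl; rewrite -e in hl.
have := into_q hk (lines0_lines hl) => eb.
have [q1 _ _ _] := qbox hk; have [_ _ + _ _] := bb hk.
by rewrite eb row_box // ltnn.
Qed.

Let old0_C' x k : k < u -> gapr k = C' -> (x, box C' i) \in lines0 D ->
  del_line (x, box C' i).
Proof.
move=> hk e hl; exists k => //; congr (_, _); last by rewrite e.
by apply: into_q => //; rewrite e; apply: lines0_lines.
Qed.

Lemma rerouted_inv : inv i D' f'.
Proof.
have [n1 n2 n3 n4 n5] := nbf.
split.
- move=> x y /memL[[hl _]|/new_gap[k hk [[? ? ? ? ?] [? ? ?]]]] //.
  exact: (inv_box I hl).
- move=> x y /memL[[hl _]|/new_gap[k hk [[g1 g2 g3 g4 g5] _]]] c hc hx hy.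
    exact: (inv_str I hl).
  have [_ _ _ _ [_ _ hn]] := gapP hk.
  by apply/negP => hcc; have := hn c; lia.
- move=> x y /memL[[hl _]|/new_gap[k hk [[g1 g2 g3 g4 g5] _]]]; last by lia.
  exact: (inv_hi I hl).
- move=> y hy hh; apply/memL; case: (f'P y).
  + by case=> k hk [-> ->]; right; left; exists k.
  + by case=> k hk [lk -> ->]; right; right; exists k.
  + case=> nb nq ->; left; split; first exact: (inv_f I).
    by case=> k hk [_ ey]; case: (nq k hk).
(* The old line from [b k] into [b' k] survives, but its start now has a larger key than [lo k]; at
   the right end of a gap, the only old line is the deleted one. *)
- move=> x y /memL[[hl nd]|[[k hk [-> ->]]|[k hk [lk -> ->]]]].
  + case: (f'P y).
    * case=> k hk [ey ->]; rewrite ey in hl.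
      have := inv_min I hl; rewrite f_b' //.
      by have [_ _ _ _ o5] := loP hk; lia.
    * case=> k hk [lk ey ->]; rewrite ey in hl nd.
      by case: nd; exists k => //; rewrite (into_q hk hl).
    * by case=> _ _ ->; apply: (inv_min I hl).
  + by rewrite f'_b'.
  + by rewrite f'_q.
(* By [B] and [Q], a box whose old start is used by the rerouting is itself rerouted. Hence, by [X],
   a box left alone shares its start with no rerouted box. *)
- have B y k : y < N -> hasl y -> f y = b k -> k < u -> y = b' k.
    move=> hy hh e hk; apply: (inv_f_inj I) => //; rewrite ?f_b' //.
      by have [] := bN hk.
    by have [l0 _ _ _ _] := bb hk; have [] := inv_box I (lines0_lines l0).
  have Q y k : y < N -> hasl y -> f y = box (gapl k) i -> k < u -> y = box (gapr k) i.
    move=> hy hh e hk; have [q1 q2 q3 q4] := qbox hk.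
    by apply: (inv_f_inj I) => //; rewrite ?f_q // box_lt.
  have X y y' : y < N -> hasl y -> (forall k, k < u -> y <> b' k) ->
      (forall k, k < u -> y <> box (gapr k) i) -> f y = f' y' ->
      (exists2 k, k < u & y' = b' k) \/ (exists2 k, k < u & lastk k /\ y' = box (gapr k) i) -> False.
    move=> hy hh nb nq e [[k hk ey]|[k hk [lk ey]]]; move: e; rewrite ey.
      rewrite f'_b' // /lo; case: ifP => _ e; first by case: (nq k hk); apply: Q.
      have hk1 : k.-1 < u by lia.
      by case: (nb _ hk1); apply: B.
    by rewrite f'_q // => e; case: (nb k hk); apply: B.
  move=> y y' hy hy' hh hh' e.
  case: (f'P y) => [[k hk [ey ek]]|[k hk [lk ey ek]]|[nb nq ek]];
  case: (f'P y') => [[j hj [ey' ej]]|[j hj [lj ey' ej]]|[nb' nq' ej]].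
  + by rewrite ey ey'; rewrite (@lo_inj k j) // -ek -ej.
  + by case: (@lo_ne_last k j hk hj lj); rewrite -ek -ej.
  + case: (X y' y) => //; first by rewrite -ej.
    by left; exists k.
  + by case: (@lo_ne_last j k hj hk lk); rewrite -ek -ej.
  + by rewrite ey ey' (@b_inj k j) // -ek -ej.
  + case: (X y' y) => //; first by rewrite -ej.
    by right; exists k.
  + case: (X y y') => //; first by rewrite -ek.
    by left; exists j.
  + case: (X y y') => //; first by rewrite -ek.
    by right; exists j.
  + by apply: (inv_f_inj I) => //; rewrite -ek -ej.
- move=> y hy hh; case: (f'P y) => [[k hk [ey ->]]|[k hk [lk ey ->]]|[nb nq ->]].
  + by have [_ _ _ o4 _] := loP hk; lia.
  + by have [_ _ r1 _ _] := bb hk; lia.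
  + exact: (inv_row I).
- move=> y hy hh hr; case: (f'P y) => [[k hk [ey _]]|[k hk [lk ey _]]|[nb nq ->]].
  + by have [_ _ _ r2 _] := bb hk; rewrite ey in hr; lia.
  + by have [_ q2 _ _] := qbox hk; rewrite ey row_box // ltnn in hr.
  + exact: (inv_fhi I).
- move=> [x y] /mem0 h0; apply/negP => /mem1 h1.
  case: h0 => [[hl nd]|hn0].
    case: h1 => [[hl1 _]|].
      by have := inv_lab I hl; rewrite hl1.
    case=> [[k hk [ex ey]]|[k [hk lk ne [ex ey]]]].
      have [l0 _ _ _ _] := bb hk; rewrite ey in hl.
      have := inv_0u I hl l0; rewrite ex => e.
      by have [_ _ _ _] := loP hk; rewrite e ltnn.
    have [q1 q2 q3 q4] := qbox hk.
    case: nd; exists k => //; rewrite ey in hl *.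
    by rewrite (into_q hk (lines0_lines hl)).
  case/new0P: (hn0) => k hk [lk e ex ey _].
  case: h1 => [[hl1 _]|].
    rewrite ey -e in hl1; have := into_q hk (lines1_lines hl1); rewrite ex => eb.
    have [q1 _ _ _] := qbox hk; have [_ _ + _ _] := bb hk.
    by rewrite eb row_box // ltnn.
  case=> [[j hj [_ ey']]|[j [hj lj ne [_ ey']]]].
    by case: (b'_ne_q hj hk); rewrite -ey' ey e.
  apply: ne; have [_ q2 _ _] := qbox hj.
  by apply: box_inj => //; rewrite -ey' ey.
- move=> x y /mem0[[hl _]|hn0]; first exact: (inv_0 I).
  case/new0P: (hn0) => k hk [lk e -> -> _].
  rewrite row_box // col_box // n4; split=> //.
  by have [_ _ r1 _ _] := bb hk; lia.
- move=> x y /mem0[[hl _]|hn0] c hc; first exact: (inv_0s I hl).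
  case/new0P: (hn0) => k hk [lk e ex ey hn]; move: hc; rewrite ex ey.
  rewrite row_box // col_box // => hc.
  have [_ g2 g3 _ [_ _ g7]] := gapP hk.
  by apply/negP => hcc; have := g7 c; lia.
- move=> x x' y /mem0[[hl nd]|hn0] /mem0[[hl' nd']|hn0'].
  + exact: (inv_0u I hl hl').
  + case/new0P: (hn0') => k hk [lk e _ ey _]; case: nd; rewrite ey in hl *.
    exact: (old0_C' hk e).
  + case/new0P: (hn0) => k hk [lk e _ ey _]; case: nd'; rewrite ey in hl' *.
    exact: (old0_C' hk e).
  + case/new0P: (hn0) => k hk [lk e -> _ _].
    case/new0P: (hn0') => k' hk' [lk' e' -> _ _].
    have eg := gapr_inj hk hk'; rewrite e e' in eg.
    by rewrite (@lastk_uniq _ _ hk hk' lk lk' (eg erefl)).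
(* The line labelled 0 into the bottom of column [q] can only be deleted if [q] is [C'], and then a
   new one from the last [b k] replaces it. *)
- move=> q hq nf; have [x hx] := inv_0e I hq nf.
  have hin : inbox ns q (h q) by rewrite /inbox ns_pos // leqnn.
  have [/existsP[k0 /eqP eb]|nd] :=
    boolP [exists k : 'I_u, box (gapr k) i == box q (h q)]; last first.
    exists x; apply/mem0; left; split=> //; case=> k hk [_ e].
    by case/existsP: nd; exists (Ordinal hk); rewrite e.
  have [k [hk lk el er]] := ex_last (ltn_ord k0).
  have [_ q2 _ _] := qbox (ltn_ord k0).
  have ei : h q = i by rewrite -(row_box hin) -eb row_box.
  have eq : gapr k0 = q by rewrite -(col_box hin) -eb col_box.
  have eC : gapr k0 = C'.
    have [_ _ g3 g4 _] := gapP (ltn_ord k0); apply/eqP; rewrite eqn_leq g4 leqNgt.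
    have [_ _ _ _ hne] := neighbouringP _ _ _ i_gt0 nbCC'.
    apply/negP => hlt; apply: (hne (gapr k0)); last by rewrite eq.
    by have [g1 g2 _ _ _] := gapP (ltn_ord k0); have := b_ltb' (ltn_ord k0); lia.
  exists (b k); apply/mem0; right; exists k; split=> //; first by rewrite er.
  by rewrite ei -eC eq.
- move=> x y /mem0[[hl nd]|hn0]; rewrite memg.
    case: (f'P y) => [[k hk [ey ->]]|[k hk [lk ey _]]|[nb nq ->]].
    + have [l0 ng _ _ _] := bb hk; rewrite ey in hl *.
      have -> := inv_0u I hl l0; rewrite -surjective_pairing mem_nth //=.
      by apply/eqP => e; have [_ _ _ _] := loP hk; rewrite e ltnn.
    + case: nd; exists k => //; rewrite ey in hl *.
      by rewrite (into_q hk (lines0_lines hl)).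
    + rewrite (inv_g I hl) negb_or andbC; case: (_ \notin gated0 D) => //=.
      apply/esym/negP => /(nthP d0)[k hk e]; apply: (nb k hk).
      by rewrite e.
  case/new0P: (hn0) => k hk [lk e -> -> _].
  rewrite -e f'_q // eqxx; apply/esym/negP => /orP[].
    by rewrite mem_ungated row_box ?ltnn ?andbF //; have [] := qbox hk.
  by move/(inv_gr I); rewrite row_box ?ltnn //; have [] := qbox hk.
- move=> x y; rewrite memg => /orP[|/(inv_gr I)//].
  by rewrite mem_ungated => /and5P[_ _ _ ->].
- have [_ _ _] := spec; apply; first exact: (inv_uniq I).
  by move=> [x y] hn0; apply/negP => /(new0_old0 hn0).
Qed.

Lemma rerouted_settled : settled D' i C C'.
Proof.
apply: (settled_intro i_gt0 nbCC' rerouted_inv) => x y /mem0[[hl nd]|].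
  rewrite memg negb_or => /andP[hU ng] h1 h2 h3 h4.
  by move: hU; rewrite mem_ungated hl ng h1 h2 h3 h4.
by case/new0P=> k hk [_ _ _ -> _] _ _; rewrite row_box // ltnn.
Qed.

(* A new line starting in [reg s A A'] would start where an ungated line into
   the bottom of [A'] starts, so it ends beyond [A']. *)
Lemma new_line_reg s A A' x y : 0 < s < i -> neighbouring ns s A A' ->
  new_line x y -> ~~ reg s A A' (x, y).
Proof.
move=> hs hn hnew; apply/negP => /and3P[/= r1 r2 r3].
have s0 : 0 < s by lia.
have [m1 m2 m3 m4 m5] := nb_facts s0 hn.
have inA : inbox ns A' s by rewrite /inbox s0 m4 /=.
have H k : k < u -> row (b k) <= s -> A <= col (b k) -> col (b' k) <= A' ->
    col (b' k) = A'.
  move=> hk h1 h2 h3; have [l0 ng _ _ _] := bb hk.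
  by rewrite (hset hs hn l0 ng h1 h2 h3) col_box.
case: hnew => [[k hk [ex ey]]|[k hk [lk ex ey]]]; rewrite {}ex {}ey in r1 r2 r3.
  move: r1 r2; rewrite /lo; case: ifPn => fk r1 r2.
    by have [q1 _ _ _] := qbox hk; move: r1; rewrite row_box //; lia.
  move: fk; rewrite negb_or => /andP[k0 _].
  have hk1 : k.-1 < u by lia.
  have hlt : col (b' k.-1) < col (b' k).
    have hlt : k.-1 < k by lia.
    have := @b'_le_b _ _ hlt hk.
    by have := b_ltb' hk; lia.
  have h3 : col (b' k.-1) <= A' by lia.
  by have := H _ hk1 r1 r2 h3; lia.
have [_ q2 _ _] := qbox hk; move: r3; rewrite col_box // => r3.
have [_ _ g3 _ _] := gapP hk.
have h3 : col (b' k) <= A' by lia.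
by have := H _ hk r1 r2 h3; lia.
Qed.

Lemma rerouted_settled_lt s A A' : 0 < s < i -> neighbouring ns s A A' ->
  settled D' s A A'.
Proof.
move=> hs hn x y /mem0[[hl nd]|hn0].
  rewrite memg negb_or => /andP[_ ng]; exact: hset hl ng.
move=> _ r1 r2 r3; case/new0P: hn0 => k hk [_ _ _ _ hnew].
by have := new_line_reg hs hn hnew; rewrite /reg /= r1 r2 r3.
Qed.

Let new1_line x y : new1 (x, y) -> new_line x y.
Proof. by move=> hl; apply/mem_new; left. Qed.

Let del_row x y : del_line (x, y) ->
  [/\ row x = i, C <= col x, col x < col y & col y <= C'].
Proof.
case=> k hk [-> ->]; have [q1 q2 _ _] := qbox hk.
rewrite row_box // !col_box //; have [g1 g2 g3 g4 _] := gapP hk.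
by have := b_ltb' hk; split=> //; lia.
Qed.

Lemma rerouted_pairing_lt s A A' g : 0 < s < i -> neighbouring ns s A A' ->
  pairing D s A A' g -> pairing D' s A A' g.
Proof.
move=> hs hn; apply: pairing_ext => -[x y] hr; apply/idP/idP.
- case/mem1=> [[]//|/new1_line hnew].
  by have := new_line_reg hs hn hnew; rewrite hr.
- move=> hl; apply/mem1; left; split=> // /del_row[e _ _ _].
  by case/and3P: hr => /= r1 _ _; lia.
- case/mem0=> [[]//|/new0P[k hk [_ _ _ _ hnew]]].
  by have := new_line_reg hs hn hnew; rewrite hr.
- move=> hl; apply/mem0; left; split=> // /del_row[e _ _ _].
  by case/and3P: hr => /= r1 _ _; lia.
Qed.

Let new_within x y : new_line x y -> C <= col x /\ col x < col y <= C'.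
Proof.
case/new_gap=> k hk [[h1 h2 h3 _ _] _]; have [g1 _ _ g4 _] := gapP hk; lia.
Qed.

Lemma rerouted_outside x y : col y <= C \/ C' <= col x ->
  [/\ ((x, y) \in lines1 D') = ((x, y) \in lines1 D),
      ((x, y) \in lines0 D') = ((x, y) \in lines0 D) &
      ((x, y) \in gated0 D') = ((x, y) \in gated0 D)].
Proof.
move=> hxy; split.
- apply/idP/idP => [/mem1[[]//|/new1_line/new_within]|hl]; first by lia.
  by apply/mem1; left; split=> // /del_row[_]; lia.
- apply/idP/idP => [/mem0[[]//|/new0P[k hk [_ _ _ _ /new_within]]]|hl].
    by lia.
  by apply/mem0; left; split=> // /del_row[_]; lia.
- rewrite memg orbC; case: (boolP (_ \in gated0 D)) => //= ng.
  rewrite mem_ungated; apply/negbTE/negP => /and5P[hl _ _ _ /andP[h1 h2]].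
  by have [_ _ hlt _] := inv_box I (lines0_lines hl); lia.
Qed.

Lemma rerouted_f_outside y : col y <= C \/ C' < col y -> f' y = f y.
Proof.
case: (f'P y) => [[k hk [ey _]]|[k hk [lk ey _]]|[_ _ ->]] //; rewrite ey.
  have [c1 c2 c3 _ _] := Uline hk; lia.
have [_ q2 _ _] := qbox hk; rewrite col_box //.
have [g1 g2 g3 g4 _] := gapP hk; have := b_ltb' hk; lia.
Qed.

End Step.

Lemma reroute_step i C C' D f : 0 < i -> neighbouring ns i C C' -> inv i D f ->
  (forall s A A', 0 < s < i -> neighbouring ns s A A' -> settled D s A A') ->
  intact i C C' D f ->
  let D' := reroute ns i D (C, C') in exists f',
  [/\ inv i D' f', settled D' i C C',
      forall s A A', 0 < s < i -> neighbouring ns s A A' -> settled D' s A A' /\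
        forall g, pairing D s A A' g -> pairing D' s A A' g,
      forall x y, col y <= C \/ C' <= col x ->
        [/\ ((x, y) \in lines1 D') = ((x, y) \in lines1 D),
            ((x, y) \in lines0 D') = ((x, y) \in lines0 D) &
            ((x, y) \in gated0 D') = ((x, y) \in gated0 D)] &
      forall y, col y <= C \/ C' < col y -> f' y = f y].
Proof.
move=> i0 hn I hset hint D'.
have [eU|neU] := eqVneq (ungated ns D i C C') [::].
  have eD : D' = D by rewrite /D' /reroute eU.
  exists f; rewrite eD; split=> //.
    apply: (settled_intro i0 hn I) => x y h1 h2 h3 h4 h5 h6.
    by have := mem_ungated i C C' D x y; rewrite eU h1 h2 h3 h4 h5 h6.
  by move=> s A A' hs hnb; split=> //; apply: hset.
have {}neU : ungated ns D i C C' <> [::] by apply/eqP.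
exists (rerouted i C C' D f); split.
- by apply: (@rerouted_inv i C C' D f).
- by apply: (@rerouted_settled i C C' D f).
- move=> s A A' hs hnb; split; first by apply: (@rerouted_settled_lt i C C' D f).
  by move=> g; apply: (@rerouted_pairing_lt i C C' D f).
- by move=> x y; apply: (@rerouted_outside i C C' D f).
- by move=> y; apply: (@rerouted_f_outside i C C' D f).
Qed.

Lemma nb_disjoint i C C' A A' : 0 < i -> neighbouring ns i C C' ->
  neighbouring ns i A A' -> (C, C') <> (A, A') -> A' <= C \/ C' <= A.
Proof.
move=> i0 /(neighbouringP _ _ _ i0)[c1 c2 c3 c4 c5].
move=> /(neighbouringP _ _ _ i0)[a1 a2 a3 a4 a5] ne.
have [|h1] := leqP A' C; [by left|right]; rewrite leqNgt; apply/negP => h2.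
have e : C' = A'.
  case: (ltngtP C' A') => // hlt; first by case: (a5 C') => //; lia.
  by case: (c5 A') => //; lia.
apply: ne; congr (_, _) => //; case: (ltngtP C A) => // hlt.
  by case: (c5 A) => //; lia.
by case: (a5 C) => //; lia.
Qed.

Lemma stage_inv i D f : inv i D f ->
  (forall s A A', 0 < s <= i -> neighbouring ns s A A' -> settled D s A A' /\
     exists g, pairing D s A A' g) ->
  let D' := stage ns D i.+1 in exists f', inv i.+1 D' f' /\
  forall s A A', 0 < s <= i.+1 -> neighbouring ns s A A' -> settled D' s A A' /\
     exists g, pairing D' s A A' g.
Proof.
move=> I hs; set j := i.+1; have j0 : 0 < j by [].
have uN : uniq (neighbours ns j).
  by rewrite filter_uniq // allpairs_uniq ?iota_uniq // => -[? ?] [? ?].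
have hint CC : CC \in neighbours ns j -> intact j CC.1 CC.2 D f.
  by rewrite mem_neighbours => hn; apply: inv_intact.
have hdone CC : CC \in neighbours ns j -> CC \notin neighbours ns j ->
    settled D j CC.1 CC.2 /\ exists g, pairing D j CC.1 CC.2 g.
  by move=> ->.
have {}I := inv_succ I; have sub : {subset neighbours ns j <= neighbours ns j} by [].
(* Induction on the pairs still to be treated: these are intact, the others settled and paired.
   Pairs of equal height do not overlap, so treating one leaves the rest alone. *)
suff gen rest E e : inv j E e ->
    (forall s A A', 0 < s <= i -> neighbouring ns s A A' -> settled E s A A' /\
       exists g, pairing E s A A' g) ->
    {subset rest <= neighbours ns j} -> uniq rest ->
    (forall CC, CC \in rest -> intact j CC.1 CC.2 E e) ->
    (forall CC, CC \in neighbours ns j -> CC \notin rest ->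
       settled E j CC.1 CC.2 /\ exists g, pairing E j CC.1 CC.2 g) ->
    let E' := foldl (reroute ns j) E rest in exists f', inv j E' f' /\
    forall s A A', 0 < s <= j -> neighbouring ns s A A' -> settled E' s A A' /\
       exists g, pairing E' s A A' g.
  exact: gen I hs sub uN hint hdone.
elim: rest E e {I hs hint hdone uN sub} => [|[C C'] rest IH] {}D {}f I hs sub uN hint hdone.
  exists f; split=> // s A A' hsi hn; have [|hlt] := leqP s i.
    by move=> hle; apply: hs => //; lia.
  have e : s = j by lia.
  by rewrite e in hn *; apply: (hdone (A, A')); rewrite // mem_neighbours.
move: uN => /=/andP[nin uN].
have hn : neighbouring ns j C C'.
  by have := sub (C, C') (mem_head _ _); rewrite mem_neighbours.
have hset s A A' : 0 < s < j -> neighbouring ns s A A' -> settled D s A A'.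
  by move=> hsj hnb; case: (hs s A A') => //; lia.
have [f' [h1 h2 h3 h4 h5]] :=
  reroute_step j0 hn I hset (hint _ (mem_head _ _)).
have hdisj CC : CC \in neighbours ns j -> CC <> (C, C') ->
    CC.2 <= C \/ C' <= CC.1.
  rewrite mem_neighbours; case: CC => A A' /= hA ne.
  by apply: (nb_disjoint j0 hn hA) => e; apply: ne.
have far CC x y : CC.2 <= C \/ C' <= CC.1 -> CC.1 <= col x -> col y <= CC.2 ->
    col y <= C \/ C' <= col x.
  by case=> hd hx hy; [left; apply: leq_trans hy hd|right; apply: leq_trans hd hx].
apply: (IH _ f') => //.
- move=> s A A' hsi hnb; have hsj : 0 < s < j by lia.
  have [k1 k2] := h3 s A A' hsj hnb; split=> //.
  by have [_ [g hg]] := hs s A A' hsi hnb; exists g; apply: k2.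
- by move=> CC hCC; apply: sub; rewrite inE hCC orbT.
- move=> CC hCC; have ne : CC <> (C, C') by move=> e; rewrite -e hCC in nin.
  have hm : CC \in (C, C') :: rest by rewrite inE hCC orbT.
  have hd := hdisj CC (sub _ hm) ne; have hd2 x y := far CC x y hd.
  have [i1 i2] := hint _ hm; split=> [x y hl hx hy|y hy hr hc].
    apply: i1 => //; have hd' := hd2 x y hx hy.
    have [e1 e0 _] := h4 x y hd'.
    by move: hl; rewrite !mem_cat e1 e0.
  rewrite h5 ?i2 //; case: hd => hd; [left|right].
    by case/andP: hc => _ hc; apply: leq_trans hc hd.
  by case/andP: hc => hc _; apply: leq_ltn_trans hd hc.
- move=> CC hCC nCC; have [->|/eqP ne] := eqVneq CC (C, C').
    by split=> //; exists f'; apply: settled_pairing.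
  have hd := hdisj CC hCC ne; have hd2 x y := far CC x y hd.
  have hnb : neighbouring ns j CC.1 CC.2 by rewrite -mem_neighbours.
  have [|k1 [g k2]] := hdone CC hCC; first by rewrite inE negb_or nCC andbT; apply/eqP.
  split.
    move=> x y hl ng hr hx hy; have hd' := hd2 x y hx hy.
    have [e1 e0 eg] := h4 x y hd'.
    by apply: (k1 x) => //; rewrite -?e0 -?eg.
  exists g; apply: pairing_ext k2 => -[x y] /and3P[/= _ hx hy].
    by have [-> _ _] := h4 x y (hd2 x y hx hy).
  by have [_ -> _] := h4 x y (hd2 x y hx hy).
Qed.

Lemma mem_boxes x : (x \in boxes ns) = (x < N).
Proof. by rewrite mem_iota. Qed.

Lemma mem_horizontal x y : (x, y) \in horizontal_lines ns =
  [&& x < N, y < N, hasl y & x == lnbr y].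
Proof.
rewrite mem_filter; have -> : ((x, y) \in [seq (b, c) | b <- boxes ns, c <- boxes ns])
    = (x < N) && (y < N).
  apply/allpairsP/andP => [[[a b]]|[hx hy]].
    by rewrite !mem_boxes => -[? ? [-> ->]].
  by exists (x, y); rewrite !mem_boxes.
rewrite /=; case: (ltnP x N) => hx; rewrite ?andbF //=.
by case: (ltnP y N) => hy; rewrite ?andbF ?andbT //= adjacentE.
Qed.

(** The left neighbour of a bottom box cannot lie before the preceding column of the same height, so
    the condition on the left column holds by itself. *)
Lemma rightmostE x y : (x, y) \in horizontal_lines ns ->
  rightmost_line ns (x, y) = (row y == h (col y)) && nonfirst (col y).
Proof.
rewrite mem_horizontal => /and4P[hx hy hh /eqP ex].
have [l1 l2 l3 l4 l5] := lnbrP hh.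
rewrite /rightmost_line /= ex l3; apply/hasP/andP.
  case=> -[A A']; rewrite mem_neighbours => hn /andP[/= hA /eqP e].
  have [n1 n2 n3 n4 n5] := nb_facts (row_gt0 ns y) hn.
  by rewrite e n4 eqxx.
case=> /eqP e nf; exists (prevcol ns (col y), col y).
  by rewrite mem_neighbours /= e; apply: nonfirst_neighbouring => //; rewrite -e.
rewrite /= eqxx andbT; have [p1 p2 p3] := prevcolP nf.
rewrite leqNgt; apply/negP => hlt; have := l5 (prevcol ns (col y)).
by rewrite hlt p1 p2 -e ltnn => /(_ isT).
Qed.

Lemma mem_initial x y :
  [/\ ((x, y) \in lines (initial_diagram ns)) = ((x, y) \in horizontal_lines ns),
      ((x, y) \in lines1 (initial_diagram ns)) =
        ((x, y) \in horizontal_lines ns) && ~~ rightmost_line ns (x, y) &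
      ((x, y) \in lines0 (initial_diagram ns)) =
        ((x, y) \in horizontal_lines ns) && rightmost_line ns (x, y)].
Proof.
by rewrite mem_cat !mem_filter; case: (rightmost_line _ _); rewrite /= ?andbT ?andbF ?orbF.
Qed.

Lemma initial_inv : inv 0 (initial_diagram ns) lnbr.
Proof.
have ml x y : (x, y) \in lines (initial_diagram ns) ->
    [/\ x < N, y < N, hasl y & x = lnbr y].
  by have [-> _ _] := mem_initial x y; rewrite mem_horizontal => /and4P[? ? ? /eqP].
have m0 x y : (x, y) \in lines0 (initial_diagram ns) ->
    [/\ x < N, y < N, hasl y & x = lnbr y] /\ row y = h (col y) /\ nonfirst (col y).
  have [_ _ ->] := mem_initial x y => /andP[hh]; rewrite rightmostE //.
  by move: hh; rewrite mem_horizontal => /and4P[? ? ? /eqP ?] /andP[/eqP ? ?].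
split.
- by move=> x y /ml[hx hy hh ->]; have [] := lnbrP hh.
- move=> x y /ml[hx hy hh ->] c _ _ hr; have [_ _ _ _ hn] := lnbrP hh.
  by apply/negP => /hn; lia.
- by move=> x y /ml[].
- move=> y hy hh; have [-> _ _] := mem_initial (lnbr y) y.
  by rewrite mem_horizontal hy hh eqxx; have [-> ] := lnbrP hh.
- by move=> x y /ml[_ _ _ ->].
- move=> y y' hy hy' hh hh' e.
  have [l1 l2 l3 l4 l5] := lnbrP hh; have [m1 m2 m3 m4 m5] := lnbrP hh'.
  have er : row y = row y' by rewrite -l3 e m3.
  apply: (@eq_box ns) => //; case: (ltngtP (col y) (col y')) => // hlt.
    by have := m5 (col y); have := row_le hy; rewrite -e; lia.
  by have := l5 (col y'); have := row_le hy'; rewrite e; lia.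
- by move=> y hy hh; have [_ _ -> _ _] := lnbrP hh; rewrite max0n.
- by [].
- move=> [x y]; have [_ -> ->] := mem_initial x y.
  by case/andP=> -> ->.
- move=> x y /m0[[hx hy hh ->] [e nf]]; split=> //.
  by have [_ _ -> _ _] := lnbrP hh.
- move=> x y /m0[[hx hy hh ->] _] c hr; have [_ _ _ _ hn] := lnbrP hh.
  by apply/negP => /hn; lia.
- by move=> x x' y /m0[[_ _ _ ->] _] /m0[[_ _ _ ->] _].
- move=> q hq nf; have hin : inbox ns q (h q) by rewrite /inbox ns_pos // leqnn.
  have [p1 p2 p3] := prevcolP nf.
  have hh : hasl (box q (h q)).
    by apply: (@hasl_col _ (prevcol ns q)); rewrite ?col_box ?row_box // p2.
  exists (lnbr (box q (h q))).
  have hm : (lnbr (box q (h q)), box q (h q)) \in horizontal_lines ns.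
    by rewrite mem_horizontal eqxx hh box_lt //; have [-> ] := lnbrP hh.
  have [_ _ ->] := mem_initial (lnbr (box q (h q))) (box q (h q)).
  by rewrite hm rightmostE // row_box // col_box // eqxx nf.
- by move=> x y /m0[[_ _ _ ->] _]; rewrite eqxx in_nil.
- by move=> x y; rewrite in_nil.
- by rewrite !filter_uniq // allpairs_uniq ?iota_uniq // => -[? ?] [? ?].
Qed.

Lemma height_le_max k : h k <= foldr maxn 0 ns.
Proof.
rewrite /height; elim: ns k => [|a s IH] [|k] //=; first by rewrite leq_maxl.
by apply: leq_trans (IH k) _; rewrite leq_maxr.
Qed.

Theorem final_pairing :
  (exists f, inv (foldr maxn 0 ns) (final_diagram ns) f) /\
  forall s A A', 0 < s -> neighbouring ns s A A' ->
    exists g, pairing (final_diagram ns) s A A' g.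
Proof.
have H i : let D := foldl (stage ns) (initial_diagram ns) (iota 1 i) in
   exists f, inv i D f /\
   forall s A A', 0 < s <= i -> neighbouring ns s A A' -> settled D s A A' /\
     exists g, pairing D s A A' g.
  elim: i => [|i [f [I hs]]].
    by exists lnbr; split; [exact: initial_inv|move=> s A A'; lia].
  have -> : iota 1 i.+1 = rcons (iota 1 i) i.+1.
    by have := iotaD 1 i 1; rewrite addn1 cats1 add1n.
  by rewrite foldl_rcons; exact: (stage_inv I hs).
have [f [I hs]] := H (foldr maxn 0 ns); split; first by exists f.
move=> s A A' s0 hn; have [_ e _ _ _] := nb_facts s0 hn.
have [n1 n2 n3 n4 n5] := nb_facts s0 hn.
have hle : 0 < s <= foldr maxn 0 ns by rewrite s0 -n4 height_le_max.
by have [_] := hs s A A' hle hn.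
Qed.
End Invariant.

(** * Disjoint unions of composite lines *)

Section Families.
Variable ns : seq nat.
Local Notation N := (sumn ns).
Local Notation h := (height ns).
Local Notation col := (col ns).
Local Notation row := (row ns).
Local Notation box := (box ns).
Local Notation key := (key ns).

Variables (D : diagram) (s A A' : nat) (g : nat -> nat).
Hypothesis s_gt0 : 0 < s.
Hypothesis nbAA' : neighbouring ns s A A'.
Hypothesis gP : pairing ns D s A A' g.

Definition exits x := [&& x < N, row x <= s & A <= col x < A'].
Definition enters y := [&& y < N, row y <= s & A < col y <= A'].

Let A_lt : A < A'. Proof. by have [] := nb_facts s_gt0 nbAA'. Qed.
Let inA r : 0 < r <= s -> inbox ns A r.
Proof. by have [_ _ e _ _] := nb_facts s_gt0 nbAA'; rewrite /inbox e. Qed.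
Let inA' r : 0 < r <= s -> inbox ns A' r.
Proof. by have [_ _ _ e _] := nb_facts s_gt0 nbAA'; rewrite /inbox e. Qed.

Lemma pairing_exits y : enters y ->
  [/\ exits (g y), col (g y) < col y, (g y, y) \in lines D &
      ((g y, y) \in lines0 D) = (y == box A' s)].
Proof.
case/and3P=> hy hr hc; have [h1 h2 h3 h4] := pair_line gP hy hr hc.
have hreg : reg ns s A A' (g y, y) by rewrite /reg /= h1 h2; lia.
have [x1 x2 x3 x4] := pair_box gP h3 hreg.
by split=> //; rewrite /exits x1 h1 h2; lia.
Qed.

Lemma pairing_inj y y' : enters y -> enters y' -> g y = g y' -> y = y'.
Proof. by case/and3P=> ? ? ? /and3P[? ? ?]; apply: (pair_inj gP). Qed.

Lemma exits_enters x : exits x -> A < col x -> enters x.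
Proof. by case/and3P=> h1 h2 h3 h4; rewrite /enters h1 h2; lia. Qed.

Lemma pairing_key_lt y : enters y -> key (g y) < key y.
Proof. by case/pairing_exits=> _ hc _ _; apply: key_col. Qed.

(** Extends [g] to a permutation of all boxes by letting column [A] wrap around to [A']. That every
    exit is a value of [g] then follows from injectivity alone, and the same permutation later
    yields the surviving term of the determinant. *)
Definition back y := if enters y then g y
  else if (col y == A) && (row y <= s) then box A' (row y) else y.

Lemma back_lt (y : 'I_N) : back y < N.
Proof.
rewrite /back; case: ifP => [/pairing_exits[/and3P[]]//|_].
by case: ifP => // /andP[_ hr]; rewrite box_lt // inA'.
Qed.

Definition back_ord (y : 'I_N) := Ordinal (back_lt y).

Lemma back_ord_inj : injective back_ord.
Proof.
move=> y y' /(congr1 val) /=; rewrite /back.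
have B z : (col z == A) && (row z <= s) -> col (box A' (row z)) = A' /\ row (box A' (row z)) = row z.
  by case/andP=> _ hr; rewrite col_box ?row_box ?inA'.
have E z : z < N -> enters z = false -> (col z == A) && (row z <= s) = false ->
    exits z -> False.
  move=> hz + + hx; case/and3P: (hx) => _ hr hc; rewrite hr andbT.
  by move=> e1 e2; rewrite exits_enters // in e1; lia.
have X z : enters z -> col (g z) < A'.
  by case/pairing_exits=> /and3P[_ _ ?] _ _ _; lia.
have F z : enters z = false -> z < N -> row z <= s -> col z = A' -> False.
  by rewrite /enters => /negP h1 h2 h3 h4; apply: h1; rewrite h2 h3 h4 leqnn andbT.
case: (boolP (enters y)) => ey; case: (boolP (enters y')) => ey'.
- by move=> e; apply/val_inj/pairing_inj.
- case: ifPn => hy' e; first by have [e1 _] := B _ hy'; have := X _ ey; rewrite e e1 ltnn.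
  have [hx _ _ _] := pairing_exits ey; case: (E y') => //; try exact: negbTE.
  by rewrite -e.
- case: ifPn => hy e; first by have [e1 _] := B _ hy; have := X _ ey'; rewrite -e e1 ltnn.
  have [hx _ _ _] := pairing_exits ey'; case: (E y) => //; try exact: negbTE.
  by rewrite e.
case: ifPn => hy; case: ifPn => hy' e.
- have [_ e1] := B _ hy; have [_ e2] := B _ hy'.
  case/andP: hy => /eqP c1 _; case/andP: hy' => /eqP c2 _.
  by apply/val_inj/(@eq_box ns); [rewrite c1 c2|rewrite -e1 e e2].
- have [e1 e2] := B _ hy; case: (F y' (negbTE ey')) => //; rewrite -e //.
  by rewrite e2; case/andP: hy.
- have [e1 e2] := B _ hy'; case: (F y (negbTE ey)) => //; rewrite e //.
  by rewrite e2; case/andP: hy'.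
- exact: val_inj.
Qed.

Definition back_perm : {perm 'I_N} := perm back_ord_inj.

Lemma back_permE y : back_perm y = back y :> nat.
Proof. by rewrite permE. Qed.

Lemma pairing_surj x : exits x -> exists2 y, enters y & g y = x.
Proof.
move=> hx; case/and3P: (hx) => hN hr hc.
pose y := back_perm^-1%g (Ordinal hN).
have e : back y = x by rewrite -back_permE permKV.
move: e; rewrite /back; case: ifPn => [hy e|ny]; first by exists y.
case: ifPn => [/andP[_ hy] e|ny2 e].
  by move: hc; rewrite -e col_box ?inA' //; lia.
case/negP: ny; rewrite e; apply: exits_enters => //.
by move: ny2; rewrite e hr andbT; lia.
Qed.

Definition gchain x q := path (fun a b => g b == a) x q && all enters q.

Lemma gchain_cons x y q : gchain x (y :: q) =
  [&& g y == x, enters y & gchain y q].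
Proof. by rewrite /gchain /= -!andbA; do !bool_congr. Qed.

Lemma gchain_eq x q q' : gchain x q -> gchain x q' ->
  col (last x q) = A' -> col (last x q') = A' -> q = q'.
Proof.
have X y : enters y -> col (g y) < A'.
  by case/pairing_exits=> /and3P[_ _ ?] _ _ _; lia.
elim: q x q' => [|y q IH] x [|y' q'] //; rewrite ?gchain_cons.
- by move=> _ /and3P[/eqP <- /X hx _] e _; move: hx; rewrite -e ltnn.
- by move=> /and3P[/eqP <- /X hx _] _ _ e; move: hx; rewrite -e ltnn.
move=> /and3P[/eqP e1 h1 h2] /and3P[/eqP e2 h3 h4] /= l1 l2.
have e : y = y' by apply: pairing_inj; rewrite // e1.
by rewrite -e in h4 l2 *; congr (_ :: _); apply: (IH y).
Qed.

Lemma gchain_back x q a : gchain x q -> a \in q -> g a \in x :: q.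
Proof.
elim: q x => // y q IH x; rewrite gchain_cons => /and3P[/eqP e hy hq].
rewrite inE => /orP[/eqP->|/(IH _ hq) hm]; first by rewrite e mem_head.
by rewrite in_cons hm orbT.
Qed.

(** Read backwards, a chain is determined by the function [g], so chains that meet have the same
    origin. *)
Lemma gchain_root x q x' q' a : gchain x q -> gchain x' q' ->
  col x = A -> col x' = A -> a \in x :: q -> a \in x' :: q' -> x = x'.
Proof.
move=> hq hq' c c'; have hE z p b : gchain z p -> b \in p -> enters b.
  by case/andP=> _ /allP; apply.
have nE z : col z = A -> enters z = false.
  by move=> e; rewrite /enters e ltnn /= !andbF.
elim: {a}(col a) {-2}a (leqnn (col a)) => [|m IH] a hm ha ha'.
  move: ha ha'; rewrite !inE => /orP[/eqP ea|/(hE _ _ _ hq)]; last first.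
    by case/and3P=> _ _ /andP[h1 _]; lia.
  by rewrite ea => /orP[/eqP//|/(hE _ _ _ hq')]; rewrite nE.
move: (ha) (ha'); rewrite !inE => /orP[/eqP ea|hqa].
  by rewrite ea => /orP[/eqP//|/(hE _ _ _ hq')]; rewrite nE.
case/orP=> [/eqP ea'|hqa'].
  by move/(hE _ _ _ hq): hqa; rewrite ea' nE.
have ey : enters a := hE _ _ _ hq hqa.
have [_ hlt _ _] := pairing_exits ey.
apply: (IH (g a)); first by lia.
  exact: gchain_back hqa.
exact: gchain_back hqa'.
Qed.

Lemma gchain_lines x q : gchain x q -> path (fun a a' => (a, a') \in lines D) x q.
Proof.
elim: q x => //= y q IH x; rewrite gchain_cons => /and3P[/eqP <- hy /IH ->].
by have [_ _ -> _] := pairing_exits hy.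
Qed.

Lemma gchain_ex x : x < N -> row x <= s -> A <= col x <= A' ->
  exists q, [/\ gchain x q, col (last x q) = A', row (last x q) <= s & last x q < N].
Proof.
move=> hN hr hc.
have [m] := ubnP (A' - col x); elim: m x hN hr hc => // m IH x hN hr hc hm.
have [e|ne] := eqVneq (col x) A'; first by exists [::].
have hx : exits x by rewrite /exits hN hr; lia.
have [y hy e] := pairing_surj hx; have [_ hlt _ _] := pairing_exits hy.
case/and3P: (hy) => y1 y2 y3.
have [||||q [q1 q2 q3 q4]] := IH y => //; try by rewrite e in hlt; lia.
by exists (y :: q); rewrite gchain_cons e eqxx hy.
Qed.

(** Follow the inverse of [g] from each box of [A] until [A'] is reached. *)
Lemma pairing_exists : exists c : s.-tuple (seq nat), disjoint_union ns D A A' c.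
Proof.
have /fin_all_exists[q hq] (i : 'I_s) : exists q, let x := box A i.+1 in
    [/\ gchain x q, col (last x q) = A', row (last x q) <= s & last x q < N].
  by apply: gchain_ex; rewrite ?row_box ?col_box ?box_lt ?inA //; have := ltn_ord i; lia.
pose c := [tuple box A i.+1 :: q i | i < s].
have hc i : tnth c i = box A i.+1 :: q i by rewrite tnth_mktuple.
have disj (i j : 'I_s) a : a \in tnth c i -> a \in tnth c j -> i = j.
  rewrite !hc; have [h1 _ _ _] := hq i; have [h2 _ _ _] := hq j => ha ha'.
  have ci : 0 < i.+1 <= s by have := ltn_ord i; lia.
  have cj : 0 < j.+1 <= s by have := ltn_ord j; lia.
  have := gchain_root h1 h2 (col_box (inA ci)) (col_box (inA cj)) ha ha'.
  move/(congr1 (Defs.row ns)); rewrite !row_box ?inA // => -[e].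
  exact: val_inj.
exists c; split=> //.
have hlt (i : 'I_s) : (row (last (box A i.+1) (q i))).-1 < s.
  by have [_ _ + _] := hq i; have := row_gt0 ns (last (box A i.+1) (q i)); lia.
pose sg i := Ordinal (hlt i).
have sgE i : box A' (sg i).+1 = last (box A i.+1) (q i).
  have [_ e _ hN] := hq i; rewrite -[RHS](boxK ns) e; congr Defs.box; apply: prednK.
have sg_inj : injective sg.
  move=> i j e; apply: (disj i j (box A' (sg i).+1)); rewrite hc.
    by rewrite sgE mem_last.
  by rewrite e sgE mem_last.
exists (perm sg_inj) => i; rewrite permE hc; exists (q i) => //.
by split; [apply: gchain_lines; have [] := hq i|rewrite sgE].
Qed.

Section Unique.
Variable c : s.-tuple (seq nat).
Hypothesis hc : disjoint_union ns D A A' c.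

Let q i := behead (tnth c i).

Let cE i : tnth c i = box A i.+1 :: q i.
Proof. by case: hc => -[sg hs] _; have [p e _] := hs i; rewrite /q e. Qed.

Let c_path (i : 'I_s) : path (fun a a' => (a, a') \in lines D) (box A i.+1) (q i).
Proof. by case: hc => -[sg hs] _; have [p e []] := hs i; rewrite /q e. Qed.

Let c_last (i : 'I_s) : exists2 r, 0 < r <= s & last (box A i.+1) (q i) = box A' r.
Proof.
case: hc => -[sg hs] _; have [p e [_ hl]] := hs i; rewrite /q e /=.
by exists (sg i).+1; rewrite // ltn_ord.
Qed.

Let disj (i j : 'I_s) a : a \in tnth c i -> a \in tnth c j -> i = j.
Proof. by case: hc => _; apply. Qed.

Hypothesis D_lt : forall x y, (x, y) \in lines D -> col x < col y.

Let last_le x p : path (fun a a' => (a, a') \in lines D) x p ->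
  col x <= col (last x p).
Proof.
elim: p x => //= y p IH x /andP[/D_lt hl /IH hp]; lia.
Qed.

Let path_enters x p : x < N -> row x <= s -> A <= col x ->
  path (fun a a' => (a, a') \in lines D) x p -> col (last x p) <= A' ->
  path (fun a a' => [&& (a, a') \in lines D, reg ns s A A' (a, a') & enters a']) x p.
Proof.
elim: p x => //= y p IH x hN hr hA /andP[hl hp] hlast.
have hy : col y <= A' by apply: leq_trans (last_le hp) hlast.
have hlt := D_lt hl.
have hreg : reg ns s A A' (x, y) by rewrite /reg /= hr hA.
have [_ y1 _ y2] := pair_box gP hl hreg.
have ey : enters y by rewrite /enters y1 y2 hy; lia.
by rewrite hl hreg ey /=; apply: IH => //; lia.
Qed.

Let edge (i : 'I_s) x y := exists2 k, k.+1 < size (tnth c i) &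
  nth 0 (tnth c i) k = x /\ nth 0 (tnth c i) k.+1 = y.

Let startP (i : 'I_s) : [/\ box A i.+1 < N, row (box A i.+1) <= s,
  col (box A i.+1) = A & row (box A i.+1) = i.+1].
Proof.
have hi : 0 < i.+1 <= s by rewrite ltn_ord.
by rewrite row_box ?col_box ?box_lt ?inA.
Qed.

Let edgeP i x y : edge i x y ->
  [/\ (x, y) \in lines D, reg ns s A A' (x, y), enters y,
      x \in tnth c i & y \in tnth c i].
Proof.
case=> k hk [ex ey].
have [h1 h2 h3 _] := startP i; have [r hr el] := c_last i.
have hlast : col (last (box A i.+1) (q i)) <= A' by rewrite el col_box ?inA'.
have hA : A <= col (box A i.+1) by rewrite h3.
have := path_enters h1 h2 hA (c_path i) hlast.
have hk' : k < size (q i) by move: hk; rewrite cE.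
move/(pathP 0)=> /(_ _ hk'); move: ex ey; rewrite cE => ex ey.
have ex' : nth 0 (box A i.+1 :: q i) k = x by rewrite -ex.
rewrite ex' [nth 0 (q i) k]ey => /and3P[-> -> ->]; split=> //.
  by rewrite -ex' mem_nth //= ltnS ltnW.
by rewrite -ey mem_nth.
Qed.

Let c_uniq i : uniq (tnth c i).
Proof.
have [h1 h2 h3 _] := startP i.
have hs : sorted (fun a b => col a < col b) (tnth c i).
  by rewrite cE /=; apply: sub_path (c_path i) => a b; apply: D_lt.
apply: (sorted_uniq _ _ hs) => [a b d|a]; [exact: ltn_trans|exact: ltnn].
Qed.

Let edge_pred i j x x' y : edge i x y -> edge j x' y -> x = x'.
Proof.
move=> e e'; have [_ _ _ _ m] := edgeP e; have [_ _ _ _ m'] := edgeP e'.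
have ij := disj m m'; rewrite -ij in e'.
case: e => k hk [<- ey]; case: e' => k' hk' [<- ey'].
have : k.+1 = k'.+1.
  by rewrite -(index_uniq 0 hk (c_uniq i)) -(index_uniq 0 hk' (c_uniq i)) ey ey'.
by case=> ->.
Qed.

Let edge_succ i j x y y' : edge i x y -> edge j x y' -> y = y'.
Proof.
move=> e e'; have [_ _ _ m _] := edgeP e; have [_ _ _ m' _] := edgeP e'.
have ij := disj m m'; rewrite -ij in e'.
case: e => k hk [ex <-]; case: e' => k' hk' [ex' <-].
have -> // : k = k'.
by rewrite -(index_uniq 0 (ltnW hk) (c_uniq i)) -(index_uniq 0 (ltnW hk') (c_uniq i)) ex ex'.
Qed.

(* The greedy step: boxes are treated in the order of their keys. *)
Let edge_of x : exits x -> exists i y, edge i x y /\ g y = x.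
Proof.
have [m] := ubnP (key x); elim: m x => // m IH x hm hx.
(* Either [x] lies in [A], where the family starts, or it is entered from [g x], whose key is
   smaller. *)
have [i hi] : exists i, x \in tnth c i.
  have [e|ne] := eqVneq (col x) A.
    case/and3P: hx => hN hr _; have hr1 : (row x).-1 < s.
      by have := row_gt0 ns x; lia.
    exists (Ordinal hr1); rewrite cE (_ : box A _ = x) ?mem_head //.
    by rewrite -[RHS](boxK ns) e; congr Defs.box; apply: prednK.
  have hy : enters x by apply: exits_enters => //; case/and3P: hx => _ _; lia.
  have [hg _ _ _] := pairing_exits hy; have hlt := pairing_key_lt hy.
  have [|i [y [e ey]]] := IH (g x) _ hg; first by lia.
  have [_ _ y1 _ y2] := edgeP e.
  by exists i; rewrite -(pairing_inj y1 hy ey).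
pose k := index x (tnth c i).
have hk : k < size (tnth c i) by rewrite index_mem.
have hk1 : k.+1 < size (tnth c i).
  rewrite ltn_neqAle hk andbT; apply/eqP => e.
  have hx2 : x = last (box A i.+1) (q i).
    have -> : last (box A i.+1) (q i) = last 0 (tnth c i) by rewrite cE.
    by rewrite -nth_last -e /= nth_index.
  have [r hr el] := c_last i; case/and3P: hx => _ _.
  by rewrite hx2 el col_box ?inA' // ltnn andbF.
pose y2 := nth 0 (tnth c i) k.+1.
have e2 : edge i x y2 by exists k => //; split=> //; apply: nth_index.
have [l2 r2 n2 _ _] := edgeP e2; have [g1 g2 _ _] := pairing_exits n2.
have [e|ne] := eqVneq (g y2) x; first by exists i, y2.
(* If the family leaves [x] for a box [y2] with [g y2] different from [x], then [g y2] has a smaller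
   key, so by induction the family also joins it to [y2], which would be entered twice. *)
have hle := pair_min gP l2 r2.
have hlt : key (g y2) < key x.
  rewrite ltn_neqAle hle andbT; apply/eqP => /key_inj e.
  by case/eqP: ne; apply: e; [case/and3P: g1|case/and3P: hx].
have [|j [y [e3 ey]]] := IH (g y2) _ g1; first by lia.
have [_ _ n3 _ _] := edgeP e3; have e4 := pairing_inj n3 n2 ey.
by rewrite e4 in e3; case/eqP: ne; apply: edge_pred e3 e2.
Qed.

Lemma edge_back i x y : edge i x y -> g y = x.
Proof.
move=> e; have [l r n _ _] := edgeP e.
have hx : exits x.
  have [x1 _ x2 _] := pair_box gP l r; case/and3P: r => /= r1 r2 r3.
  by rewrite /exits x1 r1 r2; lia.
by have [j [y' [e' <-]]] := edge_of hx; rewrite (edge_succ e e').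
Qed.

Lemma family_gchain (i : 'I_s) : gchain (box A i.+1) (q i).
Proof.
have hk k : k < size (q i) -> edge i (nth 0 (box A i.+1 :: q i) k) (nth 0 (q i) k).
  by move=> hk; exists k; rewrite cE.
apply/andP; split.
  by apply/(pathP 0) => k /hk/edge_back/eqP.
by apply/(all_nthP 0) => k /hk/edgeP[].
Qed.

Lemma family_last (i : 'I_s) : col (last (box A i.+1) (q i)) = A'.
Proof. by have [r hr ->] := c_last i; rewrite col_box ?inA'. Qed.

Lemma mem_lines_of i x y : (x, y) \in lines_of (tnth c i) <-> edge i x y.
Proof.
rewrite /edge; move: (tnth c i) => p.
have hz : size (zip p (behead p)) = (size p).-1.
  by rewrite size_zip size_behead; apply/minn_idPr/leq_pred.
have nz k : k < (size p).-1 ->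
    nth (0, 0) (zip p (behead p)) k = (nth 0 p k, nth 0 p k.+1).
  by move=> hk; rewrite nth_zip_cond hz hk nth_behead.
rewrite /lines_of; split.
  case/(nthP (0, 0))=> k; rewrite hz => hk; rewrite nz // => -[<- <-].
  by exists k; lia.
case=> k hk [<- <-]; have hk' : k < (size p).-1 by lia.
by apply/(nthP (0, 0)); exists k; rewrite ?hz // nz.
Qed.

Let L := flatten [seq lines_of p | p <- c].

Let memL x y : (x, y) \in L <-> enters y /\ x = g y.
Proof.
split.
  case/flattenP=> e /mapP[p /tnthP[i ->] ->] /mem_lines_of h.
  by have [_ _ n _ _] := edgeP h; split=> //; rewrite (edge_back h).
case=> hy ->; have [hg _ _ _] := pairing_exits hy.
have [i [y' [e ey]]] := edge_of hg; have [_ _ n _ _] := edgeP e.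
rewrite (pairing_inj n hy ey) in e.
apply/flattenP; exists (lines_of (tnth c i)); last exact/mem_lines_of.
by apply: map_f; apply: mem_tnth.
Qed.

Lemma family_labels :
  exists2 l0, l0 \in L /\ l0 \in lines0 D &
    forall l, l \in L -> l != l0 -> l \in lines1 D /\ l \notin lines0 D.
Proof.
have hs : 0 < s <= s by rewrite s_gt0 /=.
pose y0 := box A' s.
have hy0 : enters y0.
  by rewrite /enters box_lt ?row_box ?col_box ?inA' // leqnn A_lt leqnn.
have [_ _ l0 e0] := pairing_exits hy0.
exists (g y0, y0); first by split; [apply/memL|rewrite e0].
move=> [x y] /memL[hy ->] ne; have [_ _ l e] := pairing_exits hy.
have ney : (y == y0) = false by apply: contraNF ne => /eqP->.
by move: l; rewrite mem_cat e ney orbF.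
Qed.
End Unique.
End Families.

Lemma ns_height_gt0 ns : all (fun k => 0 < k) ns ->
  forall k, k < size ns -> 0 < height ns k.
Proof. by move=> /(all_nthP 0). Qed.

Theorem final_P1 ns : all (fun k => 0 < k) ns -> P1 ns (final_diagram ns).
Proof.
move=> hpos s C C' s0 hn.
have [[f I] hg] := final_pairing (ns_height_gt0 hpos).
have [g gP] := hg s C C' s0 hn.
have D_lt x y : (x, y) \in lines (final_diagram ns) -> col ns x < col ns y.
  by case/(inv_box I).
have [c hc] := pairing_exists s0 hn gP; exists c; split=> // c' hc'.
apply: eq_from_tnth => i.
have [p e [_ _]] : composite_line (final_diagram ns) (box ns C i.+1)
    (last (box ns C i.+1) (behead (tnth c i))) (tnth c i).
  case: (hc) => -[sg hs] _; have [p e [h1 h2]] := hs i.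
  by exists p => //; rewrite e.
have [p' e' [_ _]] : composite_line (final_diagram ns) (box ns C i.+1)
    (last (box ns C i.+1) (behead (tnth c' i))) (tnth c' i).
  case: (hc') => -[sg hs] _; have [p' e' [h1 h2]] := hs i.
  by exists p' => //; rewrite e'.
have := gchain_eq s0 hn gP (family_gchain s0 hn gP hc D_lt i)
  (family_gchain s0 hn gP hc' D_lt i) (family_last s0 hn hc i)
  (family_last s0 hn hc' i).
by rewrite e e' /= => ->.
Qed.

Theorem final_P2 ns : all (fun k => 0 < k) ns -> P2 ns (final_diagram ns).
Proof.
move=> hpos s C C' c s0 hn hc.
have [[f I] hg] := final_pairing (ns_height_gt0 hpos).
have [g gP] := hg s C C' s0 hn.
have D_lt x y : (x, y) \in lines (final_diagram ns) -> col ns x < col ns y.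
  by case/(inv_box I).
exact: (family_labels s0 hn gP hc D_lt).
Qed.

Local Open Scope ring_scope.

(** * Polynomial functions *)

Section PolynomialFunctions.
Variables (K : fieldType) (M : vectType K).
Local Notation pf := (@polynomial_function K M).

Lemma pf_const (c : K) : pf (fun=> c).
Proof.
have l : 'I_0 -> {linear M -> K^o} by case.
by exists 0, l, (mpoly.mpolyC 0 c) => x; rewrite mpoly.mevalC.
Qed.

Lemma pf_linear (l : {linear M -> K^o}) : pf l.
Proof.
by exists 1, (fun=> l), (mpoly.mpolyX _ (mpoly.mnm1 ord0)) => x; rewrite mpoly.mevalXU.
Qed.

Lemma pf_combine (f g : M -> K) : pf f -> pf g -> exists n (l : 'I_n -> {linear M -> K^o})
  (p q : mpoly.mpoly n K), (forall x, f x = mpoly.meval (fun i => l i x) p) /\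
  (forall x, g x = mpoly.meval (fun i => l i x) q).
Proof.
case=> m [l [p hp]] [n [l' [q hq]]].
pose L (i : 'I_(m + n)) := match fintype.split i with inl j => l j | inr j => l' j end.
pose lp := [tuple (mpoly.mpolyX K (mpoly.mnm1 (lshift n i))) | i < m].
pose lq := [tuple (mpoly.mpolyX K (mpoly.mnm1 (rshift m i))) | i < n].
exists (m + n)%N, L, (mpoly.comp_mpoly lp p), (mpoly.comp_mpoly lq q).
split=> x; rewrite mpoly.comp_mpoly_meval ?hp ?hq; apply: mpoly.meval_eq => i.
  by rewrite tnth_mktuple mpoly.mevalXU /L (unsplitK (inl i)).
by rewrite tnth_mktuple mpoly.mevalXU /L (unsplitK (inr i)).
Qed.

Lemma pf_add (f g : M -> K) : pf f -> pf g -> pf (fun x => f x + g x).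
Proof.
move=> hf hg; have [n [l [p [q [hp hq]]]]] := pf_combine hf hg.
by exists n, l, (p + q) => x; rewrite hp hq mpoly.mevalD.
Qed.

Lemma pf_mul (f g : M -> K) : pf f -> pf g -> pf (fun x => f x * g x).
Proof.
move=> hf hg; have [n [l [p [q [hp hq]]]]] := pf_combine hf hg.
by exists n, l, (p * q) => x; rewrite hp hq mpoly.mevalM.
Qed.

Lemma pf_ext (f g : M -> K) : f =1 g -> pf f -> pf g.
Proof. by move=> /funext->. Qed.

Lemma pf_sum (I : Type) (r : seq I) (P : pred I) (F : I -> M -> K) :
  (forall i, pf (F i)) -> pf (fun x => \sum_(i <- r | P i) F i x).
Proof.
move=> hF; elim: r => [|i r IH].
  by apply: pf_ext (pf_const 0) => x; rewrite big_nil.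
have [Pi|nPi] := boolP (P i).
  by apply: pf_ext (pf_add (hF i) IH) => x; rewrite big_cons Pi.
by apply: pf_ext IH => x; rewrite big_cons (negPf nPi).
Qed.

Lemma pf_prod (I : Type) (r : seq I) (P : pred I) (F : I -> M -> K) :
  (forall i, pf (F i)) -> pf (fun x => \prod_(i <- r | P i) F i x).
Proof.
move=> hF; elim: r => [|i r IH].
  by apply: pf_ext (pf_const 1) => x; rewrite big_nil.
have [Pi|nPi] := boolP (P i).
  by apply: pf_ext (pf_mul (hF i) IH) => x; rewrite big_cons Pi.
by apply: pf_ext IH => x; rewrite big_cons (negPf nPi).
Qed.

Lemma pf_exp (f : M -> K) n : pf f -> pf (fun x => f x ^+ n).
Proof.
move=> hf; apply: (@pf_ext (fun x => \prod_(i < n) f x)); last exact: pf_prod.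
by move=> x; rewrite prodr_const card_ord.
Qed.

Lemma pf_opp (f : M -> K) : pf f -> pf (fun x => - f x).
Proof.
by move=> hf; apply: pf_ext (pf_mul (pf_const (-1)) hf) => x; rewrite mulN1r.
Qed.

(** Constants and linear forms generate the polynomial functions, so that later arguments can avoid
    polynomials in several variables. *)
Lemma pf_ind (Q : (M -> K) -> Prop) :
  (forall c, Q (fun=> c)) -> (forall l : {linear M -> K^o}, Q l) ->
  (forall f g, Q f -> Q g -> Q (fun x => f x + g x)) ->
  (forall f g, Q f -> Q g -> Q (fun x => f x * g x)) ->
  forall f, pf f -> Q f.
Proof.
move=> Qc Ql Qa Qm f [n [l [p hp]]].
have Qx (f1 f2 : M -> K) : f1 =1 f2 -> Q f2 -> Q f1 by move=> /funext->.
have Qe (g : M -> K) k : Q g -> Q (fun x => g x ^+ k).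
  move=> Qg; elim: k => [|k IH]; first exact: Qc.
  by apply: (Qx _ _ (fun x => exprS (g x) k)); apply: Qm.
apply: (Qx _ (fun x => \sum_(m <- mpoly.msupp p)
   mpoly.mcoeff m p * \prod_(i <- enum 'I_n) (l i x) ^+ (m i))).
  by move=> x; rewrite hp mpoly.mevalE; apply: eq_bigr => m _; rewrite big_enum.
elim: (mpoly.msupp p) => [|m r IH].
  by apply: (Qx _ (fun=> 0)) => [x|]; [rewrite big_nil|exact: Qc].
apply: (Qx _ _ (fun x => big_cons _ _ _ _ _ _)) => /=; apply: (Qa) IH.
apply: (Qm); first exact: Qc.
elim: (enum _) => [|i s IHs].
  by apply: (Qx _ (fun=> 1)) => [x|]; [rewrite big_nil|exact: Qc].
apply: (Qx _ _ (fun x => big_cons _ _ _ _ _ _)) => /=; apply: (Qm) IHs.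
exact: Qe.
Qed.

Lemma pf_line (f : M -> K) x y : pf f ->
  exists q : {poly K}, forall t, q.[t] = f (x + t *: y).
Proof.
move: f; apply: pf_ind => [c|l|f g [p hp] [q hq]|f g [p hp] [q hq]].
- by exists c%:P => t; rewrite hornerC.
- by exists ((l x)%:P + 'X * (l y)%:P) => t; rewrite !hornerE linearD linearZ.
- by exists (p + q) => t; rewrite hornerD hp hq.
- by exists (p * q) => t; rewrite hornerM hp hq.
Qed.

(* The derivative of [f] along the vector field [phi]. *)
Lemma pf_derive (f : M -> K) (phi : {linear M -> M}) : pf f ->
  exists2 f1, pf f1 & forall x, exists r : {poly K}, forall s,
    f (x + s *: phi x) = f x + s * f1 x + s ^+ 2 * r.[s].
Proof.
(* The induction principle does not hand back that the factors are polynomial, which the product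
   rule needs; hence the stronger claim. *)
move=> hf; suff: pf f /\ exists2 f1, pf f1 & forall x, exists r : {poly K},
    forall s, f (x + s *: phi x) = f x + s * f1 x + s ^+ 2 * r.[s] by case.
move: f hf; apply: pf_ind => [c|l|f g|f g].
- split; first exact: pf_const.
  exists (fun=> 0); first exact: pf_const.
  by move=> x; exists 0 => s; rewrite horner0 !mulr0 !addr0.
- split; first exact: pf_linear.
  exists (fun x => l (phi x)); first exact: (pf_linear (l \o phi)).
  by move=> x; exists 0 => s; rewrite horner0 mulr0 addr0 linearD linearZ.
- move=> [hf [f1 hf1 ef]] [hg [g1 hg1 eg]]; split; first exact: pf_add.
  exists (fun x => f1 x + g1 x); first exact: pf_add.
  move=> x; have [r hr] := ef x; have [r' hr'] := eg x; exists (r + r') => s.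
  by rewrite hr hr' hornerD !mulrDr addrACA [f x + _ + _]addrACA.
move=> [hf [f1 hf1 ef]] [hg [g1 hg1 eg]]; split; first exact: pf_mul.
exists (fun x => f x * g1 x + f1 x * g x); first by apply: pf_add; apply: pf_mul.
move=> x; have [r hr] := ef x; have [r' hr'] := eg x.
exists ((f x)%:P * r' + (g x)%:P * r + (f1 x * g1 x)%:P
   + 'X * ((f1 x)%:P * r' + (g1 x)%:P * r) + 'X ^+ 2 * r * r') => s.
by rewrite hr hr' !hornerE; ring.
Qed.

End PolynomialFunctions.

Lemma pf_comp (K : fieldType) (M M' : vectType K) (f : M' -> K) (phi : M -> M') :
  (forall l : {linear M' -> K^o}, polynomial_function (fun x => l (phi x) : K)) ->
  polynomial_function f -> polynomial_function (fun x => f (phi x)).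
Proof.
move=> hphi; move: f; apply: pf_ind => [c|l|f g hf hg|f g hf hg].
- exact: pf_const.
- exact: hphi.
- exact: pf_add.
- exact: pf_mul.
Qed.

Lemma pf_comp_linear (K : fieldType) (M M' : vectType K) (f : M' -> K)
  (phi : {linear M -> M'}) :
  polynomial_function f -> polynomial_function (fun x => f (phi x)).
Proof. by apply: pf_comp => l; apply: (pf_linear (l \o phi)). Qed.

Section Infinite.
Variable K : numFieldType.

Lemma poly_fun0 (q : {poly K}) : (forall t, q.[t] = 0) -> q = 0.
Proof.
move=> hq; apply/eqP; apply: contraT => nq.
have := max_poly_roots nq (rs := [seq i%:R | i <- iota 0 (size q)]).
rewrite size_map size_iota ltnn => H; apply: H.
  by apply/allP => x _; apply/rootP.
rewrite map_inj_uniq ?iota_uniq // => i j /eqP; rewrite eqr_nat => /eqP; exact.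
Qed.

Lemma poly_fun_eq (p q : {poly K}) : (forall t, p.[t] = q.[t]) -> p = q.
Proof.
by move=> h; apply/subr0_eq/poly_fun0 => t; rewrite hornerD hornerN h subrr.
Qed.

Lemma poly_fun0_dense (h q : {poly K}) : h != 0 ->
  (forall t, h.[t] != 0 -> q.[t] = 0) -> q = 0.
Proof.
move=> nh H; have /eqP : h * q = 0.
  apply: poly_fun0 => t; rewrite hornerM; have [->|/H->] := eqVneq h.[t] 0.
    by rewrite mul0r.
  by rewrite mulr0.
by rewrite mulf_eq0 (negPf nh) => /eqP.
Qed.

Variable M : vectType K.

(** Restriction to the line through [x0] and [x] reduces this to polynomials in one variable. *)
Lemma pf_mul_eq0 (f g : M -> K) x0 : polynomial_function f ->
  polynomial_function g -> (forall x, f x * g x = 0) -> g x0 != 0 ->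
  forall x, f x = 0.
Proof.
move=> hf hg hfg g0 x.
have [p hp] := pf_line x0 (x - x0) hf; have [q hq] := pf_line x0 (x - x0) hg.
have p0 : p = 0.
  apply: (@poly_fun0_dense q).
    by apply: contraNneq g0 => q0; rewrite -[x0]addr0 -(scale0r (x - x0)) -hq q0 horner0.
  move=> t; rewrite hq hp => nz; have /eqP := hfg (x0 + t *: (x - x0)).
  by rewrite mulf_eq0 (negPf nz) orbF => /eqP.
by have := hp 1; rewrite p0 horner0 scale1r addrC subrK => <-.
Qed.
End Infinite.

(** * The group *)

Section Entry.
Variables (K : fieldType) (m n : nat) (i : 'I_m) (j : 'I_n).
Definition entry (A : 'M[K]_(m, n)) : K^o := A i j.
Fact entry_linear : linear entry.
Proof. by move=> a A B; rewrite /entry !mxE. Qed.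
HB.instance Definition _ :=
  GRing.isLinear.Build K 'M[K]_(m, n) K^o _ entry entry_linear.
End Entry.

Lemma pf_entry (K : fieldType) (m n : nat) (i : 'I_m) (j : 'I_n) :
  polynomial_function (fun A : 'M[K]_(m, n) => A i j).
Proof. exact: (pf_linear (entry i j)). Qed.

Section Group.
Variables (K : numFieldType) (ns : seq nat).
Local Notation n := (sumn ns).
Local Notation col := (Defs.col ns).
Local Notation pf := (@polynomial_function K 'M[K]_n).

Definition blk (g : 'M[K]_n) := forall i j : 'I_n, (col j < col i)%N -> g i j = 0.
Definition blk_part k (g : 'M[K]_n) : 'M[K]_n :=
  \matrix_(i, j) if (col i == k) && (col j == k) then g i j else 0.
(** Padding a diagonal block by the identity makes the block determinants [chi] determinants of full
    size. *)
Definition blk_proj k (g : 'M[K]_n) : 'M[K]_n :=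
  \matrix_(i, j) if (col i == k) && (col j == k) then g i j else (i == j)%:R.
Definition chi k (g : 'M[K]_n) := \det (blk_proj k g).

Local Notation derived := (derived_algebra (parabolic K ns)).

Lemma blkM g g' : blk g -> blk g' -> blk (g *m g').
Proof.
move=> hg hg' i j hij; rewrite mxE big1 // => l _.
have [h|h] := ltnP (col l) (col i); first by rewrite hg // mul0r.
by rewrite hg' ?mulr0 //; apply: leq_trans h.
Qed.

Lemma blkD g g' : blk g -> blk g' -> blk (g + g').
Proof. by move=> hg hg' i j hij; rewrite mxE hg // hg' // addr0. Qed.

Lemma blkN g : blk g -> blk (- g).
Proof. by move=> hg i j hij; rewrite mxE hg // oppr0. Qed.

Lemma blk1 : blk 1%:M.
Proof. by move=> i j hij; rewrite mxE; case: eqP hij => // ->; rewrite ltnn. Qed.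

Lemma blk_proj1 k : blk_proj k 1%:M = 1%:M.
Proof. by apply/matrixP => i j; rewrite !mxE; case: ifP. Qed.

Lemma blk_projM k g g' : blk g -> blk g' ->
  blk_proj k (g *m g') = blk_proj k g *m blk_proj k g'.
Proof.
move=> hg hg'; apply/matrixP => i j; rewrite !mxE.
have [/eqP ei|ni] := boolP (col i == k); rewrite /=; last first.
  rewrite (bigD1 i) //= !mxE (negPf ni) /= eqxx mul1r big1 ?addr0 // => l nl.
  by rewrite !mxE (negPf ni) /= eq_sym (negPf nl) mul0r.
have [/eqP ej|nj] := boolP (col j == k); last first.
  rewrite (bigD1 j) //= !mxE (negPf nj) !andbF eqxx mulr1 big1 ?addr0 // => l nl.
  by rewrite !mxE (negPf nj) !andbF (negPf nl) mulr0.
apply: eq_bigr => l _; rewrite !mxE ei ej eqxx /= !andbT.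
have [//|nl] := eqVneq (col l) k.
case: (ltngtP (col l) k) nl => // hl _.
  by rewrite hg ?ei // mul0r; case: eqP hl => [<-|_]; rewrite ?ei ?ltnn ?mul0r.
by rewrite hg' ?ej // mulr0; case: (l =P j) hl => [->|_]; rewrite ?ej ?ltnn ?mulr0.
Qed.

Lemma chiM k g g' : blk g -> blk g' -> chi k (g *m g') = chi k g * chi k g'.
Proof. by move=> hg hg'; rewrite /chi blk_projM // det_mulmx. Qed.

Lemma chi1 k : chi k 1%:M = 1.
Proof. by rewrite /chi blk_proj1 det1. Qed.

Lemma pf_det m (F : 'I_m -> 'I_m -> 'M[K]_n -> K) : (forall i j, pf (F i j)) ->
  pf (fun g => \det (\matrix_(i, j) F i j g)).
Proof.
move=> hF; apply: (@pf_ext _ _ (fun g => \sum_(s : 'S_m) (-1) ^+ s * \prod_i F i (s i) g)).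
  move=> g; rewrite /determinant; apply: eq_bigr => s _.
  by congr (_ * _); apply: eq_bigr => i _; rewrite mxE.
by apply: pf_sum => s; apply: pf_mul; [apply: pf_const|apply: pf_prod].
Qed.

Lemma pf_chi k : pf (chi k).
Proof.
apply: (@pf_det n (fun i j g => if (col i == k) && (col j == k) then g i j
  else (i == j)%:R)) => i j.
by case: (_ && _); [exact: pf_entry|exact: pf_const].
Qed.

(* The row vectors supported on [e] form a [g]-stable subspace. *)
Lemma invmx_stable (e : pred 'I_n) (g : 'M[K]_n) :
  (forall a b, e a -> ~~ e b -> g a b = 0) -> g \in unitmx ->
  forall a b, e a -> ~~ e b -> invmx g a b = 0.
Proof.
move=> hg gu i j ei ej.
pose E : 'M[K]_n := diag_mx (\row_a (e a)%:R).
have Eg : E *m g = E *m g *m E.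
  apply/matrixP => a b; rewrite mul_mx_diag mul_diag_mx !mxE.
  case ea: (e a); rewrite ?mul0r ?mul1r //.
  by case eb: (e b); rewrite ?mulr1 // mulr0 hg // eb.
have sub : (E *m g <= E)%MS by rewrite Eg submxMl.
have sub' : (E <= E *m g)%MS.
  rewrite -(geq_leqif (mxrank_leqif_sup sub)) mxrankMfree // row_free_unit //.
have : (E *m invmx g <= E)%MS.
  by have := submxMr (invmx g) sub'; rewrite mulmxK.
case/submxP=> D eD; have /matrixP/(_ i j) := eD.
by rewrite mul_diag_mx mul_mx_diag !mxE ei (negPf ej) mul1r mulr0.
Qed.

Lemma blk_inv (g : 'M[K]_n) : blk g -> g \in unitmx -> blk (invmx g).
Proof.
move=> hg gu i j hij.
apply: (@invmx_stable (fun a => col i <= col a)%N) => //; last by rewrite -ltnNge.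
by move=> a b ha hb; apply: hg; rewrite -ltnNge in hb; apply: leq_trans ha.
Qed.

Lemma chiV k g : blk g -> g \in unitmx -> chi k g * chi k (invmx g) = 1.
Proof. by move=> hg gu; rewrite -chiM ?mulmxV ?chi1 //; apply: blk_inv. Qed.

Lemma derived_blk X : derived X -> blk X.
Proof.
case=> k [a [b [hab ->]]] i j hij; rewrite summxE big1 // => l _.
have [[_ ha] [_ hb]] := hab l.
have -> : (a l *m b l - b l *m a l) i j = (a l *m b l) i j - (b l *m a l) i j.
  by rewrite !mxE.
by rewrite (blkM ha hb hij) (blkM hb ha hij) subrr.
Qed.

Lemma derived_tr X k : derived X -> \sum_(i < n | col i == k) X i i = 0.
Proof.
case=> m [a [b [hab ->]]].
have tr_comm (A B : 'M[K]_n) : blk A -> blk B ->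
    \sum_(i < n | col i == k) (A *m B) i i =
    \sum_(i < n | col i == k) \sum_(j < n | col j == k) A i j * B j i.
  move=> hA hB; apply: eq_bigr => i /eqP hi; rewrite mxE [RHS]big_mkcond /=.
  apply: eq_bigr => j _; case: (ltngtP (col j) k) => // hj.
    by rewrite hA ?hi // mul0r.
  by rewrite hB ?hi // mulr0.
under eq_bigr do rewrite summxE.
rewrite exchange_big /= big1 // => l _.
have [[_ ha] [_ hb]] := hab l.
have -> : \sum_(i < n | col i == k) (a l *m b l - b l *m a l) i i =
    \sum_(i < n | col i == k) (a l *m b l) i i - \sum_(i < n | col i == k) (b l *m a l) i i.
  by rewrite -sumrB; apply: eq_bigr => i _; rewrite [LHS]mxE [X in _ + X]mxE.
rewrite (tr_comm _ _ ha hb) (tr_comm _ _ hb ha) [X in _ - X]exchange_big /=.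
by apply/eqP; rewrite subr_eq0; apply/eqP; apply: eq_bigr => i _;
  apply: eq_bigr => j _; rewrite mulrC.
Qed.

Lemma mxtrace_delta_mx (a b : 'I_n) : \tr (delta_mx a b : 'M[K]_n) = (a == b)%:R.
Proof.
rewrite /mxtrace (bigD1 a) //= mxE eqxx /= big1 ?addr0 // => l nl.
by rewrite mxE (negPf nl).
Qed.

(** For [a] different from [b], [[x_{a,a} - x_{b,b}, x_{a,b}] = 2 x_{a,b}], whence the factor 1/2.
    The difference of diagonal units appears because elements of the parabolic have trace 0. *)
Lemma derived_zero_diag X : blk X -> (forall i, X i i = 0) -> derived X.
Proof.
move=> hX h0; pose I := ('I_n * 'I_n)%type; exists #|{: I}|.
pose A (l : I) : 'M[K]_n := delta_mx l.1 l.1 - delta_mx l.2 l.2.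
pose B (l : I) : 'M[K]_n := (X l.1 l.2 / 2%:R) *: delta_mx l.1 l.2.
exists (fun i => A (enum_val i)), (fun i => B (enum_val i)); split.
  move=> i; move: (enum_val i) => [a b]; split; split.
  - by rewrite linearB /= !mxtrace_delta_mx !eqxx subrr.
  - move=> p q hpq; rewrite !mxE.
    have ne z : (p == z) && (q == z) = false.
      by apply/negbTE/negP => /andP[/eqP e1 /eqP e2]; rewrite e1 e2 ltnn in hpq.
    by rewrite !ne subrr.
  - rewrite linearZ /= mxtrace_delta_mx; case: eqP => [->|_]; last by rewrite mulr0.
    by rewrite h0 !mul0r.
  - move=> p q hpq; rewrite !mxE /=; case: (p =P a) hpq => [->|_]; rewrite ?mulr0 //.
    case: (q =P b) => [->|_]; rewrite ?mulr0 // => hab.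
    by rewrite hX // !mul0r.
transitivity (\sum_(l : I) (A l *m B l - B l *m A l)); last first.
  by rewrite (reindex (@enum_val I predT)) //; apply: onW_bij; apply: enum_val_bij.
rewrite {1}(matrix_sum_delta X) pair_big /=; apply: eq_bigr => -[a b] _.
rewrite /A /B /= -!scalemxAr -!scalemxAl -scalerBr mulmxBl mulmxBr.
have [->|ne] := eqVneq a b; first by rewrite h0 mul0r !scale0r.
rewrite !mul_delta_mx_cond !eqxx [b == a]eq_sym (negPf ne).
rewrite !mulr1n !mulr0n subr0 sub0r opprK.
by rewrite -mulr2n -scaler_nat scalerA divfK // pnatr_eq0.
Qed.
End Group.

(** * Triangularity, unipotent elements and elimination in the group *)

Section Subgroup.
Variables (K : numFieldType) (ns : seq nat).
Local Notation n := (sumn ns).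
Local Notation col := (Defs.col ns).
Local Notation blk := (@blk K ns).
Local Notation chi := (@chi K ns).
Local Notation derived := (derived_algebra (parabolic K ns)).
Variable G : set 'M[K]_n.
Hypothesis G_grp : connected_algebraic_subgroup_SL G.
Hypothesis G_lie : lie_algebra G = derived.

Lemma G_unit g : G g -> g \in unitmx.
Proof. by move=> hg; rewrite unitmxE (cas_SL G_grp hg) unitr1. Qed.

(** As [X] has square 0, [1 + t X] is the exponential of [t X]. The derivative of [f] along the
    vector field with value [g X] at [g] again vanishes on [G], so by induction all Taylor
    coefficients of [f (1 + t X)] vanish. *)
Lemma lie_vanish X f : derived X -> X *m X = 0 -> polynomial_function f ->
  (forall g, G g -> f g = 0) -> forall t, f (1%:M + t *: X) = 0.
Proof.
move=> hX X2 hf fG.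
suff H m : forall f, polynomial_function f -> (forall g, G g -> f g = 0) ->
    forall q : {poly K}, (forall t, q.[t] = f (1%:M + t *: X)) ->
    forall j, (j < m)%N -> q`_j = 0.
  have [q hq] := pf_line 1%:M X hf; move=> t; rewrite -hq.
  have -> : q = 0.
    by apply/polyP => j; rewrite coef0 (H j.+1 f hf fG q hq).
  by rewrite horner0.
elim: m => // m IH {}f {}hf {}fG q hq [|j] hj.
  rewrite -horner_coef0 hq scale0r addr0; apply: fG; exact: cas_1 G_grp.
have [f1 hf1 hr] := pf_derive (mulmxr X) hf.
(* Left translation by [g] preserves [G], so the tangent vector [X] at 1 can be used at [g]. *)
have f1G g : G g -> f1 g = 0.
  move=> hg; have [r er] := hr g.
  pose p : {poly K} := (f g)%:P + 'X * (f1 g)%:P + 'X ^+ 2 * r.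
  have lX : lie_algebra G X by rewrite G_lie.
  have hfg : polynomial_function (fun x => f (g *m x)).
    exact: (pf_comp_linear (mulmx g)).
  have <- : p^`().[0] = f1 g by rewrite /p !derivE !hornerE /=; ring.
  apply: (lX _ hfg) => [x hx|t]; first by apply: fG; apply: (cas_M G_grp).
  by rewrite mulmxDr mulmx1 -scalemxAr er !hornerE; ring.
have hq1 t : q^`().[t] = f1 (1%:M + t *: X).
  have [r er] := hr (1%:M + t *: X).
  (* Here [(1 + t X) + s (1 + t X) X = 1 + (t + s) X], again because [X] has square 0. *)
  have e : q \Po ('X + t%:P) = (f (1%:M + t *: X))%:P + 'X * (f1 (1%:M + t *: X))%:P + 'X ^+ 2 * r.
    apply: poly_fun_eq => s; rewrite horner_comp !hornerE hq.
    transitivity (f (1%:M + t *: X + s *: mulmxr X (1%:M + t *: X))); last first.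
      by rewrite er; ring.
    congr f; rewrite /mulmxr /= mulmxDl mul1mx -scalemxAl X2 scaler0 addr0.
    by rewrite scalerDl addrCA addrC -addrA.
  have := congr1 (fun p => p^`().[0]) e.
  rewrite deriv_comp !derivE !hornerE !horner_comp !hornerE /= => ->; ring.
have := IH f1 hf1 f1G _ hq1 j hj; rewrite coef_deriv => /eqP.
by rewrite mulrn_eq0 /= => /eqP.
Qed.

Lemma G_unipotent X t : derived X -> X *m X = 0 -> G (1%:M + t *: X).
Proof.
move=> hX X2; have [F hF eG] := cas_closed G_grp.
rewrite eG => f Ff; apply: lie_vanish => //; first exact: hF.
by move=> g; rewrite {1}eG; apply.
Qed.

Lemma derived_conj g X : G g -> derived X -> derived (g *m X *m invmx g).
Proof.
move=> hg; rewrite -G_lie => hX f hf fG q hq.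
have gu := G_unit hg.
have hf' : polynomial_function (fun x => f (g *m x *m invmx g)).
  exact: (pf_comp_linear (mulmxr (invmx g) \o mulmx g)).
apply: (hX _ hf') => [x hx|t].
  apply: fG; apply: (cas_M G_grp); last exact: (cas_V G_grp).
  exact: (cas_M G_grp).
by rewrite hq mulmxDr mulmxDl mulmx1 mulmxV // -scalemxAr -scalemxAl.
Qed.

(** [G] normalises its Lie algebra. If [g i a] is nonzero where it should vanish, conjugating the
    units [x_{a,b}], for [b] in the column of [i] or later, detects the entries [(b, j)] of
    [invmx g] with [j] in a column before that of [i]. So these vanish, and then so does [g i a]. *)
Lemma G_blk g : G g -> blk g.
Proof.
move=> hg i a hai; have gu := G_unit hg.
have hV := cas_V G_grp hg.
have [//|nz] := eqVneq (g i a) 0.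
pose e (b : 'I_n) := (col i <= col b)%N.
have he b j : e b -> ~~ e j -> invmx g b j = 0.
  rewrite /e -ltnNge => hb hj.
  have hab : (col a < col b)%N by apply: leq_trans hb.
  have hX : derived (delta_mx a b).
    apply: derived_zero_diag => [p q hpq|p]; rewrite mxE.
      case: eqP hpq => [->|_] //; case: eqP => [->|_] // hlt.
      by move: (ltn_trans hlt hab); rewrite ltnn.
    by case: eqP => [->|_] //; case: eqP => [e0|_] //; rewrite e0 ltnn in hab.
  have := derived_blk (derived_conj hg hX) hj.
  rewrite mxE (bigD1 b) //= big1 ?addr0 => [|c nc]; last first.
    rewrite mxE big1 ?mul0r // => d _; rewrite mxE.
    by rewrite (negPf nc) andbF mulr0.
  rewrite mxE (bigD1 a) //= big1 ?addr0 => [|c nc]; last first.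
    by rewrite mxE (negPf nc) mulr0.
  by rewrite mxE !eqxx mulr1 => /eqP; rewrite mulf_eq0 (negPf nz) => /eqP.
have := invmx_stable he _; rewrite invmxK; apply.
- exact: G_unit.
- exact: leqnn.
- by rewrite /e -ltnNge.
Qed.

(* [G] will turn out to consist of these elements only. *)
Definition H g := [/\ G g, blk g & forall k, chi k g = 1].

Lemma H_unit g : H g -> g \in unitmx.
Proof. by case=> /G_unit. Qed.

Lemma H1 : H 1%:M.
Proof. by split; [exact: cas_1 G_grp|exact: blk1|exact: chi1]. Qed.

Lemma HM g g' : H g -> H g' -> H (g *m g').
Proof.
move=> [h1 h2 h3] [h1' h2' h3']; split; first exact: (cas_M G_grp).
  exact: blkM.
by move=> k; rewrite chiM // h3 h3' mulr1.
Qed.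

(** The [k]-th diagonal block of [X] also has square 0, so 1 plus this block lies in [G] and has
    determinant 1; this determinant is [chi k (1 + X)]. *)
Lemma H_unipotent X : blk X -> (forall i, X i i = 0) -> X *m X = 0 ->
  H (1%:M + X).
Proof.
move=> hX h0 X2.
have HG Y : blk Y -> (forall i, Y i i = 0) -> Y *m Y = 0 -> G (1%:M + Y).
  move=> hY hY0 Y2; rewrite -[Y]scale1r; apply: G_unipotent => //.
  exact: derived_zero_diag.
split; [exact: HG|by apply: blkD => //; apply: blk1|].
move=> k; pose Y := @blk_part K ns k X.
have -> : chi k (1%:M + X) = \det (1%:M + Y).
  congr (\det _); apply/matrixP => i j; rewrite !mxE.
  by case: ifP => _; rewrite ?addr0.
apply: (cas_SL G_grp); apply: HG.
- by move=> i j hij; rewrite mxE hX // if_same.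
- by move=> i; rewrite mxE h0 if_same.
apply/matrixP => i j; have /matrixP/(_ i j) := X2; rewrite !mxE => e.
have [ei|ni] := eqVneq (col i) k; last first.
  by rewrite big1 // => l _; rewrite mxE (negPf ni) mul0r.
have [ej|nj] := eqVneq (col j) k; last first.
  by rewrite big1 // => l _; rewrite [X in _ * X]mxE (negPf nj) andbF mulr0.
rewrite -[RHS]e; apply: eq_bigr => l _; rewrite !mxE ei ej eqxx andbT /=.
case: (ltngtP (col l) k) => // hl.
  by rewrite (hX i l) ?ei // !mul0r.
by rewrite (hX l j) ?ej // !mulr0.
Qed.

Lemma H_rows (y : 'I_n -> K) k : y k = 0 ->
  (forall i, y i != 0 -> (col i <= col k)%N) ->
  exists2 u, H u & forall (g : 'M[K]_n) i j, (u *m g) i j = g i j + y i * g k j.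
Proof.
move=> yk hy; pose X : 'M[K]_n := \matrix_(i, j) (y i *+ (j == k)).
have XE (g : 'M[K]_n) i j : (X *m g) i j = y i * g k j.
  rewrite mxE (bigD1 k) //= mxE eqxx mulr1n big1 ?addr0 // => l nl.
  by rewrite mxE (negPf nl) mulr0n mul0r.
exists (1%:M + X); last by move=> g i j; rewrite mulmxDl mul1mx mxE XE.
apply: H_unipotent.
- move=> i j hij; rewrite mxE; case: eqP hij => [->|]; rewrite ?mulr0n // => hij.
  have [->|/hy] := eqVneq (y i) 0; first by rewrite mul0rn.
  by rewrite leqNgt hij.
- by move=> i; rewrite mxE; case: eqP => [->|]; rewrite ?yk ?mulr0n ?mul0rn.
- by apply/matrixP => i j; rewrite XE !mxE yk mul0rn mulr0.
Qed.

Lemma H_cols (w : 'I_n -> K) k : w k = 0 ->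
  (forall j, w j != 0 -> (col k <= col j)%N) ->
  exists2 v, H v & forall (g : 'M[K]_n) i j, (g *m v) i j = g i j + g i k * w j.
Proof.
move=> wk hw; pose X : 'M[K]_n := \matrix_(i, j) (w j *+ (i == k)).
have XE (g : 'M[K]_n) i j : (g *m X) i j = g i k * w j.
  rewrite mxE (bigD1 k) //= mxE eqxx mulr1n big1 ?addr0 // => l nl.
  by rewrite mxE (negPf nl) mulr0n mulr0.
exists (1%:M + X); last by move=> g i j; rewrite mulmxDr mulmx1 mxE XE.
apply: H_unipotent.
- move=> i j hij; rewrite mxE; case: eqP hij => [->|]; rewrite ?mulr0n // => hij.
  have [->|/hw] := eqVneq (w j) 0; first by rewrite mul0rn.
  by rewrite leqNgt hij.
- by move=> i; rewrite mxE; case: eqP => [->|]; rewrite ?wk ?mulr0n ?mul0rn.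
- by apply/matrixP => i j; rewrite XE !mxE wk mul0rn mul0r.
Qed.

Definition lastbox (i : 'I_n) := Defs.row ns i == height ns (col i).

Definition dcos (g g' : 'M[K]_n) := exists u v, [/\ H u, H v & g' = u *m g *m v].

Lemma dcos_trans g1 g2 g3 : dcos g1 g2 -> dcos g2 g3 -> dcos g1 g3.
Proof.
move=> [u [v [hu hv ->]]] [u' [v' [hu' hv' ->]]].
by exists (u' *m u), (v *m v'); split; [exact: HM|exact: HM|rewrite !mulmxA].
Qed.

Lemma dcos_left u g : H u -> dcos g (u *m g).
Proof. by move=> hu; exists u, 1%:M; split=> //; [exact: H1|rewrite mulmx1]. Qed.

Lemma dcos_right v g : H v -> dcos g (g *m v).
Proof. by move=> hv; exists 1%:M, v; split=> //; [exact: H1|rewrite mul1mx]. Qed.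

Lemma dcos_refl g : dcos g g.
Proof. by rewrite -{2}[g]mulmx1; apply: dcos_right; apply: H1. Qed.

Lemma dcos_blk g g' : dcos g g' -> blk g -> blk g'.
Proof. by move=> [u [v [[_ bu _] [_ bv _] ->]]] hg; apply/blkM => //; apply: blkM. Qed.

Lemma dcos_unit g g' : dcos g g' -> g \in unitmx -> g' \in unitmx.
Proof.
by move=> [u [v [/H_unit hu /H_unit hv ->]]] hg; rewrite !unitmx_mul hu hg.
Qed.

Lemma dcos_chi g g' k : dcos g g' -> blk g -> chi k g' = chi k g.
Proof.
move=> [u [v [[_ bu cu] [_ bv cv] ->]]] hg.
by rewrite !chiM ?cu ?cv ?mulr1 ?mul1r //; apply: blkM.
Qed.

(** The intermediate state of an elimination. The last box of each column is exempt from having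
    pivot 1, since it collects the determinant of the block. *)
Definition cleared (m : nat) (g : 'M[K]_n) :=
  (forall i j : 'I_n, (i < m)%N || (j < m)%N -> i != j -> g i j = 0) /\
  (forall i : 'I_n, (i < m)%N -> ~~ lastbox i -> g i i = 1).

Lemma col_mono (i j : 'I_n) : (i <= j)%N -> (col i <= col j)%N.
Proof.
move=> hij; have := reshape_leq ns i j; rewrite hij => /esym/orP[/ltnW//|].
by case/andP=> /eqP e _; rewrite /Defs.col e.
Qed.

Lemma row_lt (i j : 'I_n) : (i < j)%N -> col i = col j ->
  (Defs.row ns i < Defs.row ns j)%N.
Proof.
move=> hij e; have := reshape_leq ns j i; rewrite leqNgt hij /= => /esym.
by rewrite -!/(Defs.col ns _) e ltnn eqxx /= => /negbT; rewrite -ltnNge.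
Qed.

Lemma cleared_rowop (k p : 'I_n) (y : 'I_n -> K) (g g' : 'M[K]_n) : cleared k g ->
  (k <= p)%N -> (forall i, y i != 0 -> (k <= i)%N) ->
  (forall i j, g' i j = g i j + y i * g p j) -> cleared k g'.
Proof.
move=> [c1 c2] hp hy eg.
have y0 (i : 'I_n) : (i < k)%N -> y i = 0.
  by move=> hi; apply/eqP; apply: contraTT hi => /hy; rewrite -leqNgt.
split=> [i j /orP[hi|hj] ne|i hi nl].
- by rewrite eg y0 // mul0r addr0 c1 // hi.
- rewrite eg c1 ?hj ?orbT // (c1 p j) ?hj ?orbT ?mulr0 ?addr0 //.
  by apply: contraTneq hj => <-; rewrite -leqNgt.
- by rewrite eg y0 // mul0r addr0 c2.
Qed.

(** Gaussian elimination using only operations with block determinants 1. Rows cannot be scaled, so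
    a pivot is made 1 with the help of the next row of the block, which exists unless the box is the
    last of its column. *)
Lemma clear_step (k : 'I_n) g : blk g -> g \in unitmx -> cleared k g ->
  exists2 g', dcos g g' & cleared k.+1 g'.
Proof.
move=> gb gu cg.
(* Off the diagonal, column [k] can be nonzero only further down in its own block: earlier rows are
   cleared, and later blocks are excluded by triangularity. *)
have F g1 : blk g1 -> cleared k g1 ->
    forall i, i != k -> g1 i k != 0 -> (k < i)%N /\ col i = col k.
  move=> b1 [c1 _] i ne nz; have hki : (k < i)%N.
    rewrite ltn_neqAle eq_sym val_eqE ne /= leqNgt.
    by apply: contra nz => hik; rewrite c1 ?hik.
  split=> //; apply/eqP; rewrite eqn_leq (col_mono (ltnW hki)) andbT leqNgt.
  by apply: contra nz => /b1 ->.
have nzcol (g1 : 'M[K]_n) : g1 \in unitmx -> exists i, g1 i k != 0.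
  move=> u1; apply/existsP; apply: contraTT u1; rewrite negb_exists => /forallP z.
  suff d0 : \det g1 = 0 by rewrite unitmxE d0 unitr0.
  rewrite -det_tr (expand_det_row _ k) big1 // => i _.
  by rewrite mxE; have := z i; rewrite negbK => /eqP->; rewrite mul0r.
suff [g1 d1 [cg1 p1 p2]] : exists2 g1, dcos g g1 &
    [/\ cleared k g1, g1 k k != 0 & ~~ lastbox k -> g1 k k = 1].
  have b1 := dcos_blk d1 gb; have p3 := F g1 b1 cg1.
  pose y i := if i == k then 0 else - g1 i k / g1 k k.
  have yP i : y i != 0 -> (k < i)%N /\ col i = col k.
    rewrite /y; case: (eqVneq i k) => [_|ne]; first by rewrite eqxx.
    move=> nz; apply: p3 => //; apply: contraNneq nz => ->.
    by rewrite oppr0 mul0r.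
  have [||u hu eu] := @H_rows y k; first by rewrite /y eqxx.
    by move=> i /yP[_ ->].
  have cg2 : cleared k (u *m g1).
    by apply: (cleared_rowop cg1 (leqnn k) _ (eu g1)) => i /yP[/ltnW].
  have b2 : blk (u *m g1) by apply: dcos_blk b1; apply: dcos_left.
  move: (eu g1) cg2 b2 (dcos_trans d1 (dcos_left g1 hu)); move: (u *m g1) => g2 e2 cg2 b2 d2.
  have k2 j : g2 k j = g1 k j by rewrite e2 /y eqxx mul0r addr0.
  have z2 i : i != k -> g2 i k = 0.
    by move=> ne; rewrite e2 /y (negPf ne) divfK // addrN.
  pose w j := if j == k then 0 else - g2 k j / g2 k k.
  have [||v hv ev] := @H_cols w k; first by rewrite /w eqxx.
    move=> j; rewrite /w; case: (eqVneq j k) => [_|ne nz]; first by rewrite eqxx.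
    rewrite leqNgt; apply: contra nz => /b2 ->; by rewrite oppr0 mul0r.
  exists (g2 *m v); first exact: (dcos_trans d2 (dcos_right g2 hv)).
  have g3n i j : i != k -> (g2 *m v) i j = g2 i j.
    by move=> ne; rewrite ev z2 // mul0r addr0.
  have g3k j : j != k -> (g2 *m v) k j = 0.
    by move=> ne; rewrite ev /w (negPf ne) mulrC divfK ?addrN // k2.
  have g3kk : (g2 *m v) k k = g1 k k.
    by rewrite ev /w eqxx mulr0 addr0 k2.
  split=> [i j hij ne|i hi nl].
    have [ei|ni] := eqVneq i k; first by rewrite ei g3k // -ei eq_sym.
    rewrite g3n //; have [ej|nj] := eqVneq j k; first by rewrite ej z2.
    have [c1 _] := cg2; apply: c1 => //; move: hij; rewrite !ltnS (leq_eqVlt i) (leq_eqVlt j).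
    have ni' : (i == k :> nat) = false by apply: negbTE.
    have nj' : (j == k :> nat) = false by apply: negbTE.
    by rewrite ni' nj'.
  have [ei|ni] := eqVneq i k; first by rewrite ei g3kk p2 // -ei.
  rewrite g3n //; have [_ c2] := cg2; apply: c2 => //.
  have ni' : (i == k :> nat) = false by apply: negbTE.
  by move: hi; rewrite ltnS leq_eqVlt ni'.
have [lk|nlk] := boolP (lastbox k).
  exists g; first exact: dcos_refl.
  split=> //; have [i nz] := nzcol g gu; have [e|ne] := eqVneq i k.
    by rewrite -{1}e.
  have [hki ec] := F g gb cg i ne nz; have := row_lt hki (esym ec).
  by move/eqP: lk => ->; rewrite -ec ltnNge row_le.
have hrow : (Defs.row ns k < height ns (col k))%N.
  by rewrite ltn_neqAle row_le // andbT.
have hin : inbox ns (col k) (Defs.row ns k).+1 by [].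
have [k1 [ck1 rk1]] : exists k1 : 'I_n, col k1 = col k /\
    Defs.row ns k1 = (Defs.row ns k).+1.
  by exists (Ordinal (box_lt hin)); rewrite /= col_box ?row_box.
have hk1 : (k < k1)%N.
  have := reshape_leq ns k1 k; rewrite /= -!/(Defs.col ns _) ck1 ltnn eqxx /= => e.
  by rewrite ltnNge e -ltnNge; move: rk1; rewrite /Defs.row => -[->].
have nk1 : k1 != k by rewrite -val_eqE neq_ltn hk1 orbT.
(* Once the entry below the pivot is nonzero, adding [c] times its row turns the pivot into 1. *)
have [g1 d1 [cg1 nz1]] : exists2 g1, dcos g g1 & cleared k g1 /\ g1 k1 k != 0.
  have [e|nz] := eqVneq (g k1 k) 0; last by exists g => //; apply: dcos_refl.
  have [i nz] := nzcol g gu.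
  have ni : i != k1 by apply: contraNneq nz => ->; rewrite e.
  have [hki ec] : (k <= i)%N /\ col i = col k.
    have [->//|ne] := eqVneq i k; by have [/ltnW] := F g gb cg i ne nz.
  have [||u hu eu] := @H_rows (fun j => (j == k1)%:R) i; first by rewrite (negPf ni).
    by move=> j /=; case: (j =P k1) => [->|]; rewrite ?eqxx // ck1 ec.
  exists (u *m g); first exact: dcos_left.
  split; last by rewrite eu /= eqxx mul1r e add0r.
  apply: (cleared_rowop cg hki _ (eu g)) => j /=; case: (j =P k1) => [->|]; rewrite ?eqxx //.
  by move=> _; apply: ltnW.
pose c := (1 - g1 k k) / g1 k1 k.
have [||u hu eu] := @H_rows (fun j => if j == k then c else 0) k1.
- by rewrite (negPf nk1).
- by move=> j /=; case: (j =P k) => [->|]; rewrite ?eqxx // ck1.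
exists (u *m g1); first exact: (dcos_trans d1 (dcos_left g1 hu)).
have e1 : (u *m g1) k k = 1 by rewrite eu eqxx /c divfK // addrC subrK.
split; rewrite ?e1 ?oner_neq0 //.
apply: (cleared_rowop cg1 (ltnW hk1) _ (eu g1)) => j /=; case: (j =P k) => [->|] //.
by rewrite eqxx.
Qed.

Lemma clear_all g : blk g -> g \in unitmx -> exists2 g', dcos g g' & cleared n g'.
Proof.
move=> gb gu; suff H' m : (m <= n)%N -> exists2 g', dcos g g' & cleared m g'.
  exact: H'.
elim: m => [|m IH] hm; first by exists g; [exact: dcos_refl|split].
have [g1 d1 c1] := IH (ltnW hm).
have [g2 d2 c2] := @clear_step (Ordinal hm) g1 (dcos_blk d1 gb) (dcos_unit d1 gu) c1.
by exists g2 => //; apply: dcos_trans d2.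
Qed.

(** On these matrices [chi k] is the [k]-th coordinate, so they form a section of the block
    determinants. *)
Definition dg (d : nat -> K) : 'M[K]_n :=
  diag_mx (\row_i if lastbox i then d (col i) else 1).

Lemma chi_diag (v : 'rV[K]_n) k : chi k (diag_mx v) = \prod_(i < n | col i == k) v 0 i.
Proof.
have -> : chi k (diag_mx v) = \det (diag_mx (\row_i if col i == k then v 0 i else 1)).
  congr (\det _); apply/matrixP => i j; rewrite !mxE.
  case: (eqVneq i j) => [<-|_]; last by rewrite !mulr0n if_same.
  by rewrite andbb !mulr1n; case: ifP.
rewrite det_diag [RHS]big_mkcond; apply: eq_bigr => i _.
by rewrite mxE.
Qed.

Lemma lastbox_uniq (i j : 'I_n) : lastbox i -> lastbox j -> col i = col j -> i = j.
Proof.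
move=> /eqP hi /eqP hj e; apply: val_inj; apply: (@eq_box ns) => //.
by rewrite hi hj e.
Qed.

Hypothesis ns_pos : forall k, (k < size ns)%N -> (0 < height ns k)%N.

Lemma bottom k : (k < size ns)%N -> exists2 i : 'I_n, lastbox i & col i = k.
Proof.
move=> /ns_pos hk; have hin : inbox ns k (height ns k) by rewrite /inbox hk leqnn.
exists (Ordinal (box_lt hin)); rewrite ?/lastbox /= ?row_box ?col_box //.
Qed.

Lemma prod_lastbox (v : 'I_n -> K) i : (forall j, ~~ lastbox j -> v j = 1) ->
  lastbox i -> \prod_(j < n | col j == col i) v j = v i.
Proof.
move=> h1 li; rewrite (bigD1 i) //= big1 ?mulr1 // => j /andP[/eqP e ne].
by apply: h1; apply: contra ne => lj; rewrite (lastbox_uniq lj li e).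
Qed.

Lemma chi_dg d k : (k < size ns)%N -> chi k (dg d) = d k.
Proof.
move=> /bottom[i li <-]; rewrite chi_diag.
rewrite (@prod_lastbox (fun j => _ 0 j)) //; first by rewrite mxE li.
by move=> j nj; rewrite mxE (negPf nj).
Qed.

Lemma dg_blk d : blk (dg d).
Proof. by move=> i j hij; rewrite !mxE; case: eqP hij => [->|_]; rewrite ?ltnn. Qed.

(** Block determinants are constant on double cosets of [H], so they determine the diagonal matrix
    that the elimination leaves. *)
Lemma clear_diag g : blk g -> g \in unitmx -> dcos g (dg (fun k => chi k g)).
Proof.
move=> gb gu; have [g' d1 [c1 c2]] := clear_all gb gu.
suff <- : g' = dg (fun k => chi k g) by [].
have eg : g' = diag_mx (\row_i g' i i).
  apply/matrixP => i j; rewrite !mxE; case: (eqVneq i j) => [<-|ne].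
    by rewrite mulr1n.
  by rewrite mulr0n c1 // ltn_ord.
rewrite {1}eg; congr diag_mx; apply/rowP => i; rewrite !mxE.
case: ifPn => [li|nl]; last by rewrite c2.
rewrite -(dcos_chi _ d1 gb) [in RHS]eg chi_diag.
rewrite (eq_bigr (fun j => g' j j)) => [|j _]; last by rewrite mxE.
by rewrite (@prod_lastbox (fun j => g' j j)) // => j nj; apply: c2.
Qed.

Lemma chi1_G g : blk g -> g \in unitmx -> (forall k, (k < size ns)%N -> chi k g = 1) -> G g.
Proof.
move=> gb gu hc; have [u [v [hu hv e]]] := clear_diag gb gu.
have e1 : dg (fun k => chi k g) = 1%:M.
  rewrite -diag_const_mx; congr diag_mx; apply/rowP => i; rewrite !mxE.
  by case: ifP => // _; rewrite hc // col_lt.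
have -> : g = invmx u *m invmx v.
  have uu := H_unit hu; have uv := H_unit hv.
  by rewrite -[invmx u]mulmx1 -e1 e -[u *m g *m v]mulmxA mulKmx // -mulmxA mulmxV // mulmx1.
by apply: (cas_M G_grp); apply: (cas_V G_grp); [case: hu|case: hv].
Qed.

Local Notation r := (size ns).
Definition dcoord (k : nat) : 'M[K]_n :=
  diag_mx (\row_i (lastbox i && (col i == k))%:R).

Lemma dgE d : dg d = dg (fun=> 0) + \sum_(k < r) d k *: dcoord k.
Proof.
apply/matrixP => i j; rewrite [RHS]mxE summxE !mxE.
case: (eqVneq i j) => [<-|ne]; last first.
  by rewrite !mulr0n big1 ?addr0 // => k _; rewrite !mxE (negPf ne) mulr0n mulr0.
rewrite !mulr1n; case li : (lastbox i); last first.
  by rewrite big1 ?addr0 // => k _; rewrite !mxE li mul0rn mulr0.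
have hk : (col i < r)%N by apply: col_lt.
rewrite add0r (bigD1 (Ordinal hk)) //= !mxE li !eqxx /= !mulr1n mulr1.
rewrite big1 ?addr0 // => k /negPf; rewrite -val_eqE /= eq_sym => nk.
by rewrite !mxE nk andbF mul0rn mulr0.
Qed.
End Subgroup.

Section Dedekind.
Variables (K : fieldType) (r : nat).
Local Notation mon := {ffun 'I_r -> nat}.
Definition chr (m : mon) (d : nat -> K) := \prod_(k < r) d k ^+ m k.

Lemma chrM m d d' : chr m (fun k => d k * d' k) = chr m d * chr m d'.
Proof. by rewrite -big_split; apply: eq_bigr => k _; rewrite exprMn. Qed.

Lemma chr1 m : chr m (fun=> 1) = 1.
Proof. by rewrite /chr big1 // => k _; rewrite expr1n. Qed.

Variable T : (nat -> K) -> Prop.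
Hypothesis T1 : T (fun=> 1).
Hypothesis TM : forall d d', T d -> T d' -> T (fun k => d k * d' k).

(* Independence of characters: a vanishing combination of characters already
   vanishes when its terms are grouped by character. *)
Lemma dedekind (s : seq (K * mon)) (w : mon -> K) :
  (forall d, T d -> \sum_(c <- s) c.1 * chr c.2 d = 0) ->
  (forall m m', (forall d, T d -> chr m d = chr m' d) -> w m = w m') ->
  \sum_(c <- s) c.1 * w c.2 = 0.
Proof.
have [N] := ubnP (size s); elim: N s w => // N IH [|c0 s'] w hN hs hw.
  by rewrite big_nil.
set s := c0 :: s' in hs hN *.
have [hall|/existsNP[d0 /existsNP[cs]]] :=
    pselect (forall d0 c, T d0 /\ c \in s -> chr c.2 d0 = chr c0.2 d0).
  have h1 : \sum_(c <- s) c.1 = 0.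
    by rewrite -[RHS](hs _ T1); apply: eq_bigr => c _; rewrite chr1 mulr1.
  have -> : \sum_(c <- s) c.1 * w c.2 = \sum_(c <- s) c.1 * w c0.2.
    rewrite big_seq [RHS]big_seq; apply: eq_bigr => c hc; congr (_ * _).
    by apply: hw => d hd; apply: hall.
  by rewrite -mulr_suml h1 mul0r.
move=> /not_implyP[[Td0 hcs] ne].
pose P (c : K * mon) := chr c.2 d0 == chr c0.2 d0.
have sz1 : (size [seq c <- s | P c] < N)%N.
  rewrite size_filter; apply: leq_trans (_ : size s <= N)%N => //.
  rewrite -[X in (_ < X)%N](count_predC P) -[X in (X < _)%N]addn0 ltn_add2l.
  by rewrite -has_count; apply/hasP; exists cs => //; apply/eqP.
have sz2 : (size [seq c <- s | ~~ P c] < N)%N.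
  rewrite size_filter; apply: leq_trans (_ : size s <= N)%N => //.
  rewrite -[X in (_ < X)%N](count_predC P) -[X in (X < _)%N]add0n ltn_add2r.
  by rewrite -has_count; apply/hasP; exists c0; rewrite ?mem_head // /P.
(* Translating the relation by [d0] and subtracting [chr c0.2 d0] times the original one kills the
   terms selected by [P] and multiplies the others by nonzero factors, which the new weight divides
   out. *)
have part2 (w' : mon -> K) :
    (forall m m', (forall d, T d -> chr m d = chr m' d) -> w' m = w' m') ->
    \sum_(c <- [seq c <- s | ~~ P c]) c.1 * w' c.2 = 0.
  move=> hw'; pose f (c : K * mon) := (c.1 * (chr c.2 d0 - chr c0.2 d0), c.2).
  have := IH (map f [seq c <- s | ~~ P c]) (fun m => w' m / (chr m d0 - chr c0.2 d0)).
  rewrite size_map big_map => /(_ sz2) H; rewrite -[RHS]H.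
  - rewrite !big_filter; apply: eq_bigr => c; rewrite /P -subr_eq0 => nz /=.
    by rewrite -mulrA [X in _ = _ * X]mulrC divfK.
  - move=> d hd; rewrite big_map big_filter.
    have h1 := hs _ (TM Td0 hd); have h2 := hs _ hd.
    have : \sum_(c <- s) c.1 * (chr c.2 d0 - chr c0.2 d0) * chr c.2 d = 0.
      under eq_bigr do rewrite mulrBr mulrBl -mulrA -chrM mulrAC.
      by rewrite sumrB h1 -mulr_suml h2 mul0r subr0.
    rewrite (bigID P) /= big1 ?add0r // => c /eqP ->.
    by rewrite subrr mulr0 mul0r.
  - by move=> m m' e; rewrite (hw' _ _ e) (e _ Td0).
have split_sum (F : K * mon -> K) : \sum_(c <- s) F c =
    \sum_(c <- [seq c <- s | P c]) F c + \sum_(c <- [seq c <- s | ~~ P c]) F c.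
  by rewrite !big_filter [LHS](bigID P).
have part1 : \sum_(c <- [seq c <- s | P c]) c.1 * w c.2 = 0.
  apply: IH => // d hd; have := hs _ hd; rewrite split_sum.
  by rewrite [X in _ + X](part2 (fun m => chr m d)) ?addr0 // => m m'; apply.
by rewrite split_sum part1 part2 // addr0.
Qed.
End Dedekind.

(** * The block determinants are trivial on the group *)

Section Torus.
Variables (K : numFieldType) (ns : seq nat).
Local Notation n := (sumn ns).
Local Notation r := (size ns).
Local Notation col := (Defs.col ns).
Local Notation blk := (@blk K ns).
Local Notation chi := (@chi K ns).
Local Notation dg := (@dg K ns).
Local Notation dcoord := (@dcoord K ns).
Local Notation mon := {ffun 'I_r -> nat}.
Local Notation derived := (derived_algebra (parabolic K ns)).
Variable G : set 'M[K]_n.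
Hypothesis G_grp : connected_algebraic_subgroup_SL G.
Hypothesis G_lie : lie_algebra G = derived.
Hypothesis ns_pos : forall k, (k < r)%N -> (0 < height ns k)%N.

Definition torus (d : nat -> K) := G (dg d).

Lemma dg1 : dg (fun=> 1) = 1%:M.
Proof.
rewrite -diag_const_mx; congr diag_mx; apply/rowP => i; rewrite !mxE.
by case: ifP.
Qed.

Lemma dgM d d' : dg (fun k => d k * d' k) = dg d *m dg d'.
Proof.
rewrite mulmx_diag; congr diag_mx; apply/rowP => i; rewrite !mxE.
by case: ifP; rewrite ?mulr1.
Qed.

Lemma torus1 : torus (fun=> 1).
Proof. by rewrite /torus dg1; apply: cas_1 G_grp. Qed.

Lemma torusM d d' : torus d -> torus d' -> torus (fun k => d k * d' k).
Proof. by rewrite /torus dgM; apply: (cas_M G_grp). Qed.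

Lemma torus_neq0 d k : torus d -> (k < r)%N -> d k != 0.
Proof.
move=> hd hk; have := G_unit G_grp hd; rewrite unitmxE unitfE det_diag.
move/prodf_neq0 => h; have [i li e] := bottom ns_pos hk.
by have := h i isT; rewrite mxE li e.
Qed.

Lemma torus_expansion f : polynomial_function f ->
  exists s : seq (K * mon), forall d, f (dg d) = \sum_(c <- s) c.1 * chr c.2 d.
Proof.
have chr0 d : chr ([ffun=> 0%N] : mon) d = 1 :> K.
  by rewrite /chr big1 // => k _; rewrite ffunE expr0.
move: f; apply: pf_ind => [c|l|f g [s hs] [t ht]|f g [s hs] [t ht]].
- by exists [:: (c, [ffun=> 0%N])] => d; rewrite big_seq1 /= chr0 mulr1.
- exists ((l (dg (fun=> 0)), [ffun=> 0%N]) ::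
    [seq (l (dcoord k), [ffun j : 'I_r => (j == k) : nat]) | k : 'I_r <- enum 'I_r]) => d.
  rewrite big_cons big_map /= chr0 mulr1 dgE linearD linear_sum big_enum /=.
  congr (_ + _); apply: eq_bigr => k _; rewrite linearZ /= mulrC; congr (_ * _).
  rewrite /chr (bigD1 k) //= ffunE eqxx expr1 big1 ?mulr1 // => j nj.
  by rewrite ffunE (negPf nj) expr0.
- by exists (s ++ t) => d; rewrite big_cat hs ht.
exists [seq (c.1 * c'.1, [ffun k : 'I_r => (c.2 k + c'.2 k)%N]) | c : K * mon <- s, c' : K * mon <- t] => d.
rewrite hs ht big_allpairs_dep mulr_suml; apply: eq_bigr => c _.
rewrite mulr_sumr; apply: eq_bigr => c' _ /=; rewrite mulrACA; congr (_ * _).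
by rewrite /chr -big_split; apply: eq_bigr => k _; rewrite ffunE exprD.
Qed.

(* A direction orthogonal to all relations satisfied by the torus would be
   tangent to [G], but the blocks of [p'] have trace 0. *)
Lemma torus_orth (v : 'I_r -> K) :
  (forall m m' : mon, (forall d, torus d -> chr m d = chr m' d) ->
     \sum_k (m k)%:R * v k = \sum_k (m' k)%:R * v k) -> forall k, v k = 0.
Proof.
move=> hv k; pose V : 'M[K]_n := \sum_(k < r) v k *: dcoord k.
pose vv j := if insub j is Some i then v i else 0.
have vvE (j : 'I_r) : vv j = v j by rewrite /vv valK.
have eV t : 1%:M + t *: V = dg (fun j => 1 + t * vv j).
  rewrite dgE -dg1 [in LHS]dgE -addrA; congr (_ + _).
  rewrite scaler_sumr -big_split; apply: eq_bigr => j _.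
  by rewrite /= vvE scalerA scalerDl.
have lV : lie_algebra G V.
  move=> f hf fG q hq; have [s hs] := torus_expansion hf.
  pose P (m : mon) : {poly K} := \prod_(j < r) (1 + v j *: 'X) ^+ m j.
  have eq : q = \sum_(c <- s) c.1 *: P c.2.
    apply: poly_fun_eq => t; rewrite hq eV hs horner_sum; apply: eq_bigr => c _.
    rewrite hornerZ; congr (_ * _); rewrite horner_prod; apply: eq_bigr => j _.
    by rewrite vvE !hornerE mulrC.
  have D (p p' : {poly K}) : p.[0] = 1 -> p'.[0] = 1 ->
      (p * p').[0] = 1 /\ (p * p')^`().[0] = p^`().[0] + p'^`().[0].
    by move=> e e'; rewrite derivM !hornerE e e' !mulr1 mul1r.
  have DX (p : {poly K}) m : p.[0] = 1 -> (p ^+ m).[0] = 1 /\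
      (p ^+ m)^`().[0] = m%:R * p^`().[0].
    move=> e; elim: m => [|m [IH1 IH2]]; first by rewrite expr0 -polyC1 derivC !hornerE.
    have [h1 h2] := D p _ e IH1; rewrite exprS; split=> //.
    by rewrite h2 IH2 -natr1; ring.
  (* [P m] is the monomial [m] along the line [1 + t v]. Its derivative at 0 is the weight to which
     [dedekind] is applied; by [hv] it only depends on the character of the torus given by [m]. *)
  have DP m : (P m)^`().[0] = \sum_j (m j)%:R * v j.
    suff [_ ->] : (P m).[0] = 1 /\ (P m)^`().[0] = \sum_j (m j)%:R * v j by [].
    apply: (big_ind2 (fun (p : {poly K}) x => p.[0] = 1 /\ p^`().[0] = x)).
    - by rewrite -polyC1 derivC !hornerE.
    - move=> p x p' y [h1 h2] [h3 h4]; have [h5 h6] := D p p' h1 h3.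
      by rewrite h5 h6 h2 h4.
    - move=> j _; have e : (1 + v j *: 'X : {poly K}).[0] = 1.
        by rewrite !hornerE ?mulr0 ?addr0.
      have [h1 h2] := DX _ (m j) e; rewrite h1 h2; split=> //.
      by rewrite !derivE !hornerE /= ?add0r ?mulr1.
  rewrite eq raddf_sum horner_sum /=.
  under eq_bigr do rewrite derivZ hornerZ DP.
  apply: (dedekind torus1 torusM _ hv) => d hd.
  by rewrite -hs fG.
have := derived_tr k (_ : derived V); rewrite -G_lie => /(_ lV).
have [i li ei] := bottom ns_pos (ltn_ord k).
have VE (j : 'I_n) : V j j = if lastbox j then vv (col j) else 0.
  rewrite /V summxE; case lj : (lastbox j); last first.
    by rewrite big1 // => l _; rewrite !mxE lj mul0rn mulr0.
  have hj : (col j < r)%N by apply: col_lt.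
  rewrite (bigD1 (Ordinal hj)) //= !mxE lj !eqxx /= !mulr1n mulr1.
  rewrite big1 ?addr0 => [|l]; first by rewrite -[col j]/(val (Ordinal hj)) vvE.
  by move=> /negPf; rewrite -val_eqE /= eq_sym => nl; rewrite !mxE nl andbF mul0rn mulr0.
rewrite (bigD1 i) ?ei //= big1 ?addr0 => [|j /andP[/eqP ej nj]].
  by rewrite VE li ei vvE.
rewrite VE; case: ifP => // lj; case/eqP: nj; apply: (@lastbox_uniq ns) => //.
by rewrite ej ei.
Qed.

Definition relation (a : 'rV[int]_r) :=
  forall d, torus d -> \prod_(k < r) (d k) ^ (a 0 k) = 1.

Lemma relationB (m m' : mon) : (forall d, torus d -> chr m d = chr m' d) ->
  relation (\row_k ((m k)%:Z - (m' k)%:Z)).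
Proof.
move=> e d hd; have nz k := torus_neq0 hd (ltn_ord k).
rewrite (eq_bigr (fun k : 'I_r => d k ^+ m k / d k ^+ m' k)); last first.
  by move=> k _; rewrite mxE expfzDr // exprnN.
rewrite big_split prodfV /= -!/(chr _ _) e // divff //.
by apply/prodf_neq0 => k _; rewrite expf_neq0.
Qed.

Lemma relation_comb m (A : 'M[int]_(m, r)) (c : 'rV[int]_m) :
  (forall i, relation (matrix.row i A)) -> relation (c *m A).
Proof.
move=> hA d hd; have nz k := torus_neq0 hd (ltn_ord k).
have xsum (x : K) (F : 'I_m -> int) : x != 0 ->
    x ^ (\sum_i F i) = \prod_i x ^ F i.
  by move=> xn; apply: (big_morph (fun i => x ^ i)) => [a b|]; rewrite ?expfzDr ?expr0z.
rewrite (eq_bigr (fun k : 'I_r => \prod_i (d k ^ A i k) ^ c 0 i)); last first.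
  move=> k _; rewrite mxE xsum //; apply: eq_bigr => i _.
  by rewrite mulrC exprz_exp.
rewrite exchange_big /= big1 // => i _.
have pz (F : 'I_r -> K) (z : int) : \prod_k F k ^ z = (\prod_k F k) ^ z.
  by case: z => l; rewrite /exprz ?prodfV prodrXl.
rewrite pz; have <- : \prod_(k < r) d k ^ (matrix.row i A) 0 k = \prod_(k < r) d k ^ A i k.
  by apply: eq_bigr => k _; rewrite mxE.
by rewrite hA // exp1rz.
Qed.

(** While fewer than [r] independent relations are known, some nonzero [v] is orthogonal to them. By
    [torus_orth] it is not orthogonal to all relations, and one that it detects raises the rank. *)
Lemma relation_rank j : (j <= r)%N -> exists2 A : 'M[int]_(j, r),
  row_free (map_mx intr A : 'M[K]_(j, r)) & forall i, relation (matrix.row i A).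
Proof.
elim: j => [|j IH] hj.
  by exists 0; [rewrite /row_free -leqn0 rank_leq_row|case].
have [A fA hA] := IH (ltnW hj).
pose B : 'M[K]_(j, r) := map_mx intr A.
have : kermx B^T != 0.
  rewrite kermx_eq0 /row_free mxrank_tr; move: fA; rewrite /row_free => /eqP ->.
  by rewrite neq_ltn hj.
case/rowV0Pn=> v /sub_kermxP vB vn0.
have [a ha nz] : exists2 a, relation a & \sum_k (a 0 k)%:~R * v 0 k != 0.
  apply: contrapT => hno; case/eqP: vn0; apply/rowP => k; rewrite mxE.
  apply: torus_orth => m m' e; apply/eqP; rewrite -subr_eq0 -sumrB.
  apply: contrapT => /negP nz; apply: hno; exists (\row_k ((m k)%:Z - (m' k)%:Z)).
    exact: relationB.
  move: nz; congr (_ != _); apply: eq_bigr => l _.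
  by rewrite mxE rmorphB /= mulrBl !pmulrn.
pose A1 := castmx (addn1 j, erefl r) (col_mx A a).
exists A1; last first.
  move=> i; have -> : matrix.row i A1 = matrix.row (cast_ord (esym (addn1 j)) i) (col_mx A a).
    by apply/rowP => k; rewrite !mxE castmxE !mxE /= cast_ord_id.
  case: (split_ordP (cast_ord (esym (addn1 j)) i)) => l ->; rewrite ?rowKu ?rowKd //.
  by rewrite [l]ord1 row_id.
have -> : map_mx intr A1 = castmx (addn1 j, erefl r) (col_mx B (map_mx intr a)).
  by rewrite map_castmx map_col_mx.
rewrite row_free_castmx /row_free eqn_leq rank_leq_row /=.
have lt : (B < col_mx B (map_mx intr a))%MS.
  rewrite /ltmx col_mx_sub submx_refl /=; apply/andP; split.
    by rewrite -addsmxE addsmxSl.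
  apply/negP => /submxP[D eD]; have := congr1 (fun x => (x *m v^T) 0 0) eD.
  rewrite -mulmxA.
  have -> : B *m v^T = 0 by rewrite -[LHS]trmxK trmx_mul trmxK vB trmx0.
  rewrite mulmx0 mxE [RHS]mxE => e; case/eqP: nz; rewrite -[RHS]e.
  by apply: eq_bigr => k _; rewrite !mxE.
have := rank_ltmx lt; move/eqP: fA => -> hlt; apply: leq_trans hlt.
by rewrite addn1.
Qed.

(** Multiplying a square matrix [A] of independent relations by its adjugate gives, for each [k],
    the relation [d k ^ \det A = 1]. *)
Lemma torus_finite : exists2 N, (0 < N)%N &
  forall d k, torus d -> (k < r)%N -> d k ^+ N = 1.
Proof.
have [A fA hA] := relation_rank (leqnn r).
have dA : \det A != 0.
  move: fA; rewrite row_free_unit unitmxE det_map_mx unitfE.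
  by apply: contraNneq => ->.
exists `|\det A|%N; first by rewrite absz_gt0.
move=> d k hd hk; have dk0 := torus_neq0 hd hk.
have h := @relation_comb _ A (matrix.row (Ordinal hk) (\adj A)) hA d hd.
have e j : (matrix.row (Ordinal hk) (\adj A) *m A) 0 j = \det A *+ (Ordinal hk == j).
  by rewrite -row_mul mul_adj_mx !mxE.
have : d k ^ \det A = 1.
  rewrite -[RHS]h (bigD1 (Ordinal hk)) //= e eqxx mulr1n big1 ?mulr1 // => j nj.
  by rewrite e eq_sym (negPf nj) mulr0n expr0z.
case: (\det A) => l; rewrite /exprz ?absz_nat //= => e'.
by rewrite -[LHS]invrK e' invr1.
Qed.

Lemma G_chi_finite : exists2 N, (0 < N)%N &
  forall g k, G g -> (k < r)%N -> chi k g ^+ N = 1.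
Proof.
have [N N0 hN] := torus_finite; exists N => // g k hg hk.
have gb := G_blk G_grp G_lie hg; have gu := G_unit G_grp hg.
have [u [v [[hu _ _] [hv _ _] e]]] := clear_diag G_grp G_lie gb gu.
apply: (hN (fun k => chi k g)) => //; rewrite /torus e; apply: (cas_M G_grp) => //.
exact: (cas_M G_grp).
Qed.

Lemma pf_zariski f : polynomial_function f ->
  zariski_closed [set x : 'M[K]_n | f x = 0].
Proof.
move=> hf; exists [set f]%classic; first by move=> ? ->.
by apply/seteqP; split=> x /= h; [move=> ? ->|apply: h].
Qed.

(** As [chi k ^ N = 1] on [G], the group is covered by the closed sets where [chi k = 1] and where
    the sum of the first [N] powers of [chi k] vanishes. They are disjoint since [N] is nonzero in
    [K], and the identity lies in the former. *)
Lemma G_chi g k : G g -> (k < r)%N -> chi k g = 1.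
Proof.
move=> hg hk; have [N N0 hN] := G_chi_finite.
have pc := @pf_chi K ns k.
pose f1 (x : 'M[K]_n) := chi k x - 1.
pose f2 (x : 'M[K]_n) := \sum_(i < N) chi k x ^+ i.
have p1 : polynomial_function f1 by apply: pf_add => //; apply: pf_const.
have p2 : polynomial_function f2 by apply: pf_sum => i; apply: pf_exp.
have [||h|h] := cas_connected G_grp (pf_zariski p1) (pf_zariski p2).
- move=> x hx /=; have := hN x k hx hk; move/eqP.
  rewrite -subr_eq0 subrX1 mulf_eq0 => /orP[/eqP e|/eqP e]; [left|right] => //.
- apply/seteqP; split=> // x [[hx /= e1] e2].
  have e : chi k x = 1 by apply/eqP; rewrite -subr_eq0; apply/eqP.
  move: e2; rewrite /= /f2 e; under eq_bigr do rewrite expr1n.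
  rewrite sumr_const card_ord => /eqP; rewrite pnatr_eq0 => /eqP e3.
  by rewrite e3 in N0.
- by have /= := h g hg => /eqP; rewrite subr_eq0 => /eqP.
have /= := h _ (cas_1 G_grp); rewrite /f2 chi1; under eq_bigr do rewrite expr1n.
by rewrite sumr_const card_ord => /eqP; rewrite pnatr_eq0 => /eqP e3; rewrite e3 in N0.
Qed.

Theorem G_char g : G g <->
  [/\ blk g, g \in unitmx & forall k, (k < r)%N -> chi k g = 1].
Proof.
split=> [hg|[gb gu hc]]; last exact: (chi1_G G_grp G_lie gb gu hc).
by split=> [||k]; [exact: (G_blk G_grp G_lie hg)|exact: (G_unit G_grp hg)|exact: G_chi].
Qed.
End Torus.

(** * The dense orbit *)

Section Nilradical.
Variables (K : fieldType) (ns : seq nat).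
Local Notation n := (sumn ns).
Local Notation col := (Defs.col ns).

Lemma mem_span_units (P : rel 'I_n) (X : 'M[K]_n) :
  X \in span_units K P <-> forall i j, ~~ P i j -> X i j = 0.
Proof.
split=> [hX i j nP|h].
  have sub : (span_units K P <= lker (linfun (entry i j)))%VS.
    apply/span_subvP => Y /mapP[[a b]]; rewrite mem_enum inE /= => hab ->.
    rewrite memv_ker lfunE /= /entry mxE.
    case: (boolP ((i == a) && (j == b))) => // /andP[/eqP ea /eqP eb].
    by rewrite ea eb hab in nP.
  by have := subvP sub _ hX; rewrite memv_ker lfunE => /eqP.
rewrite (matrix_sum_delta X); apply: memv_suml => i _; apply: memv_suml => j _.
have [Pij|nP] := boolP (P i j); last by rewrite h // scale0r mem0v.
apply: memvZ; apply: memv_span; apply/mapP; exists (i, j) => //.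
by rewrite mem_enum inE.
Qed.

Definition upper (X : 'M[K]_n) := forall i j : 'I_n, (col j <= col i)%N -> X i j = 0.

Lemma mem_nilradical X : X \in nilradical K ns <-> upper X.
Proof.
rewrite mem_span_units; split=> h i j hij; apply: h; first by rewrite -leqNgt.
by rewrite -leqNgt in hij.
Qed.

Lemma upper_vsval (x : mspace K ns) : upper (vsval x).
Proof. by apply/mem_nilradical; apply: subvsP. Qed.

Lemma vsprojKE X : upper X -> vsval (vsproj (nilradical K ns) X) = X.
Proof. by move=> hX; apply: vsprojK; apply/mem_nilradical. Qed.

Lemma upperD X Y : upper X -> upper Y -> upper (X + Y).
Proof. by move=> hX hY i j hij; rewrite mxE hX // hY // addr0. Qed.

Lemma upperZ c X : upper X -> upper (c *: X).
Proof. by move=> hX i j hij; rewrite mxE hX // mulr0. Qed.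

End Nilradical.

Section Conj.
Variables (K : numFieldType) (ns : seq nat).
Local Notation n := (sumn ns).
Local Notation col := (Defs.col ns).
Local Notation upper := (@upper K ns).
Local Notation blk := (@blk K ns).

Lemma upper_mul_blk X g : upper X -> blk g -> upper (X *m g).
Proof.
move=> hX hg i j hij; rewrite mxE big1 // => l _.
have [h|h] := leqP (col l) (col i); first by rewrite hX // mul0r.
by rewrite hg ?mulr0 //; apply: leq_ltn_trans h.
Qed.

Lemma blk_mul_upper X g : upper X -> blk g -> upper (g *m X).
Proof.
move=> hX hg i j hij; rewrite mxE big1 // => l _.
have [h|h] := ltnP (col l) (col i); first by rewrite hg // mul0r.
by rewrite hX ?mulr0 //; apply: leq_trans h.
Qed.

Lemma upper_conj X g : upper X -> blk g -> g \in unitmx -> upper (g *m X *m invmx g).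
Proof.
by move=> hX hg gu; apply: upper_mul_blk; [apply: blk_mul_upper|apply: blk_inv].
Qed.

Lemma adjointE g (x : mspace K ns) : blk g -> g \in unitmx ->
  vsval (adjoint K ns g x) = g *m vsval x *m invmx g.
Proof.
by move=> hg gu; apply: vsprojKE; apply: upper_conj => //; apply: upper_vsval.
Qed.
End Conj.

Section Density.
Variables (K : numFieldType) (ns : seq nat).
Hypothesis ns_pos : forall k, (k < size ns)%N -> (0 < height ns k)%N.
Local Notation n := (sumn ns).
Local Notation col := (Defs.col ns).
Local Notation row := (Defs.row ns).
Local Notation hasl := (hasl ns).
Local Notation lnbr := (lnbr ns).
Local Notation upper := (@upper K ns).
Local Notation blk := (@blk K ns).

(* A representative of the dense orbit of the parabolic in [m]. *)
Definition richardson : 'M[K]_n := \matrix_(i, j) (hasl j && (i == lnbr j :> nat))%:R.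
Local Notation xR := richardson.

Lemma lnbr_inj y y' : (y < n)%N -> (y' < n)%N -> hasl y -> hasl y' ->
  lnbr y = lnbr y' -> y = y'.
Proof. by move=> h1 h2 h3 h4; apply: (inv_f_inj (initial_inv ns_pos)). Qed.

Lemma rnbr_ex b c : (b < n)%N -> (col b < c)%N -> (row b <= height ns c)%N ->
  exists2 b', [/\ (b' < n)%N, hasl b' & lnbr b' = b] &
    row b' = row b /\ (col b < col b' <= c)%N.
Proof.
move=> hb hc hr; have [r1 r2 r3] := rcolP (row_gt0 ns b) hc hr.
have hin : inbox ns (rcol ns (row b) (col b).+1) (row b) by rewrite /inbox r2.
exists (box ns (rcol ns (row b) (col b).+1) (row b)); rewrite ?row_box ?col_box //.
split; first exact: box_lt.
  by apply/haslP; exists (col b); rewrite ?col_box ?row_box ?row_le //; case/andP: r1.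
rewrite /lnbr row_box // col_box // (@lcol_uniq _ _ _ (col b)) ?boxK ?row_le //; first by case/andP: r1.
Qed.

Lemma upper_xR : upper xR.
Proof.
move=> i j hij; rewrite mxE; case: (boolP (hasl j)) => //= hh.
case: eqP => // e; have [_ + _ _ _] := lnbrP hh; rewrite -e; lia.
Qed.

Lemma xR_delta (b b' c : 'I_n) : hasl b' -> lnbr b' = b ->
  xR *m delta_mx b' c = delta_mx b c.
Proof.
move=> hh e; apply/matrixP => i j; rewrite mxE (bigD1 b') //= big1 ?addr0 => [|l nl].
  by rewrite !mxE hh e eqxx /= -natrM mulnb.
by rewrite [X in _ * X]mxE (negPf nl) mulr0.
Qed.

Lemma xR_delta0 (b c : 'I_n) : ~~ hasl b -> xR *m delta_mx b c = 0.
Proof.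
move=> hh; apply/matrixP => i j; rewrite mxE [RHS]mxE big1 // => l _.
rewrite !mxE; case: (eqVneq l b) => [->|_]; last by rewrite mulr0.
by rewrite (negPf hh) mul0r.
Qed.

Lemma delta_xR (b c c' : 'I_n) : hasl c' -> lnbr c' = c ->
  delta_mx b c *m xR = delta_mx b c'.
Proof.
move=> hh e; apply/matrixP => i j; rewrite mxE (bigD1 c) //= big1 ?addr0 => [|l nl].
  rewrite !mxE eqxx andbT -natrM mulnb; congr ((_ && _)%:R).
  apply/andP/eqP => [[hj /eqP ej]|->]; last by rewrite hh e.
  exact: (val_inj (lnbr_inj (ltn_ord j) (ltn_ord c') hj hh (etrans (esym ej) (esym e)))).
by rewrite [X in X * _]mxE (negPf nl) andbF mul0r.
Qed.

Lemma delta_xR0 (b c : 'I_n) :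
  (forall c' : 'I_n, hasl c' -> lnbr c' <> c) -> delta_mx b c *m xR = 0.
Proof.
move=> hh; apply/matrixP => i j; rewrite mxE [RHS]mxE big1 // => l _.
rewrite !mxE; case: (eqVneq l c) => [->|_]; last by rewrite andbF mul0r.
have -> : hasl j && (c == lnbr j :> nat) = false; last by rewrite mulr0.
by apply/negP => /andP[hj /eqP e]; case: (hh j hj).
Qed.

Lemma blk_delta (b c : 'I_n) : (col b <= col c)%N -> blk (delta_mx b c).
Proof.
move=> hbc i j hij; rewrite mxE; case: eqP hij => [->|//]; case: eqP => [->|//].
by rewrite ltnNge hbc.
Qed.

(** [[x_R, x_{b',c}] = x_{b,c} - x_{b',d}], where [b'] and [d] are the right neighbours of [b] and
    [c] in their rows, the last term being absent if there is no [d]. If [b] is not in a lower row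
    than [c], then [b'] exists and lies no further right than the column of [c], and the formula is
    iterated towards the right. Otherwise its analogue for left neighbours is iterated towards the
    left. *)
Lemma ad_xR_surj (b c : 'I_n) : (col b < col c)%N ->
  exists2 s, blk s & xR *m s - s *m xR = delta_mx b c.
Proof.
case: (leqP (row b) (row c)) => hr.
  have [m] := ubnP (size ns - col c); elim: m b c hr => // m IH b c hr hm hc.
  have hh : (row b <= height ns (col c))%N by apply: leq_trans hr (row_le _).
  have [b0 [b1 b2 b3] [b4 b5]] := rnbr_ex (ltn_ord b) hc hh.
  pose b' := Ordinal b1; have bb : blk (delta_mx b' c) by apply: blk_delta; case/andP: b5.
  have eb : xR *m delta_mx b' c = delta_mx b c by apply: xR_delta.
  have [/existsP[d /andP[d1 /eqP d2]]|no] :=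
      boolP [exists d : 'I_n, hasl d && (lnbr d == c)].
    have ed : delta_mx b' c *m xR = delta_mx b' d by apply: delta_xR.
    have [l1 l2 l3 l4 l5] := lnbrP d1; rewrite d2 in l2 l3.
    have [|||s bs es] := IH b' d.
    - by rewrite /= b4 -l3.
    - by have := col_lt (ltn_ord d); lia.
    - by rewrite /=; lia.
    exists (delta_mx b' c + s); first exact: blkD.
    by rewrite mulmxDr mulmxDl eb ed opprD addrACA es subrK.
  exists (delta_mx b' c) => //.
  rewrite eb delta_xR0 ?subr0 // => d hd e; case/existsP: no.
  by exists d; rewrite hd e eqxx.
have [m] := ubnP (col b); elim: m b c hr => // m IH b c hr hm hc.
have hl : hasl c.
  by apply/haslP; exists (col b) => //; apply: leq_trans (ltnW hr) (row_le _).
have [l1 l2 l3 l4 l5] := lnbrP hl; pose c' := Ordinal l1.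
have hbc : (col b <= col c')%N.
  rewrite leqNgt; apply/negP => hlt; have := l5 (col b); rewrite hlt hc => /(_ isT).
  by have := row_le (ltn_ord b); lia.
have bb : blk (delta_mx b c') by apply: blk_delta.
have eb : delta_mx b c' *m xR = delta_mx b c by apply: delta_xR.
have [hb|nb] := boolP (hasl b); last first.
  by exists (- delta_mx b c'); [exact: blkN|rewrite mulmxN mulNmx opprK xR_delta0 // oppr0 add0r eb].
have [m1 m2 m3 m4 m5] := lnbrP hb; pose b' := Ordinal m1.
have ex : xR *m delta_mx b c' = delta_mx b' c' by apply: xR_delta.
have [|||s bs es] := IH b' c'.
- by rewrite /= m3 l3.
- by rewrite /=; lia.
- by rewrite /=; apply: leq_trans hbc.
exists (s - delta_mx b c'); first by apply: blkD => //; apply: blkN.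
rewrite mulmxBr mulmxBl ex eb.
have -> : xR *m s = s *m xR + delta_mx b' c' by rewrite -es addrC subrK.
by rewrite addrK opprB addrC subrK.
Qed.

(* [ad xR] has a linear right inverse [S] on [m]. Hence [xR + t Z] is conjugate
   to [xR] by [d + S Y], where [Y + t Z S(Y) = - t d Z]: by Cramer's rule, with
   [d] the determinant of this linear system, [Y] is polynomial in [t]. *)
Theorem dense_orbit (f : mspace K ns -> K) : polynomial_function f ->
  (forall g x, blk g -> g \in unitmx -> vsval x = g *m xR *m invmx g -> f x = 0) ->
  forall y, f y = 0.
Proof.
move=> hf hfx y.
have [s hs] : exists s : 'I_n * 'I_n -> 'M[K]_n, forall bc, blk (s bc) /\
    ((col bc.1 < col bc.2)%N -> xR *m s bc - s bc *m xR = delta_mx bc.1 bc.2).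
  have := @fin_all_exists ('I_n * 'I_n)%type (fun=> 'M[K]_n)
    (fun (bc : 'I_n * 'I_n) (s : 'M[K]_n) => blk s /\ ((col bc.1 < col bc.2)%N ->
    xR *m s - s *m xR = delta_mx bc.1 bc.2)); apply=> -[b c] /=.
  have [hbc|hbc] := ltnP (col b) (col c).
    by have [t ht et] := ad_xR_surj hbc; exists t.
  by exists 0; split=> [i j _|//]; rewrite mxE.
pose S (Y : 'M[K]_n) := \sum_b \sum_c Y b c *: s (b, c).
(* The matrix of [S] on matrices written as row vectors, so that the adjugate can solve the linear
   system. *)
pose Sm : 'M[K]_(n * n) := \matrix_k mxvec (s (enum_val (cast_ord (esym (mxvec_cast n n)) k))).
have SmE Y : vec_mx (mxvec Y *m Sm) = S Y.
  rewrite mulmx_sum_row linear_sum (reindex _ (curry_mxvec_bij n n)) /=.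
  rewrite /S pair_big /=; apply: eq_bigr => -[b c] _.
  rewrite linearZ /= mxvecE; congr (_ *: _).
  by rewrite rowK mxvecK /mxvec_index cast_ordK enum_rankK.
have S_blk Y : blk (S Y).
  move=> i j hij; rewrite summxE big1 // => b _; rewrite summxE big1 // => c _.
  by have [hb _] := hs (b, c); rewrite mxE hb // mulr0.
have SE Y : upper Y -> xR *m S Y - S Y *m xR = Y.
  move=> hY; rewrite [RHS](matrix_sum_delta Y) mulmx_sumr mulmx_suml -sumrB.
  apply: eq_bigr => b _; rewrite mulmx_sumr mulmx_suml -sumrB.
  apply: eq_bigr => c _; rewrite -scalemxAr -scalemxAl -scalerBr.
  have [_ e] := hs (b, c); have [h|h] := ltnP (col b) (col c); first by rewrite e.
  by rewrite hY // !scale0r.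
pose x0 := vsproj (nilradical K ns) xR.
have ex0 : vsval x0 = xR := vsprojKE upper_xR.
pose Z : 'M[K]_n := vsval (y - x0).
have hZ : upper Z := upper_vsval (y - x0).
pose Tm := Sm *m lin_mulmx Z.
pose pc : {rmorphism K -> {poly K}} := polyC.
pose A : 'M[{poly K}]_(n * n) := 1%:M + 'X *: map_mx pc Tm.
pose w : 'rV[{poly K}]_(n * n) := - ('X *: map_mx pc (mxvec Z)) *m \adj A.
pose Gp : 'M[{poly K}]_n := (\det A)%:M + vec_mx (w *m map_mx pc Sm).
have [q hq] := pf_line x0 (y - x0) hf.
pose ev t : {rmorphism {poly K} -> K} := horner_eval t.
have evC t m p (X : 'M[K]_(m, p)) : map_mx (ev t) (map_mx pc X) = X.
  by apply/matrixP => i j; rewrite !mxE /= /horner_eval hornerC.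
pose At t := 1%:M + t *: Tm; pose dt t := \det (At t).
pose Yt t := vec_mx (- (t *: mxvec Z) *m \adj (At t)).
have evX t : ev t 'X = t by rewrite /= /horner_eval hornerX.
have evA t : map_mx (ev t) A = At t.
  by rewrite map_mxD map_mx1 map_mxZ evC evX.
have evw t : map_mx (ev t) w = mxvec (Yt t).
  by rewrite map_mxM map_mx_adj evA map_mxN map_mxZ evC evX vec_mxK.
have evG t : map_mx (ev t) Gp = (dt t)%:M + S (Yt t).
  by rewrite map_mxD map_scalar_mx /= -det_map_mx evA map_vec_mx map_mxM evw evC SmE.
have evh t : (\det Gp).[t] = \det ((dt t)%:M + S (Yt t)).
  by rewrite -evG det_map_mx.
have YE t : Yt t = - (t * dt t) *: Z - t *: (Z *m S (Yt t)).
  have : mxvec (Yt t) *m At t = - (t * dt t) *: mxvec Z.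
    rewrite vec_mxK -mulmxA mul_adj_mx mul_mx_scalar scalerN scalerA scaleNr.
    by rewrite mulrC.
  rewrite mulmxDr mulmx1 -scalemxAr mulmxA -[X in _ + _ *: (X *m _)]vec_mxK SmE.
  rewrite mul_vec_lin /= => e; apply: (can_inj mxvecK).
  by rewrite linearB /= !linearZ /= -e scalerN addrK.
have hY t : upper (Yt t).
  rewrite YE; apply: upperD; first exact: upperZ.
  by rewrite -scaleNr; apply: upperZ; apply: upper_mul_blk.
suff q0 : q = 0.
  have := hq 1; rewrite q0 horner0 scale1r addrC subrK => <-//.
(* At [t = 0] the conjugating matrix is the identity, so its determinant is not the zero polynomial;
   wherever it is nonzero, the point of the line lies in the orbit. *)
apply: (@poly_fun0_dense _ (\det Gp)) => [|t ht].
  apply/eqP => /(congr1 (fun p => p.[0])); rewrite horner0 evh.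
  have -> : S (Yt 0) = 0.
    have -> : Yt 0 = 0 by rewrite YE mul0r oppr0 !scale0r subr0.
    by rewrite /S big1 // => b _; rewrite big1 // => c _; rewrite mxE scale0r.
  rewrite /dt /At scale0r !addr0 !det1 => /eqP.
  by rewrite oner_eq0.
rewrite hq; have gu : (dt t)%:M + S (Yt t) \in unitmx.
  by rewrite unitmxE unitfE -evh.
have gb : blk ((dt t)%:M + S (Yt t)).
  by apply: blkD => // i j hij; rewrite mxE; case: eqP hij => // ->; rewrite ltnn.
apply: (hfx _ _ gb gu).
have -> : vsval (x0 + t *: (y - x0)) = xR + t *: Z.
  by rewrite /Z linearD linearZ linearB /= ex0.
apply: (can_inj (mulmxK gu)); rewrite mulmxKV //.
have -> : (xR + t *: Z) *m ((dt t)%:M + S (Yt t)) =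
    dt t *: xR + xR *m S (Yt t) + ((t * dt t) *: Z + t *: (Z *m S (Yt t))).
  by rewrite mulmxDl !mulmxDr !mul_mx_scalar -!scalemxAl scalerA [dt t * t]mulrC.
rewrite [RHS]mulmxDl mul_scalar_mx -addrA; congr (_ + _).
have -> : (t * dt t) *: Z + t *: (Z *m S (Yt t)) = - Yt t.
  by rewrite [in RHS]YE opprB scaleNr opprK addrC.
by rewrite -[X in _ - X](SE _ (hY t)) opprB addrC subrK.
Qed.
End Density.

(** * The invariants *)

Local Close Scope ring_scope.

Section Crossings.
Variable ns : seq nat.
Local Notation n := (sumn ns).
Local Notation h := (height ns).
Local Notation col := (Defs.col ns).
Local Notation row := (Defs.row ns).
Local Notation box := (Defs.box ns).
Variables (s C C' : nat).
Hypothesis s_gt0 : 0 < s.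
Hypothesis nb : neighbouring ns s C C'.

Let ltC : C < C'. Proof. by have [] := nb_facts s_gt0 nb. Qed.
Let hC : h C = s. Proof. by have [_ _ ? _ _] := nb_facts s_gt0 nb. Qed.
Let hC' : h C' = s. Proof. by have [_ _ _ ? _] := nb_facts s_gt0 nb. Qed.

Definition sources (a : 'I_n) := C <= col a < C'.
Definition targets (a : 'I_n) := C < col a <= C'.
Local Notation I := sources.
Local Notation J := targets.

(* Identifies the rows [sources] with the columns [targets], so that a minor
   becomes the determinant of a square matrix indexed by all boxes. *)
Definition swap_cols (a : nat) := if col a == C then box C' (row a)
  else if col a == C' then box C (row a) else a.

Let inC (a : 'I_n) : col a = C -> inbox ns C' (row a).
Proof. by move=> e; have := inbox_box (ltn_ord a); rewrite /inbox e hC hC'. Qed.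
Let inC' (a : 'I_n) : col a = C' -> inbox ns C (row a).
Proof. by move=> e; have := inbox_box (ltn_ord a); rewrite /inbox e hC hC'. Qed.

Lemma swap_lt (a : 'I_n) : swap_cols a < n.
Proof.
rewrite /swap_cols; case: eqP => [/inC/box_lt//|_].
by case: eqP => [/inC'/box_lt|_].
Qed.

Definition swap_ord a := Ordinal (swap_lt a).

Lemma swap_row (a : 'I_n) : row (swap_cols a) = row a.
Proof.
rewrite /swap_cols; case: eqP => [/inC/row_box//|_].
by case: eqP => [/inC'/row_box|_].
Qed.

Lemma swap_col (a : 'I_n) : col (swap_cols a) =
  if col a == C then C' else if col a == C' then C else col a.
Proof.
rewrite /swap_cols; case: eqP => [/inC/col_box//|_].
by case: eqP => [/inC'/col_box|_].
Qed.

Lemma swap_ordK : involutive swap_ord.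
Proof.
move=> a; apply: val_inj; apply: (@eq_box ns) => /=; last by rewrite (swap_row (swap_ord a)) swap_row.
rewrite (swap_col (swap_ord a)) /= swap_col; case: (eqVneq (col a) C) => [->|ne].
  by rewrite eqxx (gtn_eqF ltC).
by case: (eqVneq (col a) C') => [->|ne']; rewrite ?eqxx // (negPf ne) (negPf ne').
Qed.

Definition swap : {perm 'I_n} := perm (inv_inj swap_ordK).

Lemma swapE a : swap a = swap_cols a :> nat. Proof. by rewrite permE. Qed.
Lemma swapK a : swap (swap a) = a. Proof. by rewrite !permE swap_ordK. Qed.
Lemma swap_targets a : J (swap a) = I a.
Proof.
rewrite /J /I swapE swap_col; case: (eqVneq (col a) C) => [->|?]; first by lia.
by case: (eqVneq (col a) C') => [->|?]; lia.
Qed.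
Lemma swap_sources a : I (swap a) = J a.
Proof. by rewrite -swap_targets swapK. Qed.

(** By [ndiag_le], every nonzero term of the minor of [t + x] contains at least this many factors
    [t]. *)
Definition ndiag := #|[set a : 'I_n | (C < col a < C') && (s < row a)]|.

Lemma card_by_col (P : pred 'I_n) : #|[set a : 'I_n | P a]| =
  \sum_(k < size ns) #|[set a : 'I_n | P a && (col a == k)]|.
Proof.
rewrite -sum1dep_card (partition_big (fun a : 'I_n => Ordinal (col_lt (ltn_ord a))) predT) //=.
by apply: eq_bigr => k _; rewrite sum1dep_card.
Qed.

(* At most [s] of the moves [a -> swap (p a)] cross a given column, since
   [targets] has [s] boxes less than [sources] to the left of it. *)
Lemma ndiag_le (p : {perm 'I_n}) : (forall a, ~~ I a -> p a = a) ->
  (forall a, I a -> swap (p a) = a \/ col a < col (swap (p a))) ->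
  ndiag <= #|[set a : 'I_n | I a && (swap (p a) == a)]|.
Proof.
move=> p1 p2; pose r := (p * swap)%g.
have rE a : r a = swap (p a) by rewrite permM.
have rI a : J (r a) -> I a.
  apply: contraTT => na; rewrite rE p1 // swap_targets //.
have by_col k : C < k < C' ->
    #|[set a : 'I_n | ((C < col a < C') && (r a != a)) && (col a == k)]| <=
    #|[set a : 'I_n | ((C < col a < C') && (row a <= s)) && (col a == k)]|.
  move=> hk; have [le|gt] := leqP (h k) s.
    apply: subset_leq_card; apply/fintype.subsetP => a; rewrite !inE => /andP[/andP[-> _] /eqP e].
    by rewrite e eqxx andbT /= (leq_trans _ le) // -e row_le.
  (* As boxes move to the right, the targets left of column [k] are images of sources left of it.
     There are [s] more such sources than such targets, so at most [s] of these sources are sent to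
     columns from [k] on. *)
  pose Ak := [set a : 'I_n | I a && (col a < k)]; pose Bk := [set b : 'I_n | J b && (col b < k)].
  pose Ck := [set a : 'I_n | col a == C].
  have eA : #|Ak| = #|Ck| + #|Bk|.
    rewrite -cardsUI (_ : Ck :&: Bk = finset.set0) ?cards0 ?addn0.
      by apply: eq_card => a; rewrite !inE /I /J; lia.
    by apply/setP => a; rewrite !inE /J; case: eqP => //= ->; rewrite ltnn.
  have sB : Bk \subset [set r a | a in Ak].
    apply/fintype.subsetP => b; rewrite inE => /andP[Jb lb].
    have := rI (r^-1%g b); rewrite permKV => /(_ Jb) Ia.
    apply/imsetP; exists (r^-1%g b); rewrite ?permKV // inE Ia.
    by case: (p2 _ Ia); rewrite -rE permKV; [move=> <-|lia].
  apply: (@leq_trans #|[set r a | a in Ak] :\: Bk|).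
    apply: subset_leq_card; apply/fintype.subsetP => b.
    rewrite !inE => /andP[/andP[cb nb'] /eqP e]; rewrite e ltnn andbF /=.
    have Jb : J b by rewrite /J; lia.
    have := rI (r^-1%g b); rewrite permKV => /(_ Jb) Ia.
    apply/imsetP; exists (r^-1%g b); rewrite ?permKV // inE Ia.
    case: (p2 _ Ia); rewrite -rE permKV; last by rewrite e.
    by move=> eb; case/eqP: nb'; rewrite {1}eb permKV.
  rewrite cardsD (finset.setIidPr sB) card_imset; last exact: perm_inj.
  rewrite eA addnK.
  have inK (a : 'I_n) : col a = C -> inbox ns k (row a).
    by move=> e; have := inbox_box (ltn_ord a); rewrite /inbox e hC; lia.
  pose f (a : 'I_n) : 'I_n := insubd a (box k (row a)).
  have fE a : a \in Ck -> f a = box k (row a) :> nat.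
    by rewrite inE => /eqP/inK/box_lt hlt; rewrite val_insubd hlt.
  rewrite -(@card_in_imset _ _ f Ck).
    apply: subset_leq_card; apply/fintype.subsetP => b /imsetP[a ha ->].
    have /eqP ea : col a == C by move: ha; rewrite inE.
    rewrite !inE fE // (col_box (inK _ ea)) (row_box (inK _ ea)) hk eqxx andbT /=.
    by rewrite -hC -ea row_le.
  move=> a b ha hb /(congr1 val) /=; rewrite !fE //; rewrite !inE in ha hb.
  move=> /(congr1 row); rewrite !row_box ?inK //; try exact/eqP.
  by move=> e; apply/val_inj/(@eq_box ns) => //; rewrite (eqP ha) (eqP hb).
have key : #|[set a : 'I_n | (C < col a < C') && (r a != a)]| <=
    #|[set a : 'I_n | (C < col a < C') && (row a <= s)]|.
  rewrite !card_by_col; apply: leq_sum => k _.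
  have [/by_col//|nk] := boolP (C < k < C').
  rewrite (_ : finset _ = finset.set0) ?cards0 //; apply/setP => a; rewrite !inE.
  by case: (col a =P k) => [->|_]; rewrite ?andbF // (negPf nk).
pose inner := [set a : 'I_n | C < col a < C'].
have e1 : #|inner| = #|[set a : 'I_n | (C < col a < C') && (row a <= s)]| + ndiag.
  rewrite -(cardsID [set a : 'I_n | row a <= s]); congr (_ + _); apply: eq_card => a.
    by rewrite !inE.
  by rewrite !inE -ltnNge andbC.
have e2 : #|inner| = #|[set a : 'I_n | (C < col a < C') && (r a != a)]| + #|inner :\: [set a : 'I_n | r a != a]|.
  by rewrite -(cardsID [set a : 'I_n | r a != a]); congr (_ + _); apply: eq_card => a; rewrite !inE.
have e3 : #|inner :\: [set a : 'I_n | r a != a]| <= #|[set a : 'I_n | I a && (swap (p a) == a)]|.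
  apply: subset_leq_card; apply/fintype.subsetP => a; rewrite !inE negbK rE.
  by case/andP=> -> ?; rewrite /I; lia.
lia.
Qed.
End Crossings.

Local Open Scope ring_scope.

Section Cut.
Variables (R : comNzRingType) (m : nat).
Implicit Types (P : pred 'I_m) (X Y Z : 'M[R]_m).

(** Its determinant is the principal minor on [P], without reindexing. *)
Definition cut P X : 'M[R]_m := \matrix_(a, b) if P a && P b then X a b else (a == b)%:R.

Lemma cut_mul P X Y Z :
  (forall a b, P a -> P b -> Z a b = \sum_(c | P c) X a c * Y c b) ->
  cut P X *m cut P Y = cut P Z.
Proof.
move=> hZ; apply/matrixP => a b; rewrite !mxE.
have [Pa|nPa] := boolP (P a); last first.
  rewrite (bigD1 a) //= !mxE (negPf nPa) /= eqxx mul1r big1 ?addr0 // => c nc.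
  by rewrite !mxE (negPf nPa) /= eq_sym (negPf nc) mul0r.
have [Pb|nPb] /= := boolP (P b).
  rewrite hZ // [RHS]big_mkcond /=; apply: eq_bigr => c _; rewrite !mxE Pa Pb andbT /=.
  by case: ifP => // /negbT nPc; rewrite (negPf (_ : a != c)) ?mul0r //; apply: contraNneq nPc => <-.
rewrite (bigD1 b) //= !mxE (negPf nPb) andbF eqxx mulr1 big1 ?addr0 // => c nc.
by rewrite !mxE (negPf nPb) !andbF (negPf nc) mulr0.
Qed.

Lemma cut_perm P (s : {perm 'I_m}) X :
  \det (cut (fun a => P (s a)) (\matrix_(a, b) X (s a) (s b))) = \det (cut P X).
Proof.
have -> : cut (fun a => P (s a)) (\matrix_(a, b) X (s a) (s b)) =
    row_perm s (col_perm s (cut P X)).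
  by apply/matrixP => a b; rewrite !mxE (inj_eq perm_inj).
rewrite row_permE col_permE !det_mulmx !det_perm odd_permV mulrCA -signr_addb.
by rewrite addbb mulr1.
Qed.
End Cut.

Lemma map_cut (R R' : comNzRingType) (f : {rmorphism R -> R'}) m (P : pred 'I_m) X :
  map_mx f (cut P X) = cut P (map_mx f X).
Proof.
by apply/matrixP => a b; rewrite !mxE; case: ifP => // _; rewrite rmorph_nat.
Qed.

Section Invariants.
Variables (K : numFieldType) (ns : seq nat).
Local Notation n := (sumn ns).
Local Notation h := (height ns).
Local Notation col := (Defs.col ns).
Local Notation row := (Defs.row ns).
Local Notation upper := (@upper K ns).
Local Notation blk := (@blk K ns).
Variables (s C C' : nat).
Hypothesis s_gt0 : (0 < s)%N.
Hypothesis nb : neighbouring ns s C C'.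
Local Notation I := (@sources ns C C').
Local Notation J := (@targets ns C C').
Local Notation swap := (swap s_gt0 nb).

Let ltC : (C < C')%N. Proof. by have [] := nb_facts s_gt0 nb. Qed.

Definition contributes (p : {perm 'I_n}) := [forall a, ~~ I a ==> (p a == a)] &&
  (#|[set a : 'I_n | I a && (swap (p a) == a)]| == ndiag ns s C C').

(* The lowest coefficient in [t] of the minor of [t + x] with rows [I] and
   columns [J]. *)
Definition BS (x : 'M[K]_n) := \sum_(p : {perm 'I_n} | contributes p)
  (-1) ^+ p * \prod_(a | I a && (swap (p a) != a)) x a (swap (p a)).

Definition colswap (R : nzRingType) (Y : 'M[R]_n) : 'M[R]_n := \matrix_(a, b) Y a (swap b).

(** By [ndiag_le], a permutation that does not contribute has a vanishing product or too many
    factors ['X]. The entries of [N] are allowed to involve ['X] for the sake of [BS_semi]. *)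
Lemma BS_coef (N : 'M[{poly K}]_n) :
  (forall a b : 'I_n, (col b <= col a)%N -> N a b = 0) ->
  (\det (cut I (colswap ('X%:M + N))))`_(ndiag ns s C C') = BS (map_mx (coefp 0) N).
Proof.
move=> hN; rewrite /determinant coef_sum /BS [RHS]big_mkcond /=.
apply: eq_bigr => p _.
set d := ndiag _ _ _ _.
have sg (q : {poly K}) : ((-1) ^+ p * q)`_d = (-1) ^+ p * q`_d.
  by rewrite !mulr_sign; case: (odd_perm p); rewrite ?coefN.
rewrite {}sg /contributes -/d.
have [/forallP hp|] /= := boolP [forall a, ~~ I a ==> (p a == a)]; last first.
  rewrite negb_forall => /existsP[a].
  rewrite negb_imply => /andP[Ia np].
  by rewrite (bigD1 a) //= !mxE (negPf Ia) /= eq_sym (negPf np) mul0r coef0 mulr0.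
have {}hp a : ~~ I a -> p a = a by move=> Ia; apply/eqP/(implyP (hp a)).
have pI a : I a -> I (p a).
  by apply: contraTT => Ia; rewrite -(perm_inj (hp _ Ia)).
pose fix_ a := swap (p a) == a.
set f := #|_|; have eprod : \prod_a cut I (colswap ('X%:M + N)) a (p a) =
    (\prod_(a | I a && ~~ fix_ a) N a (swap (p a))) * 'X^f.
  rewrite (bigID I) /= [X in _ * X]big1 ?mulr1 => [|a Ia]; last first.
    by rewrite !mxE (negPf Ia) hp // eqxx.
  rewrite (bigID fix_) /= mulrC; congr (_ * _).
    apply: eq_bigr => a /andP[Ia nf]; rewrite !mxE Ia pI //= eq_sym -/(fix_ a).
    by rewrite (negPf nf) mulr0n add0r.
  rewrite (eq_bigr (fun=> 'X)); last first.
    move=> a /andP[Ia /eqP ef]; rewrite !mxE Ia pI //= ef eqxx hN // addr0.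
    by rewrite mulr1n.
  by rewrite prodr_const /f cardsE.
rewrite eprod coefMXn.
have c0 : (\prod_(a | I a && ~~ fix_ a) N a (swap (p a)))`_0 =
    \prod_(a | I a && ~~ fix_ a) map_mx (coefp 0) N a (swap (p a)).
  rewrite -horner_coef0 horner_prod; apply: eq_bigr => a _.
  by rewrite mxE /= horner_coef0.
have [e|ne] := eqVneq f d; first by rewrite e ltnn subnn c0.
have [lt|le] := ltnP d f; first by rewrite mulr0.
have /existsP[a /andP[/andP[Ia nf] /eqP N0]] :
    [exists a, (I a && ~~ fix_ a) && (N a (swap (p a)) == 0)].
  apply: contraT; rewrite negb_exists => /forallP hn; case/eqP: ne; apply/eqP.
  rewrite eqn_leq le; apply: ndiag_le => // a Ia.
  have [/eqP|nf] := boolP (fix_ a); [by left|right].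
  have := hn a; rewrite Ia nf /= => nz; rewrite ltnNge; apply: contra nz => hc.
  by rewrite hN.
by rewrite (bigD1 a) ?Ia //= N0 mul0r coef0 mulr0.
Qed.

Let pc : {rmorphism K -> {poly K}} := polyC.

Let coef_pc (x : 'M[K]_n) : map_mx (coefp 0) (map_mx pc x) = x.
Proof. by apply/matrixP => a b; rewrite !mxE /= coefC. Qed.

Lemma swapI a : I (swap a) = J a. Proof. exact: swap_sources. Qed.

(** Truncating [k], [t + x] and [g] to sources and targets yields the right block of [k x g], but
    turns [t k g] into [t (1 + v)]. As [v] is strictly block upper triangular, [BS_coef] shows that
    it does not affect the lowest coefficient, and the determinant of the product gives the
    claim. *)
Lemma BS_semi g k x : blk g -> blk k -> k *m g = 1%:M -> upper x ->
  BS (k *m x *m g) = \det (cut I k) * BS x * \det (cut J g).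
Proof.
move=> gb kb kg ux; have [u eu] : {u | u = k *m x *m g} by exists (k *m x *m g).
rewrite -eu; have uu : upper u by rewrite eu; apply: upper_mul_blk => //; apply: blk_mul_upper.
pose v : 'M[K]_n := \matrix_(a, b) if I a && J b then
  \sum_(c | I c && J c) k a c * g c b - (a == b)%:R else 0.
pose N := map_mx pc u + 'X *: map_mx pc v.
have uE (a b : 'I_n) : I a -> J b -> u a b = \sum_(d | J d) \sum_(c | I c) k a c * x c d * g d b.
  move=> Ia Jb; rewrite eu mxE [RHS]big_mkcond /=; apply: eq_bigr => d _.
  have [Jd|nJ] := boolP (J d); last first.
    have [lt|le] := ltnP (col b) (col d); first by rewrite gb // mulr0.
    rewrite mxE big1 ?mul0r // => c _.
    have [lt|le'] := ltnP (col c) (col a); first by rewrite kb // mul0r.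
    rewrite ux ?mulr0 //; move: nJ Jb Ia; rewrite /targets /sources; lia.
  rewrite mxE mulr_suml [RHS]big_mkcond /=; apply: eq_bigr => c _.
  have [//|nI] := boolP (I c).
  have [lt|le] := ltnP (col b) (col d); first by rewrite gb // mulr0.
  have [lt|le'] := ltnP (col c) (col a); first by rewrite kb // !mul0r.
  rewrite ux ?mulr0 ?mul0r //; move: nI Jb Ia; rewrite /targets /sources; lia.
have hv (a b : 'I_n) : (col b <= col a)%N -> v a b = 0.
  move=> le; rewrite mxE; case: ifP => // /andP[Ia Jb].
  have -> : \sum_(c | I c && J c) k a c * g c b = (k *m g) a b.
    rewrite mxE big_mkcond /=; apply: eq_bigr => c _; case: ifP => // nIJ.
    have [lt|le1] := ltnP (col b) (col c); first by rewrite gb // mulr0.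
    have [lt|le2] := ltnP (col c) (col a); first by rewrite kb // mul0r.
    by move: nIJ Ia Jb; rewrite /targets /sources; lia.
  by rewrite kg mxE subrr.
have eN : cut I (map_mx pc k) *m cut I (colswap ('X%:M + map_mx pc x)) *m
    cut I (\matrix_(a, b) (map_mx pc g) (swap a) (swap b)) = cut I (colswap ('X%:M + N)).
  pose Y : 'M[{poly K}]_n := \matrix_(a, b) \sum_(c | I c) map_mx pc k a c *
    colswap ('X%:M + map_mx pc x) c b.
  rewrite (@cut_mul _ _ _ _ _ Y) => [|a b _ _]; last by rewrite mxE.
  apply: cut_mul => a b Ia Ib.
  have Jb : J (swap b) by rewrite -swapI swapK.
  rewrite (reindex_inj (@perm_inj _ swap)) /= [LHS]mxE [LHS]mxE.
  have eY d : Y a (swap d) = \sum_(c | I c) (k a c)%:P * ('X *+ (c == d) + (x c d)%:P).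
    by rewrite mxE; apply: eq_bigr => c _; rewrite !mxE swapK.
  have -> : \sum_(d | I (swap d)) Y a (swap d) *
      (\matrix_(a0, b0) map_mx pc g (swap a0) (swap b0)) (swap d) b =
    \sum_(d | J d) \sum_(c | I c) ((k a c * x c d * g d (swap b))%:P +
       'X * (k a c * (c == d)%:R * g d (swap b))%:P).
    apply: eq_big => [d|d _]; first exact: swapI.
    rewrite eY mulr_suml; apply: eq_bigr => c _; rewrite !mxE swapK /=.
    by rewrite !polyCM polyC_natr -mulr_natr; ring.
  have -> : \sum_(d | J d) \sum_(c | I c) ((k a c * x c d * g d (swap b))%:P +
       'X * (k a c * (c == d)%:R * g d (swap b))%:P) =
    (u a (swap b))%:P + 'X * (\sum_(c | I c && J c) k a c * g c (swap b))%:P.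
    rewrite uE //.
    transitivity ((\sum_(d | J d) \sum_(c | I c) (k a c * x c d * g d (swap b)))%:P +
      'X * (\sum_(d | J d) \sum_(c | I c) (k a c * (c == d)%:R * g d (swap b)))%:P).
      rewrite !rmorph_sum mulr_sumr -big_split; apply: eq_bigr => d _ /=.
      by rewrite !rmorph_sum mulr_sumr -big_split.
    congr (_ + _ * _%:P).
    rewrite [RHS](eq_bigl (fun c => J c && I c)); last by move=> c; rewrite andbC.
    rewrite [RHS]big_mkcondr; apply: eq_bigr => d _ /=.
    case: ifP => [Id|nId].
      rewrite (bigD1 d) //= eqxx mulr1 big1 ?addr0 // => c /andP[_ /negPf->].
      by rewrite mulr0 mul0r.
    rewrite big1 // => c Ic; rewrite (_ : (c == d) = false) ?mulr0 ?mul0r //.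
    by apply: contraFF nId => /eqP <-.
  rewrite !mxE Ia Jb /= addrCA; congr (_ + _).
  by rewrite polyCB polyC_natr mulrBr mulr_natr addrC subrK.
have := congr1 determinant eN; rewrite !det_mulmx => /(congr1 (fun p : {poly K} => p`_(ndiag ns s C C'))).
rewrite BS_coef; last first.
  by move=> a b le; rewrite mxE [X in X + _]mxE uu // [X in _ + X]mxE [X in _ * X]mxE hv // mulr0 addr0.
have -> : map_mx (coefp 0) N = u.
  by apply/matrixP => a b; rewrite !mxE /= coefD coefC coefXM addr0.
move=> <-; rewrite -map_cut det_map_mx /=.
have -> : \det (cut I (\matrix_(a, b) (map_mx pc g) (swap a) (swap b))) = (\det (cut J g))%:P.
  rewrite -[RHS](det_map_mx pc) map_cut -[RHS](cut_perm _ swap); congr (\det (cut _ _)).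
  by apply: funext => a; rewrite /= swap_targets.
rewrite coefMC coefCM BS_coef ?coef_pc // => a b le.
by rewrite mxE ux // polyC0.
Qed.
End Invariants.

(** * The value of an invariant on the matrices supported by a diagram *)

Section Evaluation.
Variables (K : numFieldType) (ns : seq nat).
Local Notation n := (sumn ns).
Local Notation h := (height ns).
Local Notation col := (Defs.col ns).
Local Notation row := (Defs.row ns).
Local Notation box := (Defs.box ns).
Local Notation key := (key ns).
Local Notation upper := (@upper K ns).
Variables (D : diagram) (s C C' : nat) (g : nat -> nat).
Hypothesis s_gt0 : (0 < s)%N.
Hypothesis nb : neighbouring ns s C C'.
Hypothesis gP : pairing ns D s C C' g.
Local Notation I := (@sources ns C C').
Local Notation J := (@targets ns C C').
Local Notation swap := (swap s_gt0 nb).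
Local Notation back := (back ns s C C' g).
Local Notation back_perm := (back_perm s_gt0 nb gP).
Local Notation BS := (BS s_gt0 nb).
Local Notation contributes := (contributes s_gt0 nb).
Local Notation enters := (enters ns s C C').

Let ltC : (C < C')%N. Proof. by have [] := nb_facts s_gt0 nb. Qed.
Let hC : h C = s. Proof. by have [_ _ ? _ _] := nb_facts s_gt0 nb. Qed.
Let hC' : h C' = s. Proof. by have [_ _ _ ? _] := nb_facts s_gt0 nb. Qed.

Let row_C (a : 'I_n) : col a = C -> (row a <= s)%N.
Proof. by move=> e; rewrite -hC -e row_le. Qed.
Let row_C' (a : 'I_n) : col a = C' -> (row a <= s)%N.
Proof. by move=> e; rewrite -hC' -e row_le. Qed.

Let back_swap (a : 'I_n) : col a = C' -> back (swap a) = a.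
Proof.
move=> e; have := swap_col s_gt0 nb a; have := swap_row s_gt0 nb a.
rewrite -!(swapE s_gt0 nb) e eqxx (gtn_eqF ltC) => hr hc.
rewrite /back /enters hc ltnn /= !andbF eqxx hr (row_C' e) /=.
by rewrite -e boxK.
Qed.

Let back_fix (a : 'I_n) : col a != C -> (s < row a)%N || ~~ J a -> back a = a.
Proof.
move=> ne ha; rewrite /back /enters ltn_ord (negPf ne) /=.
by case: ifP => // /andP[h1 h2]; move: ha; rewrite /targets; lia.
Qed.

Definition low_sources (a : 'I_n) := (row a <= s)%N && I a.

Lemma pred_perm_unique (p : {perm 'I_n}) : (forall a, ~~ I a -> p a = a) ->
  (forall a, low_sources a -> enters (swap (p a)) /\ g (swap (p a)) = a) ->
  (forall a, I a -> (s < row a)%N -> swap (p a) = a) ->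
  p = (back_perm^-1 * swap)%g.
Proof.
move=> p1 p2 p3; apply/permP => a; rewrite permM.
have -> : (back_perm^-1)%g a = swap (p a); last by rewrite swapK.
apply: (@perm_inj _ back_perm); rewrite permKV; apply/val_inj; rewrite /= back_permE.
have [Ia|nI] := boolP (I a).
  have [lt|le] := ltnP s (row a).
    rewrite p3 // back_fix ?lt //; apply/eqP => e.
    by have := row_C e; rewrite leqNgt lt.
  have [e1 e2] := p2 a (introT andP (conj le Ia)).
  by rewrite /back e1 e2.
rewrite p1 //; have [e|ne] := eqVneq (col a) C'; first by rewrite back_swap.
have nC : col a != C by apply: contra nI => /eqP e; rewrite /sources e leqnn.
have -> : swap a = a.
  by apply: val_inj; rewrite /= swapE /swap_cols (negPf nC) (negPf ne).
by rewrite back_fix // orbC /targets; move: nI ne nC; rewrite /sources; lia.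
Qed.

(** Up to [swap], it sends each source in R^s to its successor on the composite lines and fixes the
    sources below R_s. Its signature is the sign in [BS_pairing]. *)
Definition pred_perm := (back_perm^-1 * swap)%g.

Lemma swap_pred a : swap (pred_perm a) = (back_perm^-1)%g a.
Proof. by rewrite permM swapK. Qed.

Lemma pred_low a : low_sources a ->
  enters ((back_perm^-1)%g a) /\ g ((back_perm^-1)%g a) = a.
Proof.
case/andP=> hr Ia; have hx : exits ns s C C' a by rewrite /exits ltn_ord hr [(_ <= _ < _)%N]Ia.
have [y hy e] := pairing_surj s_gt0 nb gP hx.
have hN : (y < n)%N by case/and3P: hy.
suff -> : (back_perm^-1)%g a = Ordinal hN by [].
apply: (@perm_inj _ back_perm); rewrite permKV; apply/val_inj.
by rewrite /= back_permE /back /= hy e.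
Qed.

Lemma pred_high a : I a -> (s < row a)%N -> (back_perm^-1)%g a = a.
Proof.
move=> Ia lt; apply: (@perm_inj _ back_perm); rewrite permKV; apply/val_inj.
rewrite /= back_permE back_fix ?lt //; apply/eqP => e.
by have := row_C e; rewrite leqNgt lt.
Qed.

Lemma pred_out a : ~~ I a -> pred_perm a = a.
Proof.
move=> nI; apply: (@perm_inj _ swap); rewrite swap_pred.
apply: (@perm_inj _ back_perm); rewrite permKV; apply/val_inj.
rewrite /= back_permE; have [e|ne] := eqVneq (col a) C'; first by rewrite back_swap.
have nC : col a != C by apply: contra nI => /eqP e; rewrite /sources e leqnn.
have -> : swap a = a.
  by apply: val_inj; rewrite /= swapE /swap_cols (negPf nC) (negPf ne).
by rewrite back_fix // orbC /targets; move: nI ne nC; rewrite /sources; lia.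
Qed.

Lemma pred_fix a : I a -> (swap (pred_perm a) == a) = (s < row a)%N.
Proof.
move=> Ia; rewrite swap_pred; have [lt|le] := ltnP s (row a).
  by rewrite pred_high ?eqxx.
have [e1 e2] := pred_low (introT andP (conj le Ia)).
apply/eqP => e; have := pairing_key_lt s_gt0 nb gP e1.
by rewrite e2 e ltnn.
Qed.

Lemma pred_contributes : contributes pred_perm.
Proof.
apply/andP; split.
  by apply/forallP => a; apply/implyP => nI; rewrite pred_out.
apply/eqP/eq_card => a; rewrite !inE; case Ia : (I a) => /=.
  rewrite pred_fix //; case: ltnP => lt; rewrite ?andbF ?andbT //.
  move: Ia; rewrite /sources => /andP[h1 ->]; rewrite ltn_neqAle h1 !andbT.
  by apply/esym/eqP => e; have := row_C (esym e); rewrite leqNgt lt.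
by move: Ia; rewrite /sources; lia.
Qed.

(** By counting, sources in R^s are sent onto the targets in R^s, and the sources below are fixed.
    The latter use up all the fixed points that a contributing permutation may have, so sources in
    R^s move along lines of the diagram, and the greedy argument on keys identifies the moves with
    [g]. *)
Lemma contributes_unique x p : upper x ->
  (forall a b, x a b != 0 -> ((a : nat), (b : nat)) \in lines D) ->
  contributes p -> (forall a, I a -> swap (p a) != a -> x a (swap (p a)) != 0) ->
  p = pred_perm.
Proof.
move=> ux sx /andP[/forallP hp /eqP hcard] nz.
have p1 a : ~~ I a -> p a = a by move=> nI; apply/eqP/(implyP (hp a)).
pose r := (p * swap)%g; have rE a : r a = swap (p a) by rewrite permM.
have rI a : I a -> J (r a).
  move=> Ia; rewrite rE swap_targets; apply: contraTT Ia => nI.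
  by rewrite -(perm_inj (p1 _ nI)).
have r2 a : I a -> r a != a ->
    [/\ (col a < col (r a))%N, ((a : nat), (r a : nat)) \in lines D &
        (row a <= s)%N -> (row (r a) <= s)%N].
  move=> Ia; rewrite rE => na; have nx := nz _ Ia na; have hl := sx _ _ nx.
  split=> //; first by rewrite ltnNge; apply: contra nx => le; rewrite ux.
  move=> hr; have [|_ _ _ //] := pair_box gP hl.
  rewrite /reg /= hr; have := rI _ Ia; rewrite rE.
  by move: Ia; rewrite /sources /targets; lia.
pose Is := [set a : 'I_n | low_sources a].
pose Js := [set b : 'I_n | (row b <= s)%N && J b].
have eIJ : [set r a | a in Is] = Js.
  apply/eqP; rewrite eqEcard; apply/andP; split.
    apply/fintype.subsetP => b /imsetP[a ha ->].
    move: ha; rewrite !inE => /andP[hr Ia]; rewrite rI // andbT.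
    by have [->//|ne] := eqVneq (r a) a; have [_ _ ->] := r2 a Ia ne.
  rewrite card_imset; last exact: perm_inj.
  rewrite -(@card_imset _ _ swap Js); last exact: perm_inj.
  apply: subset_leq_card; apply/fintype.subsetP => b /imsetP[a ha ->].
  move: ha; rewrite !inE /low_sources => /andP[hr Ja].
  by rewrite swap_sources Ja swapE (swap_row s_gt0 nb) hr.
(* From right to left: if a box below R_s moved, its image would again be below R_s by [eIJ] and so
   already known to be fixed, against injectivity. *)
have p3 a : I a -> (s < row a)%N -> r a = a.
  have [m] := ubnP (C' - col a); elim: m a => // m IH a hm Ia lt.
  apply/eqP; apply: contraT => ne; have [r3 r4 _] := r2 a Ia ne.
  have hr : (s < row (r a))%N.
    rewrite ltnNge; apply/negP => le.
    have : r a \in Js by rewrite inE le rI.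
    rewrite -eIJ => /imsetP[a' ha' /perm_inj e]; move: ha'; rewrite -e inE.
    by case/andP; rewrite leqNgt lt.
  have Ira : I (r a).
    have := rI _ Ia; rewrite /targets /sources => /andP[h1 h2].
    rewrite (ltnW h1) ltn_neqAle h2 andbT; apply/eqP => e.
    by have := row_C' e; rewrite leqNgt hr.
  have := IH (r a) _ Ira hr; have := rI _ Ia; rewrite /targets => hj.
  have lt2 : (C' - col (r a) < m)%N by lia.
  by move=> /(_ lt2) /perm_inj e; rewrite e eqxx in ne.
have nfix a : low_sources a -> r a != a.
  move=> /andP[hr Ia]; apply/negP => fa.
  have sub : [set a : 'I_n | (C < col a < C')%N && (s < row a)%N] \subset
      [set a : 'I_n | I a && (swap (p a) == a)].
    apply/fintype.subsetP => b; rewrite !inE => /andP[hb hr'].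
    have Ib : I b by rewrite /sources; lia.
    by rewrite Ib -rE p3 // eqxx.
  have : a \in [set a : 'I_n | (C < col a < C')%N && (s < row a)%N].
    have /eqP -> : [set a : 'I_n | (C < col a < C')%N && (s < row a)%N] ==
        [set a : 'I_n | I a && (swap (p a) == a)] by rewrite eqEcard sub hcard leqnn.
    by rewrite inE Ia -rE fa.
  by rewrite inE [(s < _)%N]ltnNge hr andbF.
apply: pred_perm_unique => // [a|a Ia lt]; last by rewrite -rE p3.
(* If [g] gives the image of [a] another start, that start has a smaller key and, by induction, is
   already sent to the same box. *)
rewrite -rE; have [m] := ubnP (key a); elim: m a => // m IH a hm la.
have /andP[hr Ia] := la; have [r3 r4 r5] := r2 a Ia (nfix a la).
have ey : enters (r a).
  by rewrite /enters ltn_ord r5 //; have := rI _ Ia; rewrite /targets.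
split=> //; have hreg : reg ns s C C' ((a : nat), (r a : nat)).
  rewrite /reg /= hr; have := rI _ Ia; move: Ia; rewrite /sources /targets; lia.
have hk := pair_min gP r4 hreg.
have [e1 _ _ _] := pairing_exits s_gt0 nb gP ey.
have [//|ne] := eqVneq (g (r a)) a.
case/and3P: (e1) => gN gr gc; pose a' := Ordinal gN.
have la' : low_sources a' by rewrite /low_sources gr.
have lt : (key a' < key a)%N.
  rewrite ltn_neqAle hk andbT; apply: contra ne => /eqP e; apply/eqP.
  by apply: (key_inj (ltn_ord a') (ltn_ord a) e).
have [|i1 i2] := IH a' _ la'; first by lia.
have := pairing_inj gP i1 ey i2 => /val_inj /perm_inj e.
by rewrite -e ltnn in lt.
Qed.

(** Only the term of [pred_perm] survives; along it all coordinates are 1 except that of the line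
    labelled 0 into the bottom box of [C']. *)
Lemma BS_pairing : exists (b : bool) (z : 'I_n) (y : 'I_n),
  [/\ y = box C' s :> nat, ((z : nat), (y : nat)) \in lines0 D &
  forall x : 'M[K]_n, upper x ->
    (forall a b, x a b != 0 -> ((a : nat), (b : nat)) \in lines D) ->
    (forall a b : 'I_n, ((a : nat), (b : nat)) \in lines D ->
       ((a : nat), (b : nat)) \notin lines0 D -> x a b = 1) ->
    BS x = (-1) ^+ b * x z y].
Proof.
have hin : inbox ns C' s by rewrite /inbox s_gt0 hC' leqnn.
pose y := Ordinal (box_lt hin).
have ey : enters y by rewrite /enters /= box_lt // row_box // col_box // !leqnn ltC.
have [e1 _ _ e4] := pairing_exits s_gt0 nb gP ey.
case/and3P: (e1) => gN gr gc; pose z := Ordinal gN.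
exists (odd_perm pred_perm), z, y; split=> //; first by rewrite [_ \in _]e4 /= eqxx.
move=> x ux sx hx; rewrite /BS (bigD1 pred_perm) ?pred_contributes //=.
rewrite [X in _ + X]big1 ?addr0; last first.
  move=> p /andP[cp ne].
  have [/existsP[a /andP[/andP[Ia na] /eqP xa]]|no] :=
    boolP [exists a, (I a && (swap (p a) != a)) && (x a (swap (p a)) == 0)].
    by rewrite (bigD1 a) ?Ia //= xa mul0r mulr0.
  case/eqP: ne; apply: contributes_unique ux sx cp _ => a Ia na.
  by apply: contra no => xa; apply/existsP; exists a; rewrite Ia na xa.
congr (_ * _).
have lz : low_sources z by rewrite /low_sources gr.
have [z1 z2] := pred_low lz.
have ez : swap (pred_perm z) = y.
  by rewrite swap_pred; apply/val_inj/(pairing_inj gP z1 ey); rewrite z2.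
have hz : I z && (swap (pred_perm z) != z).
  by rewrite [I z](andP lz).2 pred_fix ?(andP lz).2 // -leqNgt.
rewrite (bigD1 z) //= ez big1 ?mulr1 // => a /andP[/andP[Ia na] ne].
have la : low_sources a by rewrite /low_sources Ia andbT leqNgt -pred_fix.
rewrite swap_pred; have [a1 a2] := pred_low la.
have [_ _ a3 a4] := pairing_exits s_gt0 nb gP a1.
rewrite a2 in a3 a4; apply: hx => //; rewrite a4; apply: contra ne => /eqP e.
by apply/eqP/val_inj; rewrite /= -a2 e.
Qed.
End Evaluation.

Section Semi.
Variables (K : numFieldType) (ns : seq nat).
Local Notation n := (sumn ns).
Local Notation h := (height ns).
Local Notation col := (Defs.col ns).
Local Notation row := (Defs.row ns).
Local Notation box := (Defs.box ns).
Local Notation upper := (@upper K ns).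
Local Notation blk := (@blk K ns).
Local Notation chi := (@chi K ns).
Local Notation dg := (@dg K ns).
Local Notation lastbox := (@lastbox ns).
Local Notation xR := (richardson K ns).
Hypothesis ns_pos : forall k, (k < size ns)%N -> (0 < h k)%N.

Definition band lo hi (a : 'I_n) := (lo <= col a < hi)%N.

Lemma cut_bandM lo hi (X Y : 'M[K]_n) : blk X -> blk Y ->
  cut (band lo hi) X *m cut (band lo hi) Y = cut (band lo hi) (X *m Y).
Proof.
move=> hX hY; apply: cut_mul => a b Pa Pb; rewrite mxE [RHS]big_mkcond /=.
apply: eq_bigr => c _; case: ifP => // nP.
have [lt|le] := ltnP (col c) (col a); first by rewrite hX // mul0r.
rewrite hY ?mulr0 //; move: nP Pa Pb; rewrite /band; lia.
Qed.

Lemma cut_blk (P : pred 'I_n) (X : 'M[K]_n) : blk X -> blk (cut P X).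
Proof.
move=> hX i j hij; rewrite mxE hX //; case: ifP => // _.
by case: eqP hij => // ->; rewrite ltnn.
Qed.

Lemma cut1 (P : pred 'I_n) : cut P 1%:M = 1%:M :> 'M[K]_n.
Proof. by apply/matrixP => a b; rewrite !mxE if_same. Qed.

Lemma chi_cut lo hi k (X : 'M[K]_n) :
  chi k (cut (band lo hi) X) = if (lo <= k < hi)%N then chi k X else 1.
Proof.
case: ifP => hk.
  congr (\det _); apply/matrixP => a b; rewrite !mxE /band.
  by case: ifP => // /andP[/eqP-> /eqP->]; rewrite hk.
rewrite -[RHS](chi1 K ns k); congr (\det _); apply/matrixP => a b; rewrite !mxE /band.
by case: ifP => // /andP[/eqP-> /eqP->]; rewrite hk.
Qed.

Lemma det_cut_dg P d : \det (cut P (dg d)) = \prod_(a | P a && lastbox a) d (col a).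
Proof.
have -> : cut P (dg d) = diag_mx (\row_a if P a && lastbox a then d (col a) else 1).
  apply/matrixP => a b; rewrite !mxE; case: (eqVneq a b) => [<-|_]; last first.
    by rewrite !mulr0n if_same.
  by rewrite andbb !mulr1n; case: (P a).
by rewrite det_diag [RHS]big_mkcond; apply: eq_bigr => a _; rewrite mxE.
Qed.

Section Group.
Variable G : set 'M[K]_n.
Hypothesis G_grp : connected_algebraic_subgroup_SL G.
Hypothesis G_lie : lie_algebra G = derived_algebra (parabolic K ns).

(** The truncation of [g] to consecutive columns is again block triangular with block determinants
    1, so it lies in [G]. *)
Lemma det_cut_G lo hi g : G g -> \det (cut (band lo hi) g) = 1.
Proof.
move=> Gg; have [gb gu gc] := (G_char G_grp G_lie ns_pos g).1 Gg.
apply: (cas_SL G_grp); apply/(G_char G_grp G_lie ns_pos); split.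
- exact: cut_blk.
- have /mulmx1_unit[] // : cut (band lo hi) g *m cut (band lo hi) (invmx g) = 1%:M.
  by rewrite cut_bandM ?mulmxV ?cut1 //; apply: blk_inv.
by move=> k hk; rewrite chi_cut gc // if_same.
Qed.

Variables (s C C' : nat).
Hypothesis s_gt0 : (0 < s)%N.
Hypothesis nb : neighbouring ns s C C'.
Local Notation BS := (@BS K ns s C C' s_gt0 nb).

Lemma BS_G g x : G g -> upper x -> BS (g *m x *m invmx g) = BS x.
Proof.
move=> Gg ux; have [gb gu gc] := (G_char G_grp G_lie ns_pos g).1 Gg.
rewrite BS_semi ?mulmxV //; last exact: blk_inv.
rewrite [\det _](det_cut_G C C' Gg) mul1r.
by rewrite [X in _ * X](det_cut_G C.+1 C'.+1 (cas_V G_grp Gg)) mulr1.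
Qed.
End Group.

Section Torus.
Variables (s C C' : nat).
Hypothesis s_gt0 : (0 < s)%N.
Hypothesis nb : neighbouring ns s C C'.
Local Notation BS := (@BS K ns s C C' s_gt0 nb).

Lemma dg_mul_inv (d : nat -> K) : (forall k, (k < size ns)%N -> d k != 0) ->
  dg d *m dg (fun k => (d k)^-1) = 1%:M.
Proof.
move=> nz; rewrite -dgM -(dg1 K ns); congr diag_mx; apply/rowP => a; rewrite !mxE.
by case: ifP => // _; rewrite divff // nz // col_lt.
Qed.

(** The left factor contributes the coordinates of the columns from [C] on and before [C'], the
    right factor the inverses of those after [C] up to [C']; only the two extreme columns fail to
    cancel. *)
Lemma BS_dg (d : nat -> K) x : (forall k, (k < size ns)%N -> d k != 0) -> upper x ->
  BS (dg d *m x *m dg (fun k => (d k)^-1)) = d C / d C' * BS x.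
Proof.
move=> nz ux; have [h1 h2 _ _ _] := nb_facts s_gt0 nb.
rewrite BS_semi ?dg_mul_inv //; try exact: dg_blk.
rewrite mulrAC; congr (_ * _); rewrite !det_cut_dg.
have [a la ea] := bottom ns_pos (ltn_trans h1 h2).
have [b lb eb] := bottom ns_pos h2.
rewrite (bigD1 a) /=; last by rewrite la /sources ea leqnn h1.
rewrite [X in _ * X](bigD1 b) /=; last by rewrite lb /targets eb leqnn h1.
rewrite ea eb mulrACA -[RHS]mulr1; congr (_ * _).
rewrite (eq_bigl (fun i : 'I_n => [&& (C < col i < C')%N & lastbox i])); last first.
  move=> i; rewrite /sources; case li : (lastbox i); rewrite ?andbF //= !andbT.
  case: (eqVneq i a) => [->|ne]; first by rewrite ea ltnn andbF.
  rewrite andbT; have : col i != C; last by lia.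
  by apply: contra ne => /eqP e; apply/eqP/lastbox_uniq; rewrite // e.
rewrite [X in _ * X](eq_bigl (fun i : 'I_n => [&& (C < col i < C')%N & lastbox i])); last first.
  move=> i; rewrite /targets; case li : (lastbox i); rewrite ?andbF //= !andbT.
  case: (eqVneq i b) => [->|ne]; first by rewrite eb ltnn !andbF.
  rewrite andbT; have : col i != C'; last by lia.
  by apply: contra ne => /eqP e; apply/eqP/lastbox_uniq; rewrite // e.
by rewrite -big_split big1 // => i _ /=; rewrite divff // nz // col_lt.
Qed.

Lemma pf_BS : polynomial_function (BS : 'M[K]_n -> K).
Proof.
apply: pf_sum => p; apply: pf_mul; first exact: pf_const.
by apply: pf_prod => a; apply: pf_entry.
Qed.

(* In [richardson] every line of the tableau is horizontal and has coefficient
   1; only the label 0 of the last line of [R_s] matters here. *)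
Lemma BS_richardson : exists b : bool, BS xR = (-1) ^+ b.
Proof.
have [h1 h2 h3 h4 h5] := nb_facts s_gt0 nb.
have hin : inbox ns C' s by rewrite /inbox s_gt0 h4 leqnn.
pose l0 := (lnbr ns (box C' s), box C' s).
pose D := Diagram [seq l <- horizontal_lines ns | l != l0] [:: l0] [::].
have hl0 : hasl ns (box C' s).
  by apply/haslP; exists C; rewrite ?col_box ?row_box // h3.
have mD x y : (x, y) \in lines D -> [/\ (x < n)%N, (y < n)%N, hasl ns y & x = lnbr ns y].
  rewrite mem_cat mem_filter mem_horizontal mem_seq1 => /orP[/andP[_]|/eqP[-> ->]].
    by case/and4P=> ? ? ? /eqP.
  by have [l1 _ _ _ _] := lnbrP hl0; split=> //; apply: box_lt.
have Dm y : (y < n)%N -> hasl ns y -> (lnbr ns y, y) \in lines D.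
  move=> hy hh; rewrite mem_cat mem_filter mem_horizontal mem_seq1 hy hh eqxx.
  by have [-> _ _ _ _] := lnbrP hh; rewrite !andbT orNb.
have gP : pairing ns D s C C' (lnbr ns).
  split.
  - move=> x y /mD[hx hy hh ->] /and3P[/= r1 _ _]; have [_ l2 l3 _ _] := lnbrP hh.
    by rewrite -l3; split=> //; have [] := lnbrP hh.
  - move=> y hy hr hc; have hh : hasl ns y.
      by apply/haslP; exists C; rewrite ?h3 //; case/andP: hc.
    have [l1 l2 l3 l4 l5] := lnbrP hh; rewrite l3 Dm //; split=> //.
      rewrite leqNgt; apply/negP => lt.
      by have := l5 C; rewrite lt h3; case/andP: hc => -> _ /(_ isT); rewrite ltnNge hr.
    by rewrite mem_seq1 /l0 xpair_eqE andbC; case: (eqVneq y) => // ->; rewrite eqxx.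
  - move=> y y' hy hy' hr hr' hc hc'; apply: lnbr_inj => //.
      by apply/haslP; exists C; rewrite ?h3 //; case/andP: hc.
    by apply/haslP; exists C; rewrite ?h3 //; case/andP: hc'.
  - by move=> x y /mD[_ _ _ ->].
  by move=> l; rewrite mem_seq1 => /eqP -> _; rewrite mem_filter eqxx.
have [b [z [y [ey hz H]]]] := BS_pairing K s_gt0 nb gP; exists b.
have xRE (i j : 'I_n) : ((i : nat), (j : nat)) \in lines D -> xR i j = 1.
  by move=> /mD[_ _ hh e]; rewrite mxE hh e eqxx.
rewrite H; first by rewrite xRE ?mulr1 // lines0_lines.
- exact: upper_xR.
- move=> i j; rewrite mxE; case: (boolP (hasl ns j)) => [hh|]; last by rewrite eqxx.
  by have [e _|ne] := (i : nat) =P lnbr ns j; [rewrite e; apply: Dm|rewrite /= eqxx].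
by move=> i j /xRE.
Qed.
End Torus.
End Semi.

(** * The section *)

Section Orbit.
Variables (K : numFieldType) (ns : seq nat).
Local Notation n := (sumn ns).
Local Notation r := (size ns).
Local Notation h := (height ns).
Local Notation col := (Defs.col ns).
Local Notation row := (Defs.row ns).
Local Notation box := (Defs.box ns).
Local Notation upper := (@upper K ns).
Local Notation blk := (@blk K ns).
Local Notation chi := (@chi K ns).
Local Notation dg := (@dg K ns).
Local Notation lastbox := (@lastbox ns).
Local Notation nonfirst := (nonfirst ns).
Local Notation xR := (richardson K ns).
Hypothesis ns_pos : forall k, (k < size ns)%N -> (0 < h k)%N.
Variable G : set 'M[K]_n.
Hypothesis G_grp : connected_algebraic_subgroup_SL G.
Hypothesis G_lie : lie_algebra G = derived_algebra (parabolic K ns).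

Local Notation inv d := (fun k => (d k)^-1).

(** The entries telescope down each column. So a diagonal matrix depending on the row only has block
    determinants depending on the height only, and these can be prescribed. *)
Lemma chi_row_torus (P : nat -> K) k : (forall i, P i != 0) -> P 0%N = 1 ->
  chi k (diag_mx (\row_a (P (row a) / P (row a).-1))) = P (h k).
Proof.
move=> nz P0; rewrite chi_diag.
suff H m : (m <= h k)%N ->
    \prod_(a < n | (col a == k) && (row a <= m)%N) (P (row a) / P (row a).-1) = P m.
  rewrite -[RHS](H (h k)) //; apply: eq_big => [a|a _]; last by rewrite mxE.
  by case: eqP => //= <-; rewrite row_le.
elim: m => [|m IH] hm; first by rewrite big1 // => a; rewrite leqn0 andbF.
have hin : inbox ns k m.+1 by rewrite /inbox hm.
pose b := Ordinal (box_lt hin).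
have rb : row b = m.+1 by rewrite row_box.
rewrite (bigD1 b); last by rewrite rb col_box // eqxx leqnn.
rewrite rb [m.+1.-1]/= (eq_bigl (fun a : 'I_n => (col a == k) && (row a <= m)%N)).
  by rewrite (IH (ltnW hm)) [LHS]divfK.
move=> a; case: (col a =P k) => //= e.
have [->|ne] := eqVneq a b; first by rewrite rb andbF ltnn.
rewrite andbT; apply/idP/idP; last by lia.
move=> le; have : row a != m.+1; last by lia.
apply: contra ne => /eqP er; apply/eqP/val_inj/(@eq_box ns) => /=.
  by rewrite col_box.
by rewrite row_box.
Qed.

Lemma index_first k : (k < r)%N -> ~~ nonfirst k -> index (h k) ns = k.
Proof.
move=> hk nf; have hm : h k \in ns by apply: mem_nth.
have [lt|gt|//] := ltngtP (index (h k) ns) k.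
  by case/existsP: nf; exists (Ordinal lt); rewrite /= /height nth_index.
by have := before_find 0%N gt; rewrite /= eqxx.
Qed.

Lemma dg_unit (d : nat -> K) : (forall k, d k != 0) -> dg d \in unitmx.
Proof. by move=> nz; have /mulmx1_unit[] := @dg_mul_inv K ns d (fun k _ => nz k). Qed.

Lemma invmx_dg (d : nat -> K) : (forall k, d k != 0) -> invmx (dg d) = dg (inv d).
Proof.
move=> nz; have e := @dg_mul_inv K ns d (fun k _ => nz k).
by rewrite -[LHS]mulmx1 -e mulmxA mulVmx ?mul1mx // dg_unit.
Qed.

(** The matrix [t] depends on the row only, so it commutes with [x_R]. It is chosen to make the
    block determinant of [p t] equal to 1 at the first column of each height. What remains is one
    coordinate per pair of neighbouring columns, as many as there are invariants; dividing by it
    leaves an element of [G]. *)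
Lemma orbit_torus p : blk p -> p \in unitmx -> exists g d,
  [/\ G g, forall k, d k != 0, forall k, ~~ ((k < r)%N && nonfirst k) -> d k = 1 &
      p *m xR *m invmx p = g *m (dg d *m xR *m dg (inv d)) *m invmx g].
Proof.
move=> pb pu.
have chi_nz g k : blk g -> g \in unitmx -> chi k g != 0.
  move=> gb gu; have := chiV k gb gu; apply: contra_eqN => /eqP ->.
  by rewrite mul0r eq_sym oner_eq0.
(* [index i ns] is the first column of height [i]. *)
pose P i := if i \in ns then (chi (index i ns) p)^-1 else 1.
have Pnz i : P i != 0.
  by rewrite /P; case: ifP; rewrite ?oner_eq0 // invr_eq0 chi_nz.
have P0 : P 0%N = 1.
  rewrite /P; case: ifP => // h0; have := ns_pos (k := index 0%N ns).
  by rewrite index_mem h0 /height nth_index // => /(_ isT).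
pose t : 'M[K]_n := diag_mx (\row_a (P (row a) / P (row a).-1)).
have tb : blk t by move=> i j hij; rewrite mxE; case: eqP hij => [->|]; rewrite ?ltnn.
have tu : t \in unitmx.
  rewrite unitmxE unitfE det_diag; apply/prodf_neq0 => a _; rewrite mxE.
  by rewrite mulf_neq0 ?invr_eq0.
have txR : t *m xR = xR *m t.
  apply/matrixP => i j; rewrite mul_diag_mx mul_mx_diag !mxE mulrC.
  case: (boolP (hasl ns j)) => hj; last by rewrite !mul0r.
  case: eqP => e; last by rewrite !mul0r.
  by have [_ _ + _ _] := lnbrP hj; rewrite -e => ->.
pose a := p *m t; have ab : blk a by apply: blkM.
have au : a \in unitmx by rewrite unitmx_mul pu.
pose d k := if (k < r)%N then chi k a else 1.
have dnz k : d k != 0 by rewrite /d; case: ifP; rewrite ?oner_eq0 // => _; apply: chi_nz.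
have inz k : (d k)^-1 != 0 by rewrite invr_eq0.
pose g := a *m dg (inv d).
have eg : g *m dg d = a.
  rewrite -mulmxA -[dg d](_ : dg (fun k => (d k)^-1^-1) = _).
    by rewrite dg_mul_inv ?mulmx1.
  by congr (dg _); apply: funext => k; rewrite invrK.
have gb : blk g by apply: blkM => //; apply: dg_blk.
have gu : g \in unitmx by rewrite unitmx_mul au dg_unit.
exists g, d; split=> //.
- apply/(G_char G_grp G_lie ns_pos); split=> // k hk.
  rewrite chiM //; last exact: dg_blk.
  by rewrite chi_dg // /d hk divff // chi_nz.
- move=> k; rewrite /d; case: ifP => //= hk nf.
  rewrite chiM // chi_row_torus // /P mem_nth // index_first // mulfV //.
  exact: chi_nz.
have eD : dg (inv d) *m dg d = 1%:M by rewrite -invmx_dg // mulVmx // dg_unit.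
have e1 : p *m xR *m invmx p *m a = a *m xR.
  by rewrite /a mulmxA mulmxKV // -!mulmxA txR.
have e2 : g *m (dg d *m xR *m dg (inv d)) *m invmx g *m (g *m dg d) = g *m dg d *m xR.
  move: (g) gu => g1 gu1.
  by rewrite mulmxA mulmxKV // -!mulmxA eD mulmx1.
by apply: (can_inj (mulmxK au)); rewrite e1 -{1}eg -e2 eg.
Qed.

Definition torus_point (d : nat -> K) : mspace K ns :=
  vsproj (nilradical K ns) (dg d *m xR *m dg (inv d)).

(* [Q] is a polynomial; all we need is that it preserves polynomial functions. *)
Lemma laurent (f : mspace K ns -> K) : polynomial_function f -> exists N (Q : (nat -> K) -> K),
  (forall P : nat -> mspace K ns -> K, (forall k, polynomial_function (P k)) ->
     polynomial_function (fun x => Q (fun k => P k x))) /\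
  forall d, (forall k, d k != 0) ->
    f (torus_point d) * (\prod_(k < r) (d k)^-1) ^+ N = Q (inv d).
Proof.
move: f; apply: pf_ind => [c|l|f g [N1 [Q1 [p1 e1]]] [N2 [Q2 [p2 e2]]]|
    f g [N1 [Q1 [p1 e1]]] [N2 [Q2 [p2 e2]]]].
- exists 0%N, (fun=> c); split=> [P _|d _]; first exact: pf_const.
  by rewrite expr0 mulr1.
(* A coordinate of [d] to the left of [x_R], multiplied by the product of all inverses, becomes the
   product of the other inverses; so [N = 1] does for a linear form. *)
- pose U (a : 'I_n) (w : nat -> K) := if lastbox a then
    \prod_(k < r | (k : nat) != col a) w k else \prod_(k < r) w k.
  pose V (b : 'I_n) (w : nat -> K) := if lastbox b then w (col b) else 1.
  exists 1%N, (fun w => \sum_a \sum_b U a w * (xR a b * V b w) *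
    l (vsproj (nilradical K ns) (delta_mx a b))); split=> [P hP|d nz].
    apply: pf_sum => a; apply: pf_sum => b; apply: pf_mul; last exact: pf_const.
    apply: pf_mul; first by rewrite /U; case: (lastbox a); apply: pf_prod.
    apply: pf_mul; first exact: pf_const.
    by rewrite /V; case: (lastbox b); [exact: hP|exact: pf_const].
  rewrite /torus_point [X in vsproj _ X](matrix_sum_delta (dg d *m xR *m dg (inv d))).
  rewrite !linear_sum /= mulr_suml; apply: eq_bigr => a _.
  rewrite !linear_sum /= mulr_suml; apply: eq_bigr => b _.
  rewrite !linearZ /= mulrAC; congr (_ * _).
  have -> : (dg d *m xR *m dg (inv d)) a b = (if lastbox a then d (col a) else 1) *
      (xR a b * V b (inv d)).
    by rewrite mul_mx_diag mxE mul_diag_mx [X in X * _]mxE [X in _ * X]mxE [X in X * _ * _]mxE mulrA.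
  rewrite expr1 mulrAC; congr (_ * _); rewrite /U; case: ifP => _; last by rewrite mul1r.
  rewrite (bigD1 (Ordinal (col_lt (ltn_ord a)))) //= mulrA divff // mul1r.
  by apply: eq_bigl => k; rewrite -val_eqE.
- exists (N1 + N2)%N, (fun w => Q1 w * (\prod_(k < r) w k) ^+ N2 +
    Q2 w * (\prod_(k < r) w k) ^+ N1); split=> [P hP|d nz].
    apply: pf_add; apply: pf_mul; [exact: p1| |exact: p2|];
    by apply: pf_exp; apply: pf_prod.
  by rewrite -e1 // -e2 // mulrDl exprD; congr (_ + _); rewrite -!mulrA // [X in _ * X]mulrC.
exists (N1 + N2)%N, (fun w => Q1 w * Q2 w); split=> [P hP|d nz].
  by apply: pf_mul; [exact: p1|exact: p2].
by rewrite -e1 // -e2 // exprD mulrACA.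
Qed.
End Orbit.

Section Assembly.
Variables (K : numFieldType) (ns : seq nat).
Local Notation n := (sumn ns).
Local Notation r := (size ns).
Local Notation h := (height ns).
Local Notation col := (Defs.col ns).
Local Notation row := (Defs.row ns).
Local Notation box := (Defs.box ns).
Local Notation upper := (@upper K ns).
Local Notation blk := (@blk K ns).
Local Notation chi := (@chi K ns).
Local Notation dg := (@dg K ns).
Local Notation nonfirst := (nonfirst ns).
Local Notation prevcol := (prevcol ns).
Local Notation xR := (richardson K ns).
Hypothesis ns_all : all (fun k => 0 < k)%N ns.
Variable G : set 'M[K]_n.
Hypothesis G_grp : connected_algebraic_subgroup_SL G.
Hypothesis G_lie : lie_algebra G = derived_algebra (parabolic K ns).
Let ns_pos := ns_height_gt0 ns_all.
Local Notation vinv d := (fun k => (d k)^-1).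
Local Notation D := (final_diagram ns).
Local Notation L0 a b := (((a : 'I_n) : nat, (b : 'I_n) : nat) \in lines0 D).
Local Notation L1 a b := (((a : 'I_n) : nat, (b : 'I_n) : nat) \in lines1 D).

Lemma upper_dg (d : nat -> K) : upper (dg d *m xR *m dg (vinv d)).
Proof.
apply: upper_mul_blk; last exact: dg_blk.
by apply: blk_mul_upper; [exact: upper_xR|exact: dg_blk].
Qed.

Definition in_section (x : mspace K ns) :=
  forall a b : 'I_n, ~~ L0 a b -> vsval x a b = (L1 a b)%:R.

Lemma final_inv : exists f, inv ns (foldr maxn 0 ns)%N D f.
Proof. by have [] := final_pairing ns_pos. Qed.

Lemma final_lt (a b : 'I_n) : ((a : nat), (b : nat)) \in lines D -> (col a < col b)%N.
Proof. by have [f I] := final_inv => /(inv_box I)[]. Qed.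

Lemma final_lab (a b : 'I_n) : L0 a b -> ~~ L1 a b.
Proof. by have [f I] := final_inv => /(inv_lab I). Qed.

Lemma vsval_e : forall a b, vsval (e_of K ns D) a b = (L1 a b)%:R.
Proof.
move=> a b; pose M : 'M[K]_n := \sum_(i < n) \sum_(j < n | L1 i j) delta_mx i j.
have eM i j : M i j = (L1 i j)%:R.
  rewrite summxE (bigD1 i) //= [X in _ + X]big1 ?addr0 => [|k nk]; last first.
    by rewrite summxE big1 // => l _; rewrite mxE eq_sym (negPf nk).
  rewrite summxE; case l1 : (L1 i j).
    rewrite (bigD1 j) //= mxE !eqxx big1 ?addr0 // => l /andP[_ nl].
    by rewrite mxE [j == l]eq_sym (negPf nl) andbF.
  rewrite big1 // => l hl; rewrite mxE eqxx; case: eqP hl => // <-.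
  by rewrite l1.
rewrite -eM /e_of vsprojKE // => i j hij; rewrite eM.
case: (boolP (L1 i j)) => // /lines1_lines /final_lt; lia.
Qed.

Lemma sectionP x : (x - e_of K ns D \in V_of K ns D) <-> in_section x.
Proof.
pose P (i j : 'I_n) := L0 i j.
have Pup (i j : 'I_n) : P i j -> (col i < col j)%N by move/lines0_lines/final_lt.
have -> : (x - e_of K ns D \in V_of K ns D) <-> vsval (x - e_of K ns D) \in span_units K P.
  split=> [/memv_imgP[u hu ->]|hx].
    rewrite lfunE /= vsprojKE // => i j hij; move/mem_span_units: hu; apply.
    by apply/negP => /Pup; lia.
  apply/memv_imgP; exists (vsval (x - e_of K ns D)) => //.
  by rewrite lfunE [RHS]vsvalK.
rewrite mem_span_units; split=> H a b nab; have := H a b nab; rewrite linearB /= !mxE vsval_e.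
  by move/eqP; rewrite subr_eq0 => /eqP.
by move=> ->; rewrite subrr.
Qed.

Definition nf := {q : 'I_r | nonfirst q}.

(** All that is used of the invariant attached to [q] and the preceding column of its height: the
    function, its sign [et] at [x_R], its sign [ep] on the section and the position of its
    coordinate there. Packing these hides the proofs on which [BS] depends, so that the invariants
    can be chosen for all [q] at once. *)
Definition basic (q : nf) (p : ('M[K]_n -> K) * (K * K) * ('I_n * 'I_n)) :=
  let: (F, (et, ep), (z, y)) := p in
  [/\ polynomial_function F, forall g x, G g -> upper x -> F (g *m x *m invmx g) = F x,
      forall (d : nat -> K) x, (forall k, d k != 0) -> upper x ->
        F (dg d *m x *m dg (vinv d)) = d (prevcol (sval q)) / d (sval q) * F x &
      [/\ F xR = et, et * et = 1, ep * ep = 1, y = box (sval q) (h (sval q)) :> nat &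
        L0 z y /\ forall x, in_section x -> F (vsval x) = ep * vsval x z y]].

Lemma basic_ex (q : nf) : exists p, basic q p.
Proof.
case: q => q hq; have s0 : (0 < h q)%N by apply: ns_pos.
have nb := nonfirst_neighbouring hq s0.
have [b eb] := BS_richardson K ns_pos s0 nb.
have [_ /(_ _ _ _ s0 nb)[g gP]] := final_pairing ns_pos.
have [c [z [y [ey hz H]]]] := BS_pairing K s0 nb gP.
exists (@BS K ns _ _ _ s0 nb, ((-1) ^+ b, (-1) ^+ c), (z, y)); split.
- exact: pf_BS.
- by move=> g' x Gg ux; apply: (BS_G ns_pos G_grp G_lie).
- by move=> d x nz ux; apply: BS_dg.
split=> //; try by rewrite -signr_addb addbb.
split=> // x hx; apply: H; first exact: upper_vsval.
  move=> i j; have [/lines0_lines //|n0] := boolP (L0 i j).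
  by rewrite hx //; case: (boolP (L1 i j)) => [/lines1_lines//|_]; rewrite eqxx.
move=> i j hl n0; rewrite hx //; move: hl; rewrite mem_cat (negPf n0) orbF.
by move=> ->.
Qed.

Section Data.
Variable p : nf -> ('M[K]_n -> K) * (K * K) * ('I_n * 'I_n).
Hypothesis pP : forall q, basic q (p q).
Let F q := (p q).1.1.
Let et q := (p q).1.2.1.
Let ep q := (p q).1.2.2.
Let z q := (p q).2.1.
Let y q := (p q).2.2.

Let F_pf q : polynomial_function (F q).
Proof. by have := pP q; rewrite /F; case: (p q) => [[? [? ?]] [? ?]] []. Qed.
Let F_G q g x : G g -> upper x -> F q (g *m x *m invmx g) = F q x.
Proof. by have := pP q; rewrite /F; case: (p q) => [[? [? ?]] [? ?]] [_ H _ _]; apply: H. Qed.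
Let F_dg q (d : nat -> K) x : (forall k, d k != 0) -> upper x ->
  F q (dg d *m x *m dg (vinv d)) = d (prevcol (sval q)) / d (sval q) * F q x.
Proof. by have := pP q; rewrite /F; case: (p q) => [[? [? ?]] [? ?]] [_ _ H _]; apply: H. Qed.
Let F_xR q : F q xR = et q.
Proof. by have := pP q; rewrite /F /et; case: (p q) => [[? [? ?]] [? ?]] [_ _ _ []]. Qed.
Let et2 q : et q * et q = 1.
Proof. by have := pP q; rewrite /et; case: (p q) => [[? [? ?]] [? ?]] [_ _ _ []]. Qed.
Let ep2 q : ep q * ep q = 1.
Proof. by have := pP q; rewrite /ep; case: (p q) => [[? [? ?]] [? ?]] [_ _ _ []]. Qed.
Let yE q : y q = box (sval q) (h (sval q)) :> nat.
Proof. by have := pP q; rewrite /y; case: (p q) => [[? [? ?]] [? ?]] [_ _ _ []]. Qed.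
Let zy0 q : L0 (z q) (y q).
Proof. by have := pP q; rewrite /y /z; case: (p q) => [[? [? ?]] [? ?]] [_ _ _ [_ _ _ _ []]]. Qed.
Let F_sec q x : in_section x -> F q (vsval x) = ep q * vsval x (z q) (y q).
Proof.
have := pP q; rewrite /y /z /F /ep.
by case: (p q) => [[? [? ?]] [? ?]] [_ _ _ [_ _ _ _ [_ H]]]; apply: H.
Qed.

Let y_col q : col (y q) = sval q.
Proof.
rewrite yE col_box // /inbox leqnn andbT; apply: ns_pos; exact: ltn_ord.
Qed.

Let y_inj q q' : y q = y q' -> q = q'.
Proof. by move=> e; apply/val_inj/val_inj; rewrite /= -!y_col e. Qed.

(** A line labelled 0 ends at the bottom box of a column that is not the first of its height, and no
    box is entered by two such lines; so the invariants account for all coordinates of the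
    section. *)
Let L0_nf a b : L0 a b -> exists q, a = z q /\ b = y q.
Proof.
move=> hab; have [f I] := final_inv; have [h1 h2 _] := inv_0 I hab.
pose q : nf := exist _ (Ordinal (col_lt (ltn_ord b))) h2.
have eb : b = y q by apply/val_inj; rewrite /= yE /= -h1 boxK.
exists q; split=> //; apply/val_inj; rewrite eb in hab.
exact: (inv_0u I hab (zy0 q)).
Qed.

(* The point of the section with the same invariants as [x]. *)
Definition section_point (x : mspace K ns) : mspace K ns :=
  e_of K ns D + \sum_q (ep q * F q (vsval x)) *:
    vsproj (nilradical K ns) (delta_mx (z q) (y q)).
Local Notation sec := section_point.

Let secE x a b : vsval (sec x) a b = (L1 a b)%:R +
  \sum_q ep q * F q (vsval x) * ((a == z q) && (b == y q))%:R.
Proof.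
rewrite /sec linearD linear_sum /= mxE vsval_e summxE; congr (_ + _).
apply: eq_bigr => q _; rewrite mxE vsprojKE ?mxE // => i j hij.
rewrite mxE; case: eqP => //= ei; case: eqP => // ej.
by have := final_lt (lines0_lines (zy0 q)); rewrite -ei -ej; lia.
Qed.

Let sec_in x : in_section (sec x).
Proof.
move=> a b nab; rewrite secE big1 ?addr0 // => q _.
case: (eqVneq a (z q)) => [ea|]; last by rewrite mulr0.
case: (eqVneq b (y q)) => [eb|]; last by rewrite mulr0.
by move: nab; rewrite ea eb zy0.
Qed.

Let sec_zy x q : vsval (sec x) (z q) (y q) = ep q * F q (vsval x).
Proof.
rewrite secE (negPf (final_lab (zy0 q))) add0r (bigD1 q) //= !eqxx mulr1 big1 ?addr0 //.
move=> q' ne; rewrite (_ : (y q == y q') = false) ?andbF ?mulr0 //.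
by apply: contraNF ne => /eqP/y_inj->.
Qed.

Let sec_F x q : F q (vsval (sec x)) = F q (vsval x).
Proof. by rewrite F_sec // sec_zy mulrA ep2 mul1r. Qed.

Let sec_id x : in_section x -> sec x = x.
Proof.
move=> hx; apply/val_inj/matrixP => a b; have [hab|nab] := boolP (L0 a b).
  have [q [-> ->]] := L0_nf hab; rewrite [LHS]sec_zy F_sec // mulrA ep2 mul1r //.
by rewrite [RHS]hx //; apply: sec_in.
Qed.

Let Fv_pf q : polynomial_function (fun x : mspace K ns => F q (vsval x)).
Proof. exact: (pf_comp_linear vsval (F_pf q)). Qed.

Let sec_pf f : polynomial_function f -> polynomial_function (fun x => f (sec x)).
Proof.
apply: pf_comp => l.
apply: (@pf_ext _ _ (fun x => l (e_of K ns D) + \sum_q (ep q * F q (vsval x)) *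
    l (vsproj (nilradical K ns) (delta_mx (z q) (y q))))).
  move=> x; rewrite /sec linearD linear_sum; congr (_ + _); apply: eq_bigr => q _.
  by rewrite linearZ.
apply: pf_add; first exact: pf_const.
apply: pf_sum => q; apply: pf_mul; last exact: pf_const.
by apply: pf_mul; [exact: pf_const|exact: Fv_pf].
Qed.

Let G_adj g x : G g -> vsval (adjoint K ns g x) = g *m vsval x *m invmx g.
Proof. by move=> Gg; have [gb gu _] := (G_char G_grp G_lie ns_pos g).1 Gg; apply: adjointE. Qed.

Let F_adj g x q : G g -> F q (vsval (adjoint K ns g x)) = F q (vsval x).
Proof. by move=> Gg; rewrite G_adj // F_G //; apply: upper_vsval. Qed.

Lemma section_surj f : polynomial_function f ->
  invariant_functions G (adjoint K ns) (fun x => f (sec x)) /\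
  forall x, in_section x -> f (sec x) = f x.
Proof.
move=> hf; split=> [|x hx]; last by rewrite sec_id.
split; first exact: sec_pf.
move=> g Gg x; congr f; rewrite /sec; congr (_ + _); apply: eq_bigr => q _.
by rewrite F_adj.
Qed.

(* On a point of the orbit of [richardson] this recovers the inverses of the
   coordinates of the torus. *)
Let Pi (k : nat) (x : mspace K ns) :=
  \prod_(q : nf | (h (sval q) == h k) && (sval q <= k)%N) (et q * F q (vsval x)).

Let Pi_pf k : polynomial_function (Pi k).
Proof. by apply: pf_prod => q; apply: pf_mul; [exact: pf_const|exact: Fv_pf]. Qed.

Let Pi_first k x : ~~ ((k < r)%N && nonfirst k) -> Pi k x = 1.
Proof.
move=> nk; apply: big1 => -[q hq] /= /andP[/eqP e le]; case/negP: nk.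
have hqp : (0 < h q)%N by apply: ns_pos.
have hk : (k < r)%N by apply: height_lt; rewrite -e.
rewrite hk /=; case/existsP: hq => c /eqP hc.
by apply/existsP; exists (widen_ord le c); rewrite /= hc e.
Qed.

(** On the orbit the factors are [d (prevcol q) / d q]; they telescope down to the first column of
    the height, where [d] is 1. *)
Let Pi_orbit g d x : G g -> (forall k, d k != 0) ->
  (forall k, ~~ ((k < r)%N && nonfirst k) -> d k = 1) ->
  vsval x = g *m (dg d *m xR *m dg (vinv d)) *m invmx g ->
  forall k, Pi k x = (d k)^-1.
Proof.
move=> Gg nz d1 ex k.
have ud := upper_dg d.
have eF q : et q * F q (vsval x) = d (prevcol (sval q)) / d (sval q).
  by rewrite ex F_G // F_dg //; last exact: upper_xR; rewrite F_xR mulrCA et2 mulr1.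
have [m] := ubnP k; elim: m k => // m IH k hm.
have [/andP[hk nk]|nk] := boolP ((k < r)%N && nonfirst k); last first.
  by rewrite Pi_first // d1 // invr1.
pose q : nf := exist _ (Ordinal hk) nk.
have [c1 c2 c3] := prevcolP nk.
rewrite /Pi (bigD1 q) /=; last by rewrite eqxx leqnn.
rewrite eF (eq_bigl (fun q' : nf => (h (sval q') == h (prevcol k)) && (sval q' <= prevcol k)%N)).
  rewrite -/(Pi _ x) IH; last by lia.
  by rewrite /= mulrAC divff ?mul1r.
move=> q'; rewrite c2 -andbA; case: eqP => //= e; apply/andP/idP => [[le ne]|le].
  have lt : (sval q' < k)%N.
    rewrite ltn_neqAle le andbT; apply: contra ne => /eqP e'.
    by apply/eqP/val_inj/val_inj.
  by rewrite leqNgt; apply/negP => gt; have := c3 (sval q'); rewrite gt lt e eqxx => /(_ isT).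
split; first by apply: leq_trans le (ltnW c1).
by apply/eqP => e'; move: le; rewrite e' /= leqNgt c1.
Qed.

(** On the dense orbit, hence everywhere, [f W] is a function of the invariants alone. Its value at
    [x] is therefore that at the section point with the same invariants, which is 0. As [W] does not
    vanish at [x_R], it can be cancelled. *)
Lemma section_inj f : polynomial_function f ->
  (forall g, G g -> forall x, f (adjoint K ns g x) = f x) ->
  (forall x, in_section x -> f x = 0) -> forall x, f x = 0.
Proof.
move=> hf fG f0.
have [N [Q [Qpf QE]]] := laurent hf.
pose W x := (\prod_(k < r) Pi k x) ^+ N.
have W_pf : polynomial_function W by apply: pf_exp; apply: pf_prod => k; apply: Pi_pf.
have key x : f x * W x = Q (fun k => Pi k x).
  apply/eqP; rewrite -subr_eq0; apply/eqP; move: x.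
  apply: (@dense_orbit K ns ns_pos (fun x => f x * W x - Q (fun k => Pi k x))).
    apply: pf_add; first exact: pf_mul.
    by apply: pf_opp; apply: Qpf; apply: Pi_pf.
  move=> p0 x pb pu; have [g [d [Gg nz d1 e]]] := orbit_torus ns_pos G_grp G_lie pb pu.
  rewrite e => ex; have eP := Pi_orbit Gg nz d1 ex.
  have -> : (fun k => Pi k x) = vinv d by apply: funext => k; apply: eP.
  rewrite -QE // /W (eq_bigr (fun k : 'I_r => (d k)^-1)) => [|k _]; last exact: eP.
  suff -> : x = adjoint K ns g (torus_point ns d) by rewrite fG // subrr.
  apply/val_inj; rewrite /= [RHS]G_adj // [LHS]ex vsprojKE //.
  exact: upper_dg.
apply: (@pf_mul_eq0 _ _ f W (vsproj (nilradical K ns) xR)) => // [x|].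
  rewrite key; have -> : (fun k => Pi k x) = (fun k => Pi k (sec x)).
    by apply: funext => k; apply: eq_bigr => q _; rewrite sec_F.
  by rewrite -key f0 ?mul0r.
rewrite expf_neq0 //; apply/prodf_neq0 => k _; apply/prodf_neq0 => q _.
by rewrite vsprojKE ?F_xR ?et2 ?oner_eq0 //; apply: upper_xR.
Qed.
End Data.

Theorem final_weierstrass :
  weierstrass_section G (adjoint K ns) (e_of K ns D) (V_of K ns D).
Proof.
have [p pP] := @fin_all_exists nf (fun=> _) basic basic_ex.
split.
- by move=> f [hf _]; exists f.
- move=> f1 f2 /set_mem[h1 i1] /set_mem[h2 i2] e.
  apply: funext => x; apply/eqP; rewrite -subr_eq0; apply/eqP; move: x.
  apply: (section_inj pP (f := fun x => f1 x - f2 x)).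
  + by apply: pf_add => //; apply: pf_opp.
  + by move=> g Gg x; rewrite i1 // i2.
  move=> x /sectionP hx; apply/eqP; rewrite subr_eq0; apply/eqP.
  have := congr1 (fun u => u (exist _ x (mem_set hx))) e.
  by rewrite /sigL.
move=> u [f hf ->]; have [H1 H2] := section_surj pP hf.
exists (fun x => f (section_point p x)) => //.
apply: funext => -[x hx]; rewrite /sigL /=; apply: H2.
by apply/sectionP; have := set_mem hx.
Qed.
End Assembly.

Local Close Scope ring_scope.

Theorem mainTheorem1 (R : realType) (ns : seq nat)
    (P' : set 'M[R[i]%C]_(sumn ns)) :
  ns <> [::] -> all (fun k => 0 < k) ns ->
  connected_algebraic_subgroup_SL P' ->
  lie_algebra P' = derived_algebra (parabolic R[i]%C ns) ->
  [/\ P1 ns (final_diagram ns),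
      P2 ns (final_diagram ns) &
      weierstrass_section P' (adjoint R[i]%C ns)
        (e_of R[i]%C ns (final_diagram ns))
        (V_of R[i]%C ns (final_diagram ns))].
Proof.
move=> _ ns_all P'_grp P'_lie; split.
- exact: final_P1.
- exact: final_P2.
exact: (@final_weierstrass R[i]%C).
Qed.
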